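(* Let $X=(X_t)_{t\ge0}$ be the process described in the context and let $\delta=\psi(1)/2$. The predictable quadratic variation of $X$ is $$\langle X,X\rangle_t=\delta t+(1-\delta)\int_0^t\frac{X_s^2}{s}\,ds .$$ Furthermore, for each $t>0$ it can be obtained as a limit in probability, $$\langle X,X\rangle_t=\mathbb{P}\text{-}\lim\sum_{k=0}^{n-1}\mathbb{E}\left[(X_{t_{k+1}}-X_{t_k})^2\,\middle|\,X_{t_k}\right],$$ where $0=t_0<t_1<\dots<t_n=t$ is a subdivision of $[0,t]$ and the limit is taken as the mesh $\max_k(t_{k+1}-t_k)$ tends to $0$.
   Context: $\varepsilon_a$ is the Dirac measure at $a$; $\phi(\mu,v,\cdot)$ is the density of the Gaussian distribution with mean $\mu$ and variance $v$. A family $(G_\sigma)_{\sigma\ge1}$ of probability measures on $[0,1]$ is a log-convolution semi-group if, for all $\sigma,\tau\ge1$, the product of two independent random variables with distributions $G_\sigma$ and $G_\tau$ has distribution $G_{\sigma\tau}$. It has Laplace exponent $\psi(\lambda)=\beta\lambda+\int_0^\infty(1-e^{-\lambda x})\nu(dx)$ if, for $R_\sigma$ distributed as $G_\sigma$, $L_\sigma(\lambda):=\mathbb{E}[(R_\sigma)^\lambda]=\sigma^{-\psi(\lambda)}$ for all $\sigma\ge1$, $\lambda>0$, where $\beta\ge0$ and $\nu$ is a measure on $[0,\infty)$ with $\nu(\{0\})=0$ and $\int_0^\infty(1\wedge x)\nu(dx)<\infty$. Standing setting: $(G_\sigma)_{\sigma\ge1}$ is a log-convolution semi-group with Laplace exponent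 $\psi$ satisfying $\psi(1/2)=1$ (equivalently $\mathbb{E}[\sqrt{R_\sigma}]=1/\sigma$). $X$ is the Markov martingale with $X_0=0$, adapted to a filtration $(\mathcal{F}_t)$ and Markov with respect to it, with right-continuous paths having left limits, and with transition probabilities: $P_{0,t}(x,dy)=\phi(x,t,y)\,dy$ for $t>0$, and for $0<s<t$, with $\sigma=\sqrt{t/s}$ and $\gamma(\sigma)=G_\sigma(\{1\})$, $$P_{s,t}(x,dy)=\gamma(\sigma)\,\varepsilon_{\sigma x}(dy)+\left(\int_{[0,1)}\phi\big(\sigma\sqrt r\,x,\;t(1-r),\;y\big)\,G_\sigma(dr)\right)dy.$$ Each $X_t$ is Gaussian with mean $0$ and variance $t$. The predictable quadratic variation $\langle X,X\rangle$ is the unique predictable increasing process, null at $0$, such that $X_t^2-\langle X,X\rangle_t$ is a martingale with respect to $(\mathcal{F}_t)$. *)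

(* Defs.v *)
From HB Require Import structures.
From mathcomp Require Import all_boot all_order all_algebra.
From mathcomp Require Import all_classical all_reals all_analysis.

Set Implicit Arguments.
Unset Strict Implicit.
Unset Printing Implicit Defensive.

Import Order.TTheory GRing.Theory Num.Theory.
Import numFieldNormedType.Exports.

Local Open Scope classical_set_scope.
Local Open Scope ring_scope.

(* Families indexed by times, or by sigma, are functions on the whole of R;   *)
(* only their values on [0, +oo[, resp. [1, +oo[, are ever constrained.       *)

Section log_convolution.
Context {R : realType}.

Definition independent_RV d (T : measurableType d) (P : probability T R)
    (U V : {RV P >-> R}) :=
  forall A B : set R, measurable A -> measurable B ->
    P (U @^-1` A `&` V @^-1` B) = (P (U @^-1` A) * P (V @^-1` B))%E.

Definition has_distribution d (T : measurableType d) (P : probability T R)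
    (U : T -> R) (mu : probability R R) :=
  forall B : set R, measurable B -> P (U @^-1` B) = mu B.

Definition log_convolution_semigroup (G : R -> probability R R) :=
  (forall sigma, 1 <= sigma -> G sigma `[0, 1]%classic = 1%E) /\
  (forall sigma tau, 1 <= sigma -> 1 <= tau ->
     forall d (T : measurableType d) (P : probability T R)
       (U V : {RV P >-> R}),
     has_distribution P U (G sigma) -> has_distribution P V (G tau) ->
     independent_RV U V ->
     has_distribution P (fun w => U w * V w) (G (sigma * tau))).

(* nu is a measure on [0, +oo[ without mass at 0, seen as a measure on R that *)
(* does not charge ]-oo, 0].                                                  *)
Definition has_laplace_exponent (G : R -> probability R R) (psi : R -> R) :=
  exists (beta : R) (nu : {measure set R -> \bar R}),
    [/\ 0 <= beta,
        nu `]-oo, 0]%classic = 0%E,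
        (\int[nu]_(x in `[0%R, +oo[) (Num.min 1 x)%:E < +oo)%E,
        forall lambda, 0 <= lambda ->
          psi lambda = beta * lambda +
            \int[nu]_(x in `[0, +oo[) (1 - expR (- (lambda * x))) &
        forall sigma lambda, 1 <= sigma -> 0 < lambda ->
          ('E_(G sigma)[(fun r : R => r `^ lambda)%R])%E = (sigma `^ (- psi lambda))%:E].

(* The second parameter is the variance, whereas normal_pdf takes the         *)
(* standard deviation.                                                        *)
Definition phi (m v y : R) : R := normal_pdf m (Num.sqrt v) y.

Definition transition (G : R -> probability R R) (s t x : R) (B : set R)
    : \bar R :=
  if s == 0 then (\int[lebesgue_measure]_(y in B) (phi x t y)%:E)%E
  else
    let sigma := Num.sqrt (t / s) in
    (G sigma [set 1%R] * \d_(sigma * x)%R B +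
     \int[lebesgue_measure]_(y in B)
       \int[G sigma]_(r in `[0%R, 1%R[)
         (phi (sigma * Num.sqrt r * x) (t * (1 - r)) y)%:E)%E.

End log_convolution.

Section processes.
Context {R : realType} {d : measure_display} {T : measurableType d}.
Variable P : probability T R.

Definition sigma_RV (Y : T -> R) : set_system T :=
  preimage_set_system setT Y measurable.

Definition measurable_wrt (H : set_system T) (Y : T -> R) :=
  sigma_RV Y `<=` H.

Definition is_condexp (H : set_system T) (Z Y : T -> R) :=
  [/\ P.-integrable setT (EFin \o Z),
      P.-integrable setT (EFin \o Y),
      measurable_wrt H Y &
      forall A, H A -> (\int[P]_(w in A) (Z w)%:E = \int[P]_(w in A) (Y w)%:E)%E].

(* A chosen version of E[Z | H]; versions are unique up to a null set and     *)
(* exist when Z is integrable and H is a sub-sigma-algebra.                   *)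
Definition condexp (Z : T -> R) (H : set_system T) : T -> R :=
  xget (fun=> 0) [set Y | is_condexp H Z Y].

Definition filtration (F : R -> set_system T) :=
  [/\ forall t, 0 <= t -> sigma_algebra setT (F t),
      forall t, 0 <= t -> F t `<=` measurable &
      forall s t, 0 <= s -> s <= t -> F s `<=` F t].

Definition adapted (F : R -> set_system T) (X : R -> T -> R) :=
  forall t, 0 <= t -> measurable_wrt (F t) (X t).

Definition martingale (F : R -> set_system T) (M : R -> T -> R) :=
  adapted F M /\ forall s t, 0 <= s -> s <= t -> is_condexp (F s) (M t) (M s).

Definition cadlag (X : R -> T -> R) :=
  forall w, (forall t, 0 <= t -> X u w @[u --> t^'+] --> X t w) /\
            (forall t, 0 < t -> cvg (X u w @[u --> t^'-])).

Definition markov_process (F : R -> set_system T) (X : R -> T -> R)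
    (Q : R -> R -> R -> set R -> \bar R) :=
  forall s t, 0 <= s -> s < t -> forall B : set R, measurable B ->
    is_condexp (F s) (fun w => \1_B (X t w)) (fun w => fine (Q s t (X s w) B)).

Definition predictable_rectangles (F : R -> set_system T)
    : set_system (R * T) :=
  [set C | (exists2 A, F 0 A & C = [set 0] `*` A) \/
           (exists s t A, [/\ 0 <= s, s < t, F s A & C = `]s, t]%classic `*` A])].

Definition predictable (F : R -> set_system T) (A : R -> T -> R) :=
  let D : set (R * T) := `[0, +oo[%classic `*` setT in
  preimage_set_system D (fun p => A p.1 p.2) measurable
    `<=` <<s D, predictable_rectangles F >>.

Definition increasing_process (A : R -> T -> R) :=
  forall w, (forall s t, 0 <= s -> s <= t -> A s w <= A t w) /\
            (forall t, 0 <= t -> A u w @[u --> t^'+] --> A t w).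

Definition compensates_square (F : R -> set_system T) (X A : R -> T -> R) :=
  [/\ predictable F A, increasing_process A, forall w, A 0 w = 0 &
      martingale F (fun t w => X t w ^+ 2 - A t w)].

(* A is <X, X>; uniqueness is up to indistinguishability. *)
Definition is_predictable_qv (F : R -> set_system T) (X A : R -> T -> R) :=
  compensates_square F X A /\
  forall B, compensates_square F X B ->
    {ae P, forall w, forall t, 0 <= t -> B t w = A t w}.

Definition subdivision (t : R) (n : nat) (p : nat -> R) :=
  [/\ p 0%N = 0, p n = t & forall k, (k < n)%N -> p k < p k.+1].

Definition mesh (n : nat) (p : nat -> R) : R :=
  \big[Num.max/0]_(k < n) (p k.+1 - p k).

Definition cvg_in_prob_mesh (t : R) (S : nat -> (nat -> R) -> T -> R)
    (Y : T -> R) :=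
  forall eps eta : R, 0 < eps -> 0 < eta ->
    exists2 h : R, 0 < h &
      forall n p, subdivision t n p -> mesh n p < h ->
        (P [set w | (eps <= `|S n p w - Y w|)%R] < eta%:E)%E.

End processes.

(* Main.v *)
(* By the Markov property, E[X_t^2 | F_s] is an explicit affine function of
   X_s^2 for 0 < s < t, in which only the powers (t/s)^(1-delta) and
   (t/s)^(-delta) of t/s occur, because psi(1) = 2 delta; psi(1/2) = 1 and
   Jensen's inequality give delta <= 1. Integrating
   d/du E[1_E X_u^2] = delta P(E) + (1 - delta) E[1_E X_u^2 / u] for E in F_s
   and exchanging integrals, X^2 - A is a martingale. A is continuous and
   adapted, hence predictable.

   Uniqueness: a predictable increasing B compensating X^2 defines, by the
   change of time u = B_s(w), the measure dB_s(w) P(dw) on R x T. On predictable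
   rectangles it depends only on X, so two compensators A and B give the same
   measure on predictable sets. For the convex function
   F(x) = sqrt(1 + x^2) - 1 and the predictable process N = B - A,
   E F(N_c) <= lim sum E[F'(N_{k+1}) (N_{k+1} - N_k)] = int F'(N) (dB - dA) dP,
   which is 0 because F' is bounded; hence N_c = 0.

   Approximation: given F_{t_k}, the increment
   c_k = E[(X_{t_{k+1}} - X_{t_k})^2 | X_{t_k}] and the increment of A have the
   same conditional expectation, so the defects D_k = (A_{t_{k+1}} - A_{t_k}) - c_k
   are orthogonal in L^2, and E D_k^2 <= E (A_{t_{k+1}} - A_{t_k})^2
   <= 64 (t_{k+1} - t_k)^2 by the fourth moments of X. The sum of the D_k thus has
   variance at most 64 t mesh, and Chebyshev's inequality concludes. *)
Require Import Defs.
From HB Require Import structures.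
From mathcomp Require Import all_boot all_order all_algebra.
From mathcomp Require Import all_classical all_reals all_analysis.
From mathcomp Require Import measurable_realfun measurable_function ring lra.

Set Implicit Arguments.
Unset Strict Implicit.
Unset Printing Implicit Defensive.

Import Order.TTheory GRing.Theory Num.Theory.
Import numFieldNormedType.Exports.

Local Open Scope classical_set_scope.
Local Open Scope ring_scope.

(** * Conditional expectations *)

(** Compensators must have their path properties for every [w], and the filtration is not completed,
    so [A] cannot freely be modified on a null set. What saves the definition is a dichotomy: on
    each path [X_s^2 / s] is integrable on every [[0, c]], or on no [[0, c]] with [c > 0]. In the
    second case the real integral takes its default value 0 throughout, and [A] reduces to
    [delta * t], still continuous and increasing. The convex function of the uniqueness argument has
    linear growth because compensators are only known to be integrable. Tangents are taken at the
    right end of each cell: there convexity bounds increments from above, and right continuity of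
    [N] makes the resulting step functions converge to [F'(N_s)] itself, a predictable integrand.
    Gaussian moments come from comparing densities with different means or deviations through
    [1 + x <= expR x]. The number 64 is a crude bound for the fourth moment of a standard Gaussian,
    found by doubling the deviation. It bounds [E[(X_u^2 / u)^2]] uniformly in [u], so the
    singularity of [1 / s] at 0 does no harm to the estimates. *)

Section nonnegative_functions.
Import HBNNSimple.

(** Functional monotone class argument: simple functions are built from indicators by sums and
    scalings, and increase to any nonnegative measurable function. Every later extension from sets
    to functions (pulling out, Markov property, predictable integrands) is an instance. *)
Lemma nnfun_ind d (T : measurableType d) (R : realType) (C : (T -> R) -> Prop) :
  (forall A, measurable A -> C \1_A) ->
  (forall f g : T -> R, measurable_fun setT f -> measurable_fun setT g ->
     (forall x, 0 <= f x) -> (forall x, 0 <= g x) -> C f -> C g -> C (f \+ g)) ->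
  (forall (k : R) (f : T -> R), 0 <= k -> measurable_fun setT f -> (forall x, 0 <= f x) ->
     C f -> C (fun x => k * f x)) ->
  (forall (h : nat -> T -> R) (f : T -> R), (forall n, measurable_fun setT (h n)) ->
     (forall n x, 0 <= h n x) -> (forall x, nondecreasing_seq (h ^~ x)) ->
     measurable_fun setT f -> (forall x, h ^~ x @ \oo --> f x) ->
     (forall n, C (h n)) -> C f) ->
  forall f : T -> R, measurable_fun setT f -> (forall x, 0 <= f x) -> C f.
Proof.
move=> C1 CD CZ Clim f mf f0.
have mEf : measurable_fun setT (EFin \o f) by exact/measurable_EFinP.
pose g := nnsfun_approx measurableT mEf.
apply: (Clim (fun n => (g n : T -> R)) f) => //.
- move=> x m n mn; exact: (lefP _ _ (nd_nnsfun_approx measurableT mEf mn)).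
- move=> x; have := @cvg_nnsfun_approx _ _ _ setT measurableT _ mEf _ x.
  move=> /(_ _ I) c; apply: (fine_cvg (f := EFin \o (g ^~ x)) (c _)) => y _.
  by rewrite lee_fin.
(* A simple function is the sum of its values times the indicators of its level sets; the induction
   runs over the list of values, all of them nonnegative. *)
move=> n; rewrite (_ : (g n : T -> R) = (fun x => \sum_(y <- finmap.enum_fset (fset_set (range (g n))))
    (y * \1_(g n @^-1` [set y]) x))); last first.
  by apply/funext => x; rewrite [LHS]fimfunE fsbig_finite//=.
have : all (fun y => 0 <= y) (finmap.enum_fset (fset_set (range (g n)))).
  apply/allP => y; rewrite in_fset_set// inE => -[x _ <-]; exact: fun_ge0.
have mfS s : measurable_fun setT (fun x => \sum_(y <- s) y * (\1_(g n @^-1` [set y]) x : R)).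
  apply: measurable_sum => y; apply: measurable_funM => //; exact: measurable_indic.
elim: (finmap.enum_fset _) => [_|y s IH /= /andP[y0 s0]].
  under eq_fun do rewrite big_nil.
  rewrite (_ : (fun=> 0) = (fun x => 0 * \1_(@setT T) x)); last first.
    by apply/funext => x; rewrite mul0r.
  by apply: CZ => //; exact: C1.
under eq_fun do rewrite big_cons.
apply: (CD (fun x => y * _) (fun x => \sum_(j <- s) _)) => //.
- apply: measurable_funM => //; exact: measurable_indic.
- by move=> x; rewrite mulr_ge0.
- move=> x; rewrite big_seq sumr_ge0// => z zs; rewrite mulr_ge0//.
  by move/allP : s0; apply.
- apply: CZ => //; exact: C1.
- exact: IH.
Qed.

End nonnegative_functions.

Section sub_sigma_algebra.
Context {R : realType} {d : measure_display} {T : measurableType d}.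
Variables (P : probability T R) (H : set_system T).
Hypotheses (sH : sigma_algebra setT H) (Hm : H `<=` measurable).

Let gH : <<s H >> = H.
Proof. exact: sigma_algebra_id. Qed.

(** Turns measurability for a sub-sigma-algebra into ordinary measurability on the retyped space,
    where the usual closure lemmas apply. *)
Lemma measurable_wrtP (Y : T -> R) :
  measurable_wrt H Y <->
  measurable_fun setT (Y : g_sigma_algebraType H -> R).
Proof.
split => [HY _ B mB|mY A [B mB <-]].
  rewrite /measurable/= gH; apply: HY; by exists B.
by have := mY measurableT B mB; rewrite /measurable/= gH.
Qed.

Lemma measurable_fun_wrt (Y : T -> R) :
  measurable_wrt H Y -> measurable_fun setT Y.
Proof. by move=> HY _ B mB; apply: Hm; apply: HY; exists B. Qed.

Lemma sub_sigma_setT : H setT.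
Proof. by case: sH => H0 HC _; rewrite -(setD0 setT); exact: HC. Qed.

(** For an indicator [Y] this is the hypothesis; [nnfun_ind] on the space retyped with [H] does the
    rest. Equality holds in [[0, +oo]], where monotone limits pass freely. *)
Lemma ge0_integral_pull_out (Y Z1 Z2 : T -> R) :
  measurable_fun setT Z1 -> measurable_fun setT Z2 ->
  (forall w, 0 <= Z1 w) -> (forall w, 0 <= Z2 w) ->
  (forall A, H A -> \int[P]_(w in A) (Z1 w)%:E = \int[P]_(w in A) (Z2 w)%:E)%E ->
  measurable_wrt H Y -> (forall w, 0 <= Y w) ->
  (\int[P]_w (Y w * Z1 w)%:E = \int[P]_w (Y w * Z2 w)%:E)%E.
Proof.
move=> mZ1 mZ2 Z10 Z20 eqZ /measurable_wrtP mY Y0.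
have mH (f : g_sigma_algebraType H -> R) :
    measurable_fun setT f -> measurable_fun setT (f : T -> R).
  by move=> mf; apply: measurable_fun_wrt; exact/measurable_wrtP.
move: Y mY Y0.
apply: (@nnfun_ind _ (g_sigma_algebraType H) R (fun Y =>
  (\int[P]_w (Y w * Z1 w)%:E = \int[P]_w (Y w * Z2 w)%:E)%E)).
- move=> A mA.
  have HA : H A by move: mA; rewrite /measurable/= gH.
  have := eqZ A HA; rewrite integral_mkcond [in RHS]integral_mkcond => e.
  transitivity (\int[P]_x (((fun w => (Z1 w)%:E) \_ A) x))%E.
    apply: eq_integral => x _; rewrite patchE indicE.
    by case: ifPn => _; rewrite ?mul1r ?mul0r.
  rewrite e; apply: eq_integral => x _; rewrite patchE indicE.
  by case: ifPn => _; rewrite ?mul1r ?mul0r.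
- move=> f g mf mg f0 g0 ef eg.
  have D (Z : T -> R) : measurable_fun setT Z -> (forall w, 0 <= Z w) ->
      (\int[P]_w ((f \+ g) w * Z w)%:E =
        \int[P]_w (f w * Z w)%:E + \int[P]_w (g w * Z w)%:E)%E.
    move=> mZ Z0; under eq_integral do rewrite /= mulrDl EFinD.
    rewrite ge0_integralD//.
    + by move=> x _; rewrite lee_fin mulr_ge0.
    + by apply/measurable_EFinP/measurable_funM => //; exact: mH.
    + by move=> x _; rewrite lee_fin mulr_ge0.
    + by apply/measurable_EFinP/measurable_funM => //; exact: mH.
  by rewrite !D// ef eg.
- move=> k f k0 mf f0 ef.
  have D (Z : T -> R) : measurable_fun setT Z -> (forall w, 0 <= Z w) ->
      (\int[P]_w (k * f w * Z w)%:E = k%:E * \int[P]_w (f w * Z w)%:E)%E.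
    move=> mZ Z0; under eq_integral do rewrite /= -mulrA EFinM.
    rewrite ge0_integralZl_EFin//.
    + by move=> x _; rewrite lee_fin mulr_ge0.
    + by apply/measurable_EFinP/measurable_funM => //; exact: mH.
  by rewrite !D// ef.
- move=> h f mh h0 ndh mf hf eh.
  have D (Z : T -> R) : measurable_fun setT Z -> (forall w, 0 <= Z w) ->
      (\int[P]_w (h n w * Z w)%:E @[n --> \oo] -->
       \int[P]_w (f w * Z w)%:E)%E.
    move=> mZ Z0.
    rewrite (_ : (\int[P]_w (f w * Z w)%:E)%E =
        (\int[P]_w limn (fun n => (h n w * Z w)%:E))%E); last first.
      apply: eq_integral => w _; apply/esym/cvg_lim => //.
      apply: cvg_EFin; first exact: nearW.
      by apply: cvgMl => //; exact: hf.
    apply: cvg_monotone_convergence => //.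
    + by move=> n; apply/measurable_EFinP/measurable_funM => //; exact: mH.
    + by move=> n w _; rewrite lee_fin mulr_ge0.
    + by move=> w _ m n mn; rewrite lee_fin ler_wpM2r//; exact: ndh.
  have c1 := D _ mZ1 Z10; have := D _ mZ2 Z20.
  under eq_fun do rewrite -eh.
  move=> c2.
  by rewrite -(cvg_lim _ c1)// -(cvg_lim _ c2).
Qed.

End sub_sigma_algebra.

Section real_integrals.
Context d (T : measurableType d) (R : realType) (mu : {measure set T -> \bar R}).
Variables (D : set T) (mD : measurable D).
Implicit Types f g : T -> R.

Lemma rintegrableD f g : mu.-integrable D (EFin \o f) ->
  mu.-integrable D (EFin \o g) ->
  mu.-integrable D (EFin \o (fun x => f x + g x)).
Proof. by move=> i j; exact: (integrableD mD i j). Qed.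

Lemma rintegrableB f g : mu.-integrable D (EFin \o f) ->
  mu.-integrable D (EFin \o g) ->
  mu.-integrable D (EFin \o (fun x => f x - g x)).
Proof. by move=> i j; exact: (integrableB mD i j). Qed.

Lemma rintegrableZ (k : R) f : mu.-integrable D (EFin \o f) ->
  mu.-integrable D (EFin \o (fun x => k * f x)).
Proof. by move=> i; exact: (integrableZl mD k i). Qed.

Lemma rintegrable_measurable f :
  mu.-integrable D (EFin \o f) -> measurable_fun D f.
Proof. by move=> /measurable_int/measurable_EFinP. Qed.

Lemma rintegrable_le f g : measurable_fun D f ->
  (forall x, D x -> `|f x| <= `|g x|) ->
  mu.-integrable D (EFin \o g) -> mu.-integrable D (EFin \o f).
Proof.
move=> mf fg; apply: le_integrable => //; first exact/measurable_EFinP.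
Qed.

Lemma integral_Rintegral f : mu.-integrable D (EFin \o f) ->
  (\int[mu]_(x in D) (f x)%:E = (\int[mu]_(x in D) f x)%R%:E)%E.
Proof. by move=> i; rewrite /Rintegral fineK//; exact: integrable_fin_num. Qed.

Lemma ge0_rintegrable f : measurable_fun D f -> (forall x, D x -> 0 <= f x) ->
  (\int[mu]_(x in D) (f x)%:E < +oo)%E -> mu.-integrable D (EFin \o f).
Proof.
move=> mf f0 foo; apply/integrableP; split; first exact/measurable_EFinP.
rewrite (eq_integral (fun x => (f x)%:E))// => x; rewrite inE => Dx.
by rewrite /= ger0_norm// f0.
Qed.

End real_integrals.

Section conditional_expectation.
Context {R : realType} {d : measure_display} {T : measurableType d}.
Variables (P : probability T R) (H : set_system T).
Hypotheses (sH : sigma_algebra setT H) (Hm : H `<=` measurable).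
Local Notation intg f := (P.-integrable setT (EFin \o f)).

(** Zero integrals of [Z] over [H] mean that the positive and negative parts of [Z] have the same
    integrals over [H], so the nonnegative version applies to each of the two parts of [Y]. This is
    the source of every orthogonality below. *)
Lemma integral_pull_out0 (Y Z : T -> R) :
  intg Z -> (forall A, H A -> \int[P]_(w in A) Z w = 0) ->
  measurable_wrt H Y -> intg (fun w => Y w * Z w) ->
  \int[P]_w (Y w * Z w) = 0.
Proof.
move=> iZ Z0 mY iYZ.
have mZ : measurable_fun setT Z := rintegrable_measurable iZ.
have mYT : measurable_fun setT Y := measurable_fun_wrt Hm mY.
have iS A (f : T -> R) : measurable A -> intg f ->
    P.-integrable A (EFin \o f).
  by move=> mA; apply: integrableS.
have ip : intg (Z^\+)%R by exact: integrable_funrpos.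
have im : intg (Z^\-)%R by exact: integrable_funrneg.
have eqZ A : H A ->
    (\int[P]_(w in A) ((Z^\+)%R w)%:E = \int[P]_(w in A) ((Z^\-)%R w)%:E)%E.
  move=> HA; have mA := Hm HA.
  rewrite !integral_Rintegral//; [|exact: iS..].
  congr EFin; apply/eqP; rewrite -subr_eq0 -RintegralB//; [|exact: iS..].
  rewrite -[X in _ == X](Z0 A HA); apply/eqP/eq_Rintegral => w _.
  by rewrite -[in RHS](funrposBneg Z).
have key (U : T -> R) : measurable_wrt H U -> (forall w, 0 <= U w) ->
    (forall w, `|U w| <= `|Y w|) -> intg (fun w => U w * Z w) /\
    \int[P]_w (U w * Z w) = 0.
  move=> mU U0 UY.
  have mUT : measurable_fun setT U := measurable_fun_wrt Hm mU.
  have iUZ : intg (fun w => U w * Z w).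
    apply: rintegrable_le iYZ => //; first exact: measurable_funM.
    by move=> w _; rewrite !normrM ler_wpM2r.
  have iUp : intg (fun w => U w * (Z^\+)%R w).
    apply: rintegrable_le iUZ => //.
      by apply: measurable_funM => //; exact: measurable_funrpos.
    move=> w _; rewrite !normrM ler_wpM2l//.
    by rewrite ger0_norm ?funrpos_ge0// /funrpos ge_max ler_norm normr_ge0.
  have iUm : intg (fun w => U w * (Z^\-)%R w).
    apply: rintegrable_le iUZ => //.
      by apply: measurable_funM => //; exact: measurable_funrneg.
    move=> w _; rewrite !normrM ler_wpM2l//.
    by rewrite ger0_norm ?funrneg_ge0// /funrneg ge_max normr_ge0 andbT -normrN ler_norm.
  split => //.
  rewrite -[RHS](subrr (\int[P]_w (U w * (Z^\+)%R w))).
  rewrite [X in _ - X](_ : _ = \int[P]_w (U w * (Z^\-)%R w)); last first.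
    congr fine; apply: (ge0_integral_pull_out sH Hm) => //.
    - exact: measurable_funrpos.
    - exact: measurable_funrneg.
  rewrite -RintegralB//; apply: eq_Rintegral => w _.
  by rewrite -mulrBr; congr (_ * _); rewrite -[in LHS](funrposBneg Z).
have mp : measurable_wrt H (Y^\+)%R.
  by apply/measurable_wrtP => //; apply: measurable_funrpos; exact/measurable_wrtP.
have mm : measurable_wrt H (Y^\-)%R.
  by apply/measurable_wrtP => //; apply: measurable_funrneg; exact/measurable_wrtP.
have [|i1 e1] := key _ mp (funrpos_ge0 Y).
  move=> w; rewrite ger0_norm ?funrpos_ge0//.
  by rewrite /funrpos ge_max ler_norm normr_ge0.
have [|i2 e2] := key _ mm (funrneg_ge0 Y).
  move=> w; rewrite ger0_norm ?funrneg_ge0//.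
  by rewrite /funrneg ge_max normr_ge0 andbT -normrN ler_norm.
rewrite -[RHS]subr0 -{1}e1 -e2 -RintegralB//; apply: eq_Rintegral => w _.
by rewrite -mulrBl; congr (_ * _); rewrite -[in LHS](funrposBneg Y).
Qed.

Lemma is_condexp_diff (Z Y : T -> R) : is_condexp P H Z Y ->
  forall A, H A -> \int[P]_(w in A) (Z w - Y w) = 0.
Proof.
move=> [iZ iY mY e] A HA; have mA := Hm HA.
have iS (f : T -> R) : intg f -> P.-integrable A (EFin \o f).
  by apply: integrableS.
by rewrite RintegralB//; [rewrite /Rintegral e// subrr|exact: iS..].
Qed.

(** The difference [U] of two versions is tested against its own sign, which is measurable for [H];
    this gives [E|U| = 0]. *)
Lemma is_condexp_unique (Z Y Y' : T -> R) :
  is_condexp P H Z Y -> is_condexp P H Z Y' -> ae_eq P setT Y Y'.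
Proof.
move=> cY cY'; have [iZ iY mY eY] := cY; have [_ iY' mY' eY'] := cY'.
pose U w := Y w - Y' w.
have mU : measurable_wrt H U.
  by apply/measurable_wrtP => //; apply: measurable_funB; exact/measurable_wrtP.
have iU : intg U by exact: rintegrableB.
have U0 A : H A -> \int[P]_(w in A) U w = 0.
  move=> HA; have mA := Hm HA.
  have iS (f : T -> R) : intg f -> P.-integrable A (EFin \o f).
    by apply: integrableS.
  rewrite RintegralB//; [|exact: iS..].
  by rewrite /Rintegral -eY// -eY'// subrr.
pose s w : R := if 0 <= U w then 1 else -1.
have sE w : s w * U w = `|U w|.
  rewrite /s; case: ifPn => [h|]; first by rewrite mul1r ger0_norm.
  by rewrite -ltNge => h; rewrite mulN1r ltr0_norm.
have ms : measurable_wrt H s.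
  apply/measurable_wrtP => //; apply: measurable_fun_ifT => //.
  by apply: measurable_fun_ler => //; exact/measurable_wrtP.
have iN : intg (fun w => `|U w|) by exact: integrable_norm.
have := integral_pull_out0 iU U0 ms.
rewrite (_ : (fun w => s w * U w) = fun w => `|U w|); last exact/funext.
move=> /(_ iN) e.
have e' : (\int[P]_w `|(EFin \o U) w| = 0)%E.
  by rewrite -[RHS](congr1 EFin e) -[RHS]integral_Rintegral.
have mEU : measurable_fun setT (EFin \o U).
  by apply/measurable_EFinP; exact: measurable_fun_wrt mU.
have [h _] := ae_eq_integral_abs P measurableT mEU.
apply: filterS (h e') => w hw Tw.
by have [/eqP] := hw Tw; rewrite subr_eq0 => /eqP.
Qed.

End conditional_expectation.

(** * Gaussian moments *)

Section gaussian_moments.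
Context {R : realType}.
Local Notation mu := (@lebesgue_measure R).
Implicit Types m s u y : R.

(** Rescaling the deviation by [u] amounts to an exponential tilt by a quadratic. Integrating a
    lower bound of the exponential turns the known total mass into a bound on moments. *)
Lemma normal_pdf_tilt m s u y : 0 < s -> 0 < u ->
  u * normal_pdf m (s * u) y =
  normal_pdf m s y * expR ((1 - u ^- 2) * ((y - m) ^+ 2 / (s ^+ 2 *+ 2))).
Proof.
move=> s0 u0; rewrite !normal_pdfE ?gt_eqF ?mulr_gt0//.
rewrite /normal_fun -[RHS]mulrA -expRD mulrA; congr (_ * expR _).
  rewrite /normal_peak exprMn -!mulrnAr -mulrA (mulrC (u ^+ 2)) mulrA.
  rewrite [in LHS]sqrtrM; last by rewrite mulr_ge0 ?sqr_ge0// mulrn_wge0 ?pi_ge0.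
  by rewrite sqrtr_sqr (gtr0_norm u0) invfM mulrCA divff ?mulr1 ?gt_eqF.
by field; rewrite !gt_eqF.
Qed.

(** The analogous tilt by a linear exponent, which moves the mean. *)
Lemma normal_pdf_shift m s (t : R) y : 0 < s ->
  expR (t ^+ 2 * s ^+ 2 / 2) * normal_pdf (m + t * s ^+ 2) s y =
  normal_pdf m s y * expR (t * (y - m)).
Proof.
move=> s0; rewrite !normal_pdfE ?gt_eqF// /normal_fun mulrCA -[RHS]mulrA.
by congr (_ * _); rewrite -!expRD; congr expR; field; rewrite gt_eqF.
Qed.

Lemma measurable_poly_normal_pdf m s (f : R -> R) : measurable_fun setT f ->
  measurable_fun setT (fun y => (f y * normal_pdf m s y)%:E).
Proof.
move=> mf; apply/measurable_EFinP/measurable_funM => //.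
exact: measurable_normal_pdf.
Qed.

Let mvar m : measurable_fun setT (fun y : R => (y - m) ^+ 2).
Proof. by apply: measurable_funX; exact: measurable_funB. Qed.

(** Let [J] be the mean of [x = (y - m)^2 / (2 s^2)]. Integrating [normal_pdf_tilt] with
    [1 + z <= expR z] gives [1 + (1 - u^-2) J <= u] for every [u > 0], and [u] tending to 1 from
    both sides forces [J = 1 / 2]. The cases [u > 1] and [u < 1] are separate because the
    coefficient changes sign and the integrals must stay nonnegative. *)
Lemma normal_variance m s : 0 < s ->
  (\int[mu]_y ((y - m) ^+ 2 * normal_pdf m s y)%:E = (s ^+ 2)%:E)%E.
Proof.
move=> s0; set I := (X in X = _).
pose x y : R := (y - m) ^+ 2 / (s ^+ 2 *+ 2).
have x0 y : 0 <= x y by rewrite mulr_ge0 ?sqr_ge0// invr_ge0 mulrn_wge0// sqr_ge0.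
have mx : measurable_fun setT x by exact: measurable_funM.
pose J := (\int[mu]_y (x y * normal_pdf m s y)%:E)%E.
have J0 : (0 <= J)%E.
  by apply: integral_ge0 => y _; rewrite lee_fin mulr_ge0 ?normal_pdf_ge0.
have IJ : I = ((s ^+ 2 *+ 2)%:E * J)%E.
  rewrite /J -ge0_integralZl_EFin//.
  - apply: eq_integral => y _; rewrite -EFinM; congr EFin; rewrite /x.
    by field; rewrite gt_eqF.
  - by move=> y _; rewrite lee_fin mulr_ge0 ?normal_pdf_ge0.
  - exact: measurable_poly_normal_pdf.
  - by rewrite mulrn_wge0 ?sqr_ge0.
have ub u : 1 < u -> ((1 - u ^- 2)%:E * J + 1 <= u%:E)%E.
  move=> u1; have u0 : 0 < u := lt_trans ltr01 u1.
  have t0 : 0 <= 1 - u ^- 2.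
    by rewrite subr_ge0 invf_le1 ?exprn_gt0// exprn_ege1// ltW.
  rewrite /J -ge0_integralZl_EFin//; last 2 first.
  - by move=> y _; rewrite lee_fin mulr_ge0 ?normal_pdf_ge0.
  - exact: measurable_poly_normal_pdf.
  rewrite -(integral_normal_pdf m s) -ge0_integralD//; last 4 first.
  - by move=> y _; apply: mule_ge0; rewrite lee_fin ?t0 // mulr_ge0 ?x0 ?normal_pdf_ge0.
  - by apply: measurable_funeM; exact: measurable_poly_normal_pdf.
  - by move=> y _; rewrite lee_fin normal_pdf_ge0.
  - by apply/measurable_EFinP; exact: measurable_normal_pdf.
  apply: (@le_trans _ _ (\int[mu]_y (u%:E * (normal_pdf m (s * u) y)%:E))%E).
    apply: ge0_le_integral => //.
    - move=> y _; apply: adde_ge0; last by rewrite lee_fin normal_pdf_ge0.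
      by apply: mule_ge0; rewrite lee_fin ?t0 // mulr_ge0 ?x0 ?normal_pdf_ge0.
    - apply: emeasurable_funD.
        by apply: measurable_funeM; exact: measurable_poly_normal_pdf.
      by apply/measurable_EFinP; exact: measurable_normal_pdf.
    - by apply: measurable_funeM; apply/measurable_EFinP; exact: measurable_normal_pdf.
    - move=> y _; rewrite -!EFinM -EFinD lee_fin normal_pdf_tilt//.
      have := ler_wpM2l (normal_pdf_ge0 m s y) (expR_ge1Dx ((1 - u ^- 2) * x y)).
      by apply: le_trans; rewrite le_eqVlt; apply/orP; left; apply/eqP; ring.
  rewrite ge0_integralZl_EFin//; last 3 first.
  - by move=> y _; rewrite lee_fin normal_pdf_ge0.
  - by apply/measurable_EFinP; exact: measurable_normal_pdf.
  - exact: ltW.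
  by rewrite integral_normal_pdf mule1.
have lb u : 0 < u -> u < 1 -> (1 <= u%:E + (u ^- 2 - 1)%:E * J)%E.
  move=> u0 u1.
  have t0 : 0 <= u ^- 2 - 1.
    by rewrite subr_ge0 invf_ge1 ?exprn_gt0// exprn_ile1// ltW.
  rewrite /J -ge0_integralZl_EFin//; last 2 first.
  - by move=> y _; rewrite lee_fin mulr_ge0 ?normal_pdf_ge0.
  - exact: measurable_poly_normal_pdf.
  rewrite -[X in (_ <= X + _)%E]mule1 -{2}(integral_normal_pdf m (s * u)).
  rewrite -ge0_integralZl_EFin//; last 3 first.
  - by move=> y _; rewrite lee_fin normal_pdf_ge0.
  - by apply/measurable_EFinP; exact: measurable_normal_pdf.
  - exact: ltW.
  rewrite -(integral_normal_pdf m s) -ge0_integralD//; last 4 first.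
  - by move=> y _; rewrite mule_ge0 ?lee_fin ?normal_pdf_ge0// ltW.
  - by apply: measurable_funeM; apply/measurable_EFinP; exact: measurable_normal_pdf.
  - by move=> y _; apply: mule_ge0; rewrite lee_fin ?t0 // mulr_ge0 ?x0 ?normal_pdf_ge0.
  - by apply: measurable_funeM; exact: measurable_poly_normal_pdf.
  apply: ge0_le_integral => //.
  - by move=> y _; rewrite lee_fin normal_pdf_ge0.
  - by apply/measurable_EFinP; exact: measurable_normal_pdf.
  - apply: emeasurable_funD.
      by apply: measurable_funeM; apply/measurable_EFinP; exact: measurable_normal_pdf.
    by apply: measurable_funeM; exact: measurable_poly_normal_pdf.
  - move=> y _; rewrite -!EFinM -EFinD lee_fin normal_pdf_tilt//.
    have := ler_wpM2l (normal_pdf_ge0 m s y) (expR_ge1Dx ((1 - u ^- 2) * x y)).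
    rewrite -/(x y); set a := normal_pdf m s y * expR _ => h.
    by rewrite -lerBlDr; apply: le_trans h; rewrite le_eqVlt; apply/orP; left; apply/eqP; ring.
(* The single value [u = 2] already excludes [J = +oo]. *)
have Jfin : J \is a fin_num.
  rewrite ge0_fin_numE// ltey; apply/negP => /eqP Joo.
  have := ub 2 (ltr1n _ 2); rewrite Joo gt0_muley ?addye ?leye_eq//.
  by rewrite lte_fin subr_gt0 -natrX invf_lt1 ?ltr1n ?ltr0n.
rewrite IJ -(fineK Jfin) -EFinM; congr EFin.
suff -> : fine J = 1 / 2 by rewrite -mulr_natr -mulrA mul1r divff ?mulr1.
have ub' u : 1 < u -> (1 - u ^- 2) * fine J + 1 <= u.
  by move=> /ub; rewrite -(fineK Jfin) -EFinM -EFinD lee_fin.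
have lb' u : 0 < u -> u < 1 -> 1 <= u + (u ^- 2 - 1) * fine J.
  by move=> u0 /(lb _ u0); rewrite -(fineK Jfin) -EFinM -EFinD lee_fin.
set j := fine J in ub' lb' *.
apply/eqP; rewrite eq_le; apply/andP; split.
  apply/ler_addgt0Pr => e e0.
  (* At [u = 1 + e' / 2], after division by [e' / 2], the bound reads
     [j (2 + e' / 2) <= (1 + e' / 2)^2]; the cap of [e'] at 1 controls the quadratic term. *)
  pose e' := Num.min e 1; have e'0 : 0 < e' by rewrite lt_min e0 ltr01.
  have := ub' (1 + e' / 2); rewrite ltrDl divr_gt0// => /(_ erefl).
  move=> h; apply: (@le_trans _ _ (1 / 2 + e')); last by rewrite lerD2l ge_min lexx.
  have e'1 : e' <= 1 by rewrite ge_min lexx orbT.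
  have : ((1 + e' / 2) ^+ 2 - 1) * j <= (e' / 2) * (1 + e' / 2) ^+ 2.
    move: h; rewrite -lerBrDr [X in _ <= X -> _]addrAC subrr add0r => h.
    have u2 : 0 < (1 + e' / 2) ^+ 2 by rewrite exprn_gt0// addr_gt0// divr_gt0.
    rewrite -(ler_pM2r u2) in h; apply: le_trans h.
    rewrite le_eqVlt; apply/orP; left; apply/eqP; field; lra.
  have -> : (1 + e' / 2) ^+ 2 - 1 = (e' / 2) * (2 + e' / 2) by field.
  rewrite -mulrA ler_pM2l ?divr_gt0// => {}h; nra.
apply/ler_addgt0Pr => e e0; rewrite -lerBlDr.
pose e' := Num.min e 1; have e'0 : 0 < e' by rewrite lt_min e0 ltr01.
have e'1 : e' <= 1 by rewrite ge_min lexx orbT.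
have := lb' (1 - e' / 2) => h.
have u0 : 0 < 1 - e' / 2 by lra.
apply: (@le_trans _ _ (1 / 2 - e')); first by rewrite lerD2l lerN2 ge_min lexx.
have {}h : 1 <= 1 - e' / 2 + ((1 - e' / 2) ^- 2 - 1) * j by apply: h => //; lra.
have : (e' / 2) * (1 - e' / 2) ^+ 2 <= (1 - (1 - e' / 2) ^+ 2) * j.
  have u2 : 0 < (1 - e' / 2) ^+ 2 by rewrite exprn_gt0.
  have h1 : e' / 2 <= ((1 - e' / 2) ^- 2 - 1) * j by lra.
  rewrite -(ler_pM2r u2) in h1; apply: (le_trans h1).
  rewrite le_eqVlt; apply/orP; left; apply/eqP; field; lra.
have -> : 1 - (1 - e' / 2) ^+ 2 = (e' / 2) * (2 - e' / 2) by field.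
rewrite -[X in _ <= X -> _]mulrA ler_pM2l ?divr_gt0// => {}h2; nra.
Qed.

(** Integrating [normal_pdf_shift] gives [1 + t E <= expR (t^2 s^2 / 2)] for all real [t]. The right
    side is [1 + O(t^2)], so the linear term must vanish. *)
Lemma normal_mean m s : 0 < s ->
  mu.-integrable setT (EFin \o (fun y => (y - m) * normal_pdf m s y)) /\
  (\int[mu]_y ((y - m) * normal_pdf m s y)) = 0.
Proof.
move=> s0.
have iV : mu.-integrable setT (EFin \o (fun y => (y - m) ^+ 2 * normal_pdf m s y)).
  apply: ge0_rintegrable => //; last by rewrite normal_variance// ltry.
    by apply/measurable_EFinP; exact: measurable_poly_normal_pdf.
  by move=> y _; rewrite mulr_ge0 ?sqr_ge0 ?normal_pdf_ge0.
have ip t : mu.-integrable setT (EFin \o normal_pdf t s).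
  exact: integrable_normal_pdf.
have i1 : mu.-integrable setT (EFin \o (fun y => (y - m) * normal_pdf m s y)).
  have i2 : mu.-integrable setT (EFin \o
      (fun y => normal_pdf m s y + (y - m) ^+ 2 * normal_pdf m s y)).
    exact: rintegrableD.
  apply: rintegrable_le i2 => //.
    by apply: measurable_funM; [exact: measurable_funB|exact: measurable_normal_pdf].
  move=> y _; have p0 := normal_pdf_ge0 m s y.
  rewrite /= [leRHS]ger0_norm; last by rewrite addr_ge0// mulr_ge0 ?sqr_ge0.
  rewrite normrM (ger0_norm p0) -{2}(mul1r (normal_pdf m s y)) -mulrDl ler_wpM2r//.
  set z := y - m; have z1 := sqr_ge0 (z - 1); have z2 := sqr_ge0 (z + 1).
  have z3 := sqr_ge0 z; by rewrite ler_norml; apply/andP; split; nra.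
split => //; set E := (X in X = 0).
have h t : 1 + t * E <= expR (t ^+ 2 * s ^+ 2 / 2).
  have I1 z : \int[mu]_y (normal_pdf z s y) = 1 by rewrite /Rintegral integral_normal_pdf.
  have it : mu.-integrable setT (EFin \o (fun y => t * ((y - m) * normal_pdf m s y))).
    exact: rintegrableZ.
  rewrite -{1}(I1 m) -RintegralZl// -RintegralD//.
  have C1 (C : R) : C = \int[mu]_y (C * normal_pdf (m + t * s ^+ 2) s y).
    by rewrite RintegralZl// I1 mulr1.
  rewrite [leRHS]C1.
  apply: le_Rintegral => //.
  - exact: rintegrableD.
  - exact: rintegrableZ.
  - move=> y _; rewrite normal_pdf_shift//.
    have := ler_wpM2l (normal_pdf_ge0 m s y) (expR_ge1Dx (t * (y - m))).
    by apply: le_trans; rewrite le_eqVlt; apply/orP; left; apply/eqP; ring.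
set c := s ^+ 2 / 2; have c0 : 0 < c by rewrite divr_gt0// exprn_gt0.
(* The test value is [t = E / D], a small multiple of [E]. This [D] is large enough to make
   [t^2 c < 1], so that [expR (t^2 c)] is at most [1 / (1 - t^2 c)], and to make [D^2 - c D - c E^2]
   positive, which leaves [E^2 <= 0]. *)
pose D := 1 + c + E ^+ 2 * c; have D0 : 0 < D by rewrite /D; nra.
have := h (E / D).
rewrite (_ : (E / D) ^+ 2 * s ^+ 2 / 2 = (E / D) ^+ 2 * c); last by rewrite /c [RHS]mulrA.
move=> h1; have h2 := expR_ge1Dx (- ((E / D) ^+ 2 * c)).
rewrite expRN in h2.
have e0 := expR_gt0 ((E / D) ^+ 2 * c).
have h3 : (1 - (E / D) ^+ 2 * c) * expR ((E / D) ^+ 2 * c) <= 1.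
  by rewrite -ler_pdivlMr// div1r.
have DV : E / D * E = E ^+ 2 / D by field; rewrite gt_eqF.
have D2 : (E / D) ^+ 2 * c * D ^+ 2 = E ^+ 2 * c by field; rewrite gt_eqF.
have E20 : 0 <= E ^+ 2 by exact: sqr_ge0.
have k1 : (E / D) ^+ 2 * c < 1.
  by rewrite -(ltr_pM2r (exprn_gt0 2 D0)) D2 mul1r /D; nra.
have h4 : (1 - (E / D) ^+ 2 * c) * (1 + E / D * E) <= 1.
  by apply: le_trans h3; rewrite ler_wpM2l// subr_ge0 ltW.
have : (D ^+ 2 - E ^+ 2 * c) * (D + E ^+ 2) <= D ^+ 3.
  rewrite -(ler_pM2r (exprn_gt0 3 D0)) mul1r in h4; apply: le_trans h4.
  by rewrite le_eqVlt; apply/orP; left; apply/eqP; field; rewrite gt_eqF.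
rewrite {h h1 h2 h3 h4 k1 D2 DV e0} => h5.
have : E ^+ 2 <= 0.
  set e := E ^+ 2 in D h5 E20 D0 *.
  have h6 : e * (D ^+ 2 - c * D - c * e) <= 0 by nra.
  have h7 : 0 < D ^+ 2 - c * D - c * e by rewrite /D; nra.
  by rewrite -(pmulr_lle0 _ h7).
by move=> h6; apply/eqP; rewrite -sqrf_eq0 eq_le h6.
Qed.

Lemma normal_second_moment m s : 0 < s ->
  (\int[mu]_y (y ^+ 2 * normal_pdf m s y)%:E = (m ^+ 2 + s ^+ 2)%:E)%E.
Proof.
move=> s0.
have iV : mu.-integrable setT (EFin \o (fun y => (y - m) ^+ 2 * normal_pdf m s y)).
  apply: ge0_rintegrable => //; last by rewrite normal_variance// ltry.
    by apply/measurable_EFinP; exact: measurable_poly_normal_pdf.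
  by move=> y _; rewrite mulr_ge0 ?sqr_ge0 ?normal_pdf_ge0.
have ip : mu.-integrable setT (EFin \o normal_pdf m s) by exact: integrable_normal_pdf.
have [i1 e1] := normal_mean m s0.
have i2 := rintegrableD measurableT iV (rintegrableZ measurableT (2 * m) i1).
have i3 := rintegrableD measurableT i2 (rintegrableZ measurableT (m ^+ 2) ip).
rewrite (_ : (fun y => _) = (fun y => ((y - m) ^+ 2 * normal_pdf m s y +
   2 * m * ((y - m) * normal_pdf m s y) + m ^+ 2 * normal_pdf m s y)%:E)); last first.
  by apply/funext => y; congr EFin; ring.
rewrite integral_Rintegral// RintegralD//; last exact: rintegrableZ.
rewrite RintegralD//; last exact: rintegrableZ.
rewrite !RintegralZl// e1 mulr0 addr0 /Rintegral normal_variance//.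
by rewrite integral_normal_pdf/= mulr1 addrC.
Qed.

(** Doubling the deviation gives the factor [expR (3 x / 4)] with [x = y^2 / (2 s^2)], and
    [expR (3 x / 4) >= (3 x / 8)^2]. As [y^4 = 4 s^4 x^2], the integrand is at most [512 / 9] times
    [s^4] times the wider density; 64 rounds this up. *)
Lemma normal_fourth_moment s : 0 < s ->
  (\int[mu]_y (y ^+ 4 * normal_pdf 0 s y)%:E <= (64 * s ^+ 4)%:E)%E.
Proof.
move=> s0; apply: (@le_trans _ _
    (\int[mu]_y ((64 * s ^+ 4)%:E * (normal_pdf 0 (s * 2) y)%:E))%E); last first.
  rewrite ge0_integralZl_EFin//.
  - by rewrite integral_normal_pdf mule1.
  - by move=> y _; rewrite lee_fin normal_pdf_ge0.
  - by apply/measurable_EFinP; exact: measurable_normal_pdf.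
  - by rewrite mulr_ge0// exprn_ge0// ltW.
apply: ge0_le_integral => //.
- by move=> y _; rewrite lee_fin mulr_ge0 ?normal_pdf_ge0// exprn_even_ge0.
- exact: measurable_poly_normal_pdf.
- by apply: measurable_funeM; apply/measurable_EFinP; exact: measurable_normal_pdf.
move=> y _; rewrite -EFinM lee_fin.
have := normal_pdf_tilt 0 y s0 (ltr0n R 2).
rewrite subr0; set x := y ^+ 2 / _ => t.
have x0 : 0 <= x by rewrite mulr_ge0 ?sqr_ge0// invr_ge0 mulrn_wge0// sqr_ge0.
have yx : y ^+ 4 = 4 * s ^+ 4 * x ^+ 2 by rewrite /x; field; rewrite gt_eqF.
have p0 := normal_pdf_ge0 0 s y.
rewrite (_ : 1 - 2 ^- 2 = 3 / 8 + 3 / 8) in t; last by field.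
rewrite (mulrDl (3 / 8)) expRD in t.
have e1 := expR_ge1Dx (3 / 8 * x).
set e := expR _ in t e1.
have h : 9 / 64 * x ^+ 2 <= e * e by nra.
have s4 : 0 <= s ^+ 4 by rewrite exprn_ge0// ltW.
have -> : 64 * s ^+ 4 * normal_pdf 0 (s * 2) y = s ^+ 4 * (32 * (2 * normal_pdf 0 (s * 2) y)).
  by ring.
rewrite t yx.
have -> : 4 * s ^+ 4 * x ^+ 2 * normal_pdf 0 s y = s ^+ 4 * (normal_pdf 0 s y * (4 * x ^+ 2)) by ring.
rewrite ler_wpM2l// [leRHS]mulrCA ler_wpM2l//; nra.
Qed.

End gaussian_moments.

(** * Kernels made of one atom and a density *)

Section markov_functional.
Context {R : realType} {d : measure_display} {T : measurableType d}.
Variables (P : probability T R) (H : set_system T).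
Hypothesis Hm : H `<=` measurable.
Local Notation mu := (@lebesgue_measure R).
Variables (gamma : \bar R) (a : R -> R) (q : R -> R -> \bar R).
Hypothesis gamma0 : (0 <= gamma)%E.
Hypothesis mq : forall x, measurable_fun setT (q x).
Hypothesis q0 : forall x y, (0 <= q x y)%E.

(** The kernel with an atom of mass [gamma] at [a x] and density [q x], applied to [h]. Both cases
    of [transition] have this form, the one at time 0 with [gamma = 0]. *)
Definition mixed_integral x (h : R -> R) : \bar R :=
  (gamma * (h (a x))%:E + \int[mu]_y ((h y)%:E * q x y))%E.

Lemma mixed_integral_ge0 x h : (forall y, 0 <= h y) ->
  (0 <= mixed_integral x h)%E.
Proof.
move=> h0; apply: adde_ge0; first by rewrite mule_ge0 ?lee_fin.
by apply: integral_ge0 => y _; rewrite mule_ge0 ?lee_fin.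
Qed.

Let mhq x (h : R -> R) : measurable_fun setT h ->
  measurable_fun setT (fun y => ((h y)%:E * q x y)%E).
Proof.
by move=> mh; apply: emeasurable_funM => //; exact/measurable_EFinP.
Qed.

Lemma mixed_integralD x (h1 h2 : R -> R) :
  measurable_fun setT h1 -> measurable_fun setT h2 ->
  (forall y, 0 <= h1 y) -> (forall y, 0 <= h2 y) ->
  (mixed_integral x (h1 \+ h2)%R = mixed_integral x h1 + mixed_integral x h2)%E.
Proof.
move=> m1 m2 h10 h20; rewrite /mixed_integral.
rewrite [X in (_ + X = _)%E](_ : _ = \int[mu]_y ((h1 y)%:E * q x y) +
    \int[mu]_y ((h2 y)%:E * q x y))%E; last first.
  rewrite -ge0_integralD//; last 4 first.
  - by move=> y _; rewrite mule_ge0 ?lee_fin.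
  - exact: mhq.
  - by move=> y _; rewrite mule_ge0 ?lee_fin.
  - exact: mhq.
  by apply: eq_integral => y _; rewrite EFinD ge0_muleDl ?lee_fin.
by rewrite EFinD ge0_muleDr ?lee_fin// addeACA.
Qed.

Lemma mixed_integralZ x (k : R) (h : R -> R) : 0 <= k ->
  measurable_fun setT h -> (forall y, 0 <= h y) ->
  (mixed_integral x (fun y => k * h y)%R = k%:E * mixed_integral x h)%E.
Proof.
move=> k0 mh h0; rewrite /mixed_integral ge0_muleDr; last 2 first.
- by rewrite mule_ge0 ?lee_fin.
- by apply: integral_ge0 => y _; rewrite mule_ge0 ?lee_fin.
rewrite -ge0_integralZl_EFin//; last 2 first.
- by move=> y _; rewrite mule_ge0 ?lee_fin.
- exact: mhq.
rewrite EFinM muleCA; congr (_ + _)%E.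
by apply: eq_integral => y _; rewrite EFinM muleA.
Qed.

Lemma mixed_integral_nd x (h1 h2 : R -> R) :
  measurable_fun setT h1 -> measurable_fun setT h2 ->
  (forall y, 0 <= h1 y) -> (forall y, h1 y <= h2 y) ->
  (mixed_integral x h1 <= mixed_integral x h2)%E.
Proof.
move=> m1 m2 h10 h12; apply: leeD; first by rewrite lee_wpmul2l ?lee_fin.
apply: ge0_le_integral => //.
- by move=> y _; rewrite mule_ge0 ?lee_fin.
- exact: mhq.
- exact: mhq.
- by move=> y _; rewrite lee_wpmul2r ?lee_fin.
Qed.

Lemma mixed_integral_cvg x (h : nat -> R -> R) (f : R -> R) :
  (forall n, measurable_fun setT (h n)) -> (forall n y, 0 <= h n y) ->
  (forall y, nondecreasing_seq (h ^~ y)) -> (forall y, h ^~ y @ \oo --> f y) ->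
  gamma \is a fin_num ->
  (mixed_integral x (h n) @[n --> \oo] --> mixed_integral x f)%E.
Proof.
move=> mh h0 ndh hf gfin.
have f0 y : 0 <= f y.
  by apply: (cvgr_to_ge (hf y)); exact: nearW.
have c1 : ((gamma * (h n (a x))%:E)%E @[n --> \oo] --> (gamma * (f (a x))%:E)%E).
  apply: cvgeZl => //; apply: cvg_EFin; first exact: nearW.
  exact: hf.
have c2 : (\int[mu]_y ((h n y)%:E * q x y))%E @[n --> \oo] -->
    (\int[mu]_y ((f y)%:E * q x y))%E.
  rewrite (_ : (\int[mu]_y ((f y)%:E * q x y))%E =
      (\int[mu]_y limn (fun n => (h n y)%:E * q x y))%E); last first.
    apply: eq_integral => y _; apply/esym/cvg_lim => //.
    have ndE : nondecreasing_seq (fun n => ((h n y)%:E * q x y)%E).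
      by move=> m n mn; rewrite lee_wpmul2r// lee_fin; exact: ndh.
    have [qfin|] := boolP (q x y \is a fin_num).
      apply: cvgeZr => //; apply: cvg_EFin; first exact: nearW.
      exact: hf.
    (* The density may be infinite at [y]. Then either [f y = 0] and all [h n y] vanish, or
       [h n y > 0] from some rank on and the products are constantly [+oo]. *)
    rewrite ge0_fin_numE// -leNgt leye_eq => /eqP ->.
    have [fy0|fy0] := eqVneq (f y) 0.
      rewrite fy0 mul0e; apply: cvg_near_cst; apply: nearW => n.
      have := h0 n y; rewrite le_eqVlt => /predU1P[<-|hn0]; first by rewrite mul0e.
      have : h n y <= f y.
        rewrite -(cvg_lim _ (hf y))//; apply: nondecreasing_cvgn_le => //.
        by apply/cvg_ex; exists (f y); exact: hf.
      by rewrite fy0 leNgt hn0.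
    have fy_gt0 : 0 < f y by rewrite lt0r fy0 f0.
    rewrite gt0_muley//; apply: cvg_near_cst.
    have gtN : \forall n \near \oo, 0 < h n y.
      exact: (cvgr_gt (f y) (hf y) 0 fy_gt0).
    by apply: filterS gtN => n hn; rewrite gt0_muley.
  apply: cvg_monotone_convergence => //.
  - by move=> n; exact: mhq.
  - by move=> n y _; rewrite mule_ge0 ?lee_fin.
  - by move=> y _ m n mn; rewrite lee_wpmul2r// lee_fin; exact: ndh.
apply: cvgeD => //; apply: ge0_adde_def; rewrite inE.
  by rewrite mule_ge0 ?lee_fin.
by apply: integral_ge0 => y _; rewrite mule_ge0 ?lee_fin.
Qed.

Hypothesis gamma_fin : gamma \is a fin_num.
Hypothesis fin1 : forall x, (mixed_integral x (cst 1%R) < +oo)%E.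

(** Allows the [fine] in [markovYZ] to be removed. *)
Lemma mixed_integral_indic_fin x B : measurable B ->
  mixed_integral x \1_B \is a fin_num.
Proof.
move=> mB; rewrite ge0_fin_numE; last exact: mixed_integral_ge0.
apply: le_lt_trans (fin1 x); apply: mixed_integral_nd => // y.
by rewrite indicE; case: (_ \in _).
Qed.

Variables (Y Z : T -> R).
Hypothesis mZ : measurable_fun setT Z.
Hypothesis markovYZ : forall B, measurable B ->
  is_condexp P H (fun w => \1_B (Z w)) (fun w => fine (mixed_integral (Y w) \1_B)).

(** Measurability of the kernel in [w] is carried through the induction, because for indicators it
    is supplied by the Markov property itself. *)
Lemma markov_integral (h : R -> R) :
  measurable_fun setT h -> (forall y, 0 <= h y) ->
  measurable_fun setT (fun w => mixed_integral (Y w) h) /\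
  forall A, H A -> (\int[P]_(w in A) (h (Z w))%:E =
                    \int[P]_(w in A) mixed_integral (Y w) h)%E.
Proof.
move: h; apply: (@nnfun_ind _ R R (fun h =>
  measurable_fun setT (fun w => mixed_integral (Y w) h) /\
  forall A, H A -> (\int[P]_(w in A) (h (Z w))%:E =
                    \int[P]_(w in A) mixed_integral (Y w) h)%E)).
- move=> B mB; have [_ iB _ eB] := markovYZ mB.
  have E : (fun w => mixed_integral (Y w) \1_B) =
      EFin \o (fun w => fine (mixed_integral (Y w) \1_B)).
    by apply/funext => w /=; rewrite fineK// mixed_integral_indic_fin.
  split; first by rewrite E; exact: measurable_int iB.
  by move=> A HA; rewrite eB// E.
- move=> f g mf mg f0 g0 [mKf eKf] [mKg eKg]; split.
    under eq_fun do rewrite mixed_integralD//.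
    exact: emeasurable_funD.
  move=> A HA; have mA := Hm HA.
  under [RHS]eq_integral do rewrite mixed_integralD//.
  under [LHS]eq_integral do rewrite /= EFinD.
  rewrite [RHS]ge0_integralD//; last 4 first.
  + by move=> w _; exact: mixed_integral_ge0.
  + exact: measurable_funTS.
  + by move=> w _; exact: mixed_integral_ge0.
  + exact: measurable_funTS.
  rewrite [LHS]ge0_integralD//; last 4 first.
  + by move=> w _; rewrite lee_fin.
  + by apply: measurable_funTS; apply/measurable_EFinP; exact: measurableT_comp.
  + by move=> w _; rewrite lee_fin.
  + by apply: measurable_funTS; apply/measurable_EFinP; exact: measurableT_comp.
  by rewrite eKf// eKg.
- move=> k f k0 mf f0 [mKf eKf]; split.
    under eq_fun do rewrite mixed_integralZ//.
    exact: measurable_funeM.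
  move=> A HA; have mA := Hm HA.
  under [RHS]eq_integral do rewrite mixed_integralZ//.
  under [LHS]eq_integral do rewrite /= EFinM.
  rewrite [RHS]ge0_integralZl_EFin//; last 2 first.
  + by move=> w _; exact: mixed_integral_ge0.
  + exact: measurable_funTS.
  rewrite [LHS]ge0_integralZl_EFin//; last 2 first.
  + by move=> w _; rewrite lee_fin.
  + by apply: measurable_funTS; apply/measurable_EFinP; exact: measurableT_comp.
  by rewrite eKf.
- move=> h f mh h0 ndh mf hf IH.
  have cK w := @mixed_integral_cvg (Y w) h f mh h0 ndh hf gamma_fin.
  have mK : measurable_fun setT (fun w => mixed_integral (Y w) f).
    apply: (emeasurable_fun_cvg (fun n w => mixed_integral (Y w) (h n))) => //.
    by move=> n; have [] := IH n.
  split => // A HA; have mA := Hm HA.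
  have c1 : (\int[P]_(w in A) (h n (Z w))%:E)%E @[n --> \oo] -->
      (\int[P]_(w in A) (f (Z w))%:E)%E.
    rewrite (_ : (\int[P]_(w in A) (f (Z w))%:E)%E =
        (\int[P]_(w in A) limn (fun n => (h n (Z w))%:E))%E); last first.
      apply: eq_integral => w _; apply/esym/cvg_lim => //.
      by apply: cvg_EFin; [exact: nearW|exact: hf].
    apply: cvg_monotone_convergence => //.
    + move=> n; apply: measurable_funTS; apply/measurable_EFinP.
      exact: measurableT_comp.
    + by move=> n w _; rewrite lee_fin.
    + by move=> w _ m n mn; rewrite lee_fin; exact: ndh.
  have c2 : (\int[P]_(w in A) mixed_integral (Y w) (h n))%E @[n --> \oo] -->
      (\int[P]_(w in A) mixed_integral (Y w) f)%E.
    rewrite (_ : (\int[P]_(w in A) mixed_integral (Y w) f)%E =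
        (\int[P]_(w in A) limn (fun n => mixed_integral (Y w) (h n)))%E); last first.
      by apply: eq_integral => w _; apply/esym/cvg_lim => //; exact: cK.
    apply: cvg_monotone_convergence => //.
    + by move=> n; apply: measurable_funTS; have [] := IH n.
    + by move=> n w _; exact: mixed_integral_ge0.
    + by move=> w _ m n mn; apply: mixed_integral_nd => // y; exact: ndh.
  rewrite -(cvg_lim _ c1)// -(cvg_lim _ c2)//.
  by congr (limn _); apply/funext => n; have [_ ->] := IH n.
Qed.

End markov_functional.

(** Inversion is discontinuous at 0. Writing [1 / f] as [f] times the power -1 of [f ^+ 2] reduces
    the claim to real powers, and both sides are 0 where [f] vanishes. *)
Lemma measurable_funV d (T : measurableType d) (R : realType) (D : set T)
    (f : T -> R) : measurable_fun D f -> measurable_fun D (fun x => (f x)^-1).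
Proof.
move=> mf; rewrite (_ : (fun x => _) = (fun x => f x * ((f x) ^+ 2) `^ (-1))).
  apply: measurable_funM => //.
  apply: (@measurableT_comp _ _ _ _ _ _ (@powR R ^~ (-1)) _ (fun x => f x ^+ 2)) => //.
  exact: measurable_funX.
apply/funext => x; rewrite powR_inv1 ?sqr_ge0//.
by have [->|fx0] := eqVneq (f x) 0; [rewrite invr0 mul0r|field].
Qed.

Lemma measurable_indic_comp d d' (T : measurableType d) (T' : measurableType d')
    (R : realType) (D : set T) (A : set T') (f : T -> T') : measurable A ->
  measurable_fun D f -> measurable_fun D (fun w => \1_A (f w) : R).
Proof.
by move=> mA mf; exact: (@measurableT_comp _ _ _ _ _ _ (\1_A : T' -> R)).
Qed.

Lemma measurable_normal_pdf_comp d (T : measurableType d) (R : realType)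
    (m s y : T -> R) : measurable_fun setT m -> measurable_fun setT s ->
  measurable_fun setT y ->
  measurable_fun setT (fun w => normal_pdf (m w) (s w) (y w)).
Proof.
move=> mm ms my; rewrite /normal_pdf; apply: measurable_fun_ifT.
- exact: measurable_fun_eqr.
- exact: measurable_indic_comp.
- apply: measurable_funM.
    apply: measurable_funV.
    apply: (@measurableT_comp _ _ _ _ _ _ (@Num.sqrt R)).
      exact: continuous_measurable_fun (@sqrt_continuous R).
    under eq_fun do rewrite -mulr_natr.
    apply: measurable_funM => //; apply: measurable_funM => //.
    exact: measurable_funX.
  apply: measurableT_comp => //.
  under eq_fun do rewrite mulNr -mulrN.
  apply: measurable_funM; first by apply: measurable_funX; exact: measurable_funB.
  apply: measurable_funN; apply: measurable_funV.
  under eq_fun do rewrite -mulr_natr.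
  by apply: measurable_funM => //; exact: measurable_funX.
Qed.

(** * Probabilities on the unit interval and Gaussian mixtures *)

Section unit_interval_probability.
Context {R : realType} (g : probability R R).
Hypothesis g01 : g `[0, 1]%classic = 1%E.

Lemma integral_prob01 (f : R -> \bar R) : measurable_fun setT f ->
  (forall r : R, 0 <= r <= 1 -> (0 <= f r)%E) ->
  (\int[g]_(r in `[0%R, 1%R]) f r =
   g [set 1%R] * f 1%R + \int[g]_(r in `[0%R, 1%R[) f r)%E.
Proof.
move=> mf f0; have E : `[0, 1]%classic = [set 1] `|` `[0, 1[%classic :> set R.
  by rewrite setUC setUitv1 // bnd_simp ler01.
rewrite E ge0_integral_setU//=.
- congr (_ + _)%E; rewrite (eq_integral (cst (f 1))).
    rewrite integral_cst//; exact: muleC.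
  by move=> r; rewrite inE /= => ->.
- exact: measurable_funTS.
- move=> r [->|]; first by apply: f0; rewrite ler01 lexx.
  by rewrite /= in_itv/= => /andP[r0 r1]; apply: f0; rewrite r0 ltW.
- by apply/disj_setPS => r [/= ->]; rewrite in_itv/= ltxx andbF.
Qed.

Lemma integral_prob01T (f : R -> \bar R) : measurable_fun setT f ->
  (forall r, 0 <= f r)%E -> (\int[g]_r f r = \int[g]_(r in `[0%R, 1%R]) f r)%E.
Proof.
move=> mf f0; rewrite (@ge0_negligible_integral _ _ _ g setT (~` `[0, 1]))//.
- by rewrite setTD setCK.
- exact: measurableC.
- by have := probability_setC g (measurable_itv `[0%R, 1%R]); rewrite g01 subee.
Qed.

Variable m : R.
Hypothesis gm : ('E_g[(fun r : R => r `^ 1)%R] = m%:E)%E.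

Lemma prob01_mean : (\int[g]_(r in `[0%R, 1%R]) r%:E = m%:E)%E.
Proof.
rewrite -gm unlock integral_prob01T//.
- apply: eq_integral => r; rewrite inE/= in_itv/= => /andP[r0 _].
  by rewrite powRr1.
- by apply/measurable_EFinP; exact: measurable_powR.
- by move=> r; rewrite lee_fin powR_ge0.
Qed.

Lemma prob01_onem_mean : (\int[g]_(r in `[0%R, 1%R]) (1 - r)%:E = (1 - m)%:E)%E.
Proof.
have i1 : g.-integrable `[0, 1] (EFin \o (cst 1 : R -> R)).
  exact: finite_measure_integrable_cst.
have i2 : g.-integrable `[0, 1] (EFin \o (fun r : R => r)).
  apply: rintegrable_le i1 => // r; rewrite /= in_itv/= => /andP[r0 r1].
  by rewrite normr1 ger0_norm.
rewrite integral_Rintegral//; last exact: rintegrableB.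
have e1 : \int[g]_(r in `[0%R, 1%R]) 1 = 1 :> R.
  by rewrite Rintegral_cst// mul1r; exact: (congr1 fine g01).
by rewrite RintegralB// e1 /Rintegral prob01_mean.
Qed.

Lemma prob01_mean_itv01 : 0 <= m <= 1.
Proof.
rewrite -!lee_fin -prob01_mean; apply/andP; split.
  apply: integral_ge0 => r; rewrite /= in_itv/= => /andP[r0 _].
  by rewrite lee_fin.
rewrite -g01 -[leRHS]mul1e -integral_cst//; apply: ge0_le_integral => //.
- by move=> r; rewrite /= in_itv/= => /andP[r0 _]; rewrite lee_fin.
- by move=> r; rewrite /= in_itv/= => /andP[_ r1]; rewrite lee_fin.
Qed.

(** Integrates the inequality [0 <= (sqrt r - k)^2], where [k] is the mean of [sqrt r]. *)
Lemma prob01_jensen (k : R) :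
  ('E_g[(fun r : R => r `^ (1 / 2))%R] = k%:E)%E -> k ^+ 2 <= m.
Proof.
rewrite unlock integral_prob01T//; last 2 first.
- by apply/measurable_EFinP; exact: measurable_powR.
- by move=> r; rewrite lee_fin powR_ge0.
move=> gk.
have i1 : g.-integrable `[0, 1] (EFin \o (cst 1 : R -> R)).
  exact: finite_measure_integrable_cst.
have ms : measurable_fun (`[0, 1]%classic : set R) (fun r : R => r `^ (1 / 2)).
  by apply: measurable_funTS; exact: measurable_powR.
have is_ : g.-integrable `[0, 1] (EFin \o (fun r : R => r `^ (1 / 2))).
  apply: ge0_rintegrable => //; last by rewrite gk ltry.
  by move=> r _; rewrite powR_ge0.
have i2 : g.-integrable `[0, 1] (EFin \o (fun r : R => r)).
  apply: rintegrable_le i1 => // r; rewrite /= in_itv/= => /andP[r0 r1].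
  by rewrite normr1 ger0_norm.
have h : 0 <= \int[g]_(r in `[0%R, 1%R]) (r - (2 * k) * r `^ (1 / 2) + k ^+ 2 * 1).
  apply: Rintegral_ge0 => r; rewrite /= in_itv/= => /andP[r0 _].
  rewrite div1r powR12_sqrt//.
  have : 0 <= (Num.sqrt r - k) ^+ 2 by exact: sqr_ge0.
  by rewrite sqrrB sqr_sqrtr// mulr1 -mulr_natr => e; apply: le_trans e _; lra.
rewrite RintegralD// in h; last 2 first.
- by apply: rintegrableB => //; exact: rintegrableZ.
- exact: rintegrableZ.
rewrite RintegralB// in h; last exact: rintegrableZ.
have e1 : \int[g]_(r in `[0%R, 1%R]) 1 = 1 :> R.
  by rewrite Rintegral_cst// mul1r; exact: (congr1 fine g01).
rewrite !RintegralZl// e1 /Rintegral prob01_mean gk/= in h.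
by nra.
Qed.

Variables (sigma t : R).
Hypotheses (sigma0 : 0 < sigma) (t0 : 0 < t).

(** Extended values are kept: the variances tend to 0 as [r] approaches 1, and the integral may
    diverge at some [y]. *)
Definition mixture_density (x y : R) : \bar R :=
  (\int[g]_(r in `[0%R, 1%R[)
     (phi (sigma * Num.sqrt r * x) (t * (1 - r)) y)%:E)%E.

Let measurable_phi x : measurable_fun setT (fun z : R * R =>
  phi (sigma * Num.sqrt z.2 * x) (t * (1 - z.2)) z.1).
Proof.
have ms : measurable_fun setT (@Num.sqrt R).
  exact: continuous_measurable_fun (@sqrt_continuous R).
apply: measurable_normal_pdf_comp => //.
- apply: measurable_funM => //; apply: measurable_funM => //.
  exact: measurableT_comp.
- apply: measurableT_comp => //; apply: measurable_funM => //.
  exact: measurable_funB.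
Qed.

Lemma mixture_density_ge0 x y : (0 <= mixture_density x y)%E.
Proof.
by apply: integral_ge0 => r _; rewrite lee_fin normal_pdf_ge0.
Qed.

Lemma measurable_mixture_density x : measurable_fun setT (mixture_density x).
Proof.
pose f (z : R * R) : \bar R :=
  ((phi (sigma * Num.sqrt z.2 * x) (t * (1 - z.2)) z.1) * \1_`[0, 1[ z.2)%:E.
have mf : measurable_fun setT f.
  apply/measurable_EFinP; apply: measurable_funM => //.
  exact: measurable_indic_comp.
have f0 z : (0 <= f z)%E by rewrite lee_fin mulr_ge0 ?normal_pdf_ge0.
rewrite (_ : mixture_density x = fubini_F g f).
  exact: measurable_fun_fubini_tonelli_F.
apply/funext => y; rewrite /mixture_density /fubini_F [LHS]integral_mkcond.
apply: eq_integral => r _; rewrite patchE /f indicE/=.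
by case: ifPn => _; rewrite ?mulr1 ?mulr0.
Qed.

Lemma integral_mixture_density x (h : R -> R) : measurable_fun setT h ->
  (forall y, 0 <= h y) ->
  (\int[lebesgue_measure]_y ((h y)%:E * mixture_density x y) =
   \int[g]_(r in `[0%R, 1%R[) \int[lebesgue_measure]_y
      (h y * phi (sigma * Num.sqrt r * x) (t * (1 - r)) y)%:E)%E.
Proof.
move=> mh h0.
pose f (z : R * R) : \bar R := (h z.1 *
  ((phi (sigma * Num.sqrt z.2 * x) (t * (1 - z.2)) z.1) * \1_`[0, 1[ z.2))%:E.
have mf : measurable_fun setT f.
  apply/measurable_EFinP; apply: measurable_funM; first exact: measurableT_comp.
  apply: measurable_funM => //.
  exact: measurable_indic_comp.
have f0 z : (0 <= f z)%E by rewrite lee_fin mulr_ge0 ?mulr_ge0 ?normal_pdf_ge0.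
transitivity (\int[lebesgue_measure]_y \int[g]_r f (y, r))%E.
  apply: eq_integral => y _; rewrite /mixture_density integral_mkcond.
  rewrite -ge0_integralZl_EFin//.
  - apply: eq_integral => r _; rewrite patchE /f indicE/=.
    by case: ifPn => _; rewrite ?mulr1 ?mulr0 ?mule0.
  - by move=> r _; rewrite patchE; case: ifPn; rewrite ?lee_fin ?normal_pdf_ge0.
  - apply/(measurable_restrictT _ _).1 => //; apply: measurable_funTS.
    apply/measurable_EFinP.
    exact: (measurableT_comp (measurable_phi x) (measurable_pair1 y)).
rewrite fubini_tonelli// [RHS]integral_mkcond; apply: eq_integral => r _.
rewrite patchE /f/= indicE; case: ifPn => _.
  by apply: eq_integral => y _; rewrite mulr1.
by under eq_integral do rewrite mulr0 mulr0; rewrite integral0.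
Qed.

Lemma mixture_density_mass x :
  (g [set 1%R] + \int[lebesgue_measure]_y mixture_density x y = 1)%E.
Proof.
have := @integral_mixture_density x (cst 1) _ _.
under eq_integral do rewrite mul1e.
move=> -> //.
rewrite -g01 -[RHS]mul1e -integral_cst// integral_prob01// mule1; congr (_ + _)%E.
apply: eq_integral => r _.
by under eq_integral do rewrite mul1r; rewrite integral_normal_pdf.
Qed.

(** For [r < 1] the Gaussian component has second moment [sigma^2 r x^2 + t (1 - r)]. At [r = 1]
    this affine function of [r] equals [(sigma x)^2], the contribution of the atom, so both parts
    combine into one integral over [[0, 1]] that depends on the mean only. *)
Lemma mixture_density_second_moment x :
  (g [set 1%R] * ((sigma * x) ^+ 2)%:E +
   \int[lebesgue_measure]_y ((y ^+ 2)%:E * mixture_density x y) =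
   (sigma ^+ 2 * x ^+ 2 * m + t * (1 - m))%:E)%E.
Proof.
rewrite integral_mixture_density//; last by move=> y; exact: sqr_ge0.
transitivity (\int[g]_(r in `[0%R, 1%R]) (sigma ^+ 2 * x ^+ 2 * r + t * (1 - r))%:E)%E.
  rewrite integral_prob01//.
  - congr (_ * _ + _)%E; first by congr EFin; ring.
    apply: eq_integral => r; rewrite inE/= in_itv/= => /andP[r0 r1].
    have v0 : 0 < t * (1 - r) by rewrite mulr_gt0// subr_gt0.
    rewrite normal_second_moment ?sqrtr_gt0//; congr EFin.
    by rewrite !exprMn !sqr_sqrtr ?(ltW v0)//; ring.
  - apply/measurable_EFinP; apply: measurable_funD; apply: measurable_funM => //.
    exact: measurable_funB.
  - move=> r /andP[r0 r1]; rewrite lee_fin; apply: addr_ge0.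
      by apply: mulr_ge0 => //; apply: mulr_ge0; exact: sqr_ge0.
    by rewrite mulr_ge0 ?subr_ge0// ltW.
under eq_integral do rewrite EFinD.
rewrite ge0_integralD//.
- under eq_integral do rewrite EFinM.
  rewrite ge0_integralZl_EFin//; last 2 first.
  - by move=> r; rewrite /= in_itv/= => /andP[r0 _]; rewrite lee_fin.
  - by apply: mulr_ge0; exact: sqr_ge0.
  rewrite prob01_mean; under eq_integral do rewrite EFinM.
  rewrite ge0_integralZl_EFin ?(ltW t0)//; last 2 first.
    by move=> r; rewrite /= in_itv/= => /andP[_ r1]; rewrite lee_fin subr_ge0.
  - by apply: measurable_funTS; apply/measurable_EFinP; exact: measurable_funB.
  by rewrite prob01_onem_mean.
- move=> r; rewrite /= in_itv/= => /andP[r0 _].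
  by rewrite lee_fin; apply: mulr_ge0 => //; apply: mulr_ge0; exact: sqr_ge0.
- by apply: measurable_funTS; apply/measurable_EFinP; exact: measurable_funM.
- move=> r; rewrite /= in_itv/= => /andP[r0 r1].
  by rewrite lee_fin mulr_ge0 ?(ltW t0)// subr_ge0.
- apply: measurable_funTS; apply/measurable_EFinP; apply: measurable_funM => //.
  exact: measurable_funB.
Qed.

End unit_interval_probability.

Lemma mixed_integral_indic (R : realType) (gamma : \bar R) (a : R -> R)
    (q : R -> R -> \bar R) x B : measurable B ->
  (mixed_integral gamma a q x \1_B =
   gamma * \d_(a x) B + \int[lebesgue_measure]_(y in B) q x y)%E.
Proof.
move=> mB; rewrite /mixed_integral /dirac; congr (_ + _)%E.
rewrite [RHS]integral_mkcond; apply: eq_integral => y _.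
by rewrite patchE indicE; case: ifPn => _; rewrite ?mul1e ?mul0e.
Qed.

(* [E(X_t^2 | F_s)] as a function of [X_s^2]. *)
Definition cond_square {R : realType} (delta s t z : R) : R :=
  if s == 0 then t
  else (t / s) `^ (1 - delta) * z + (t - t * (t / s) `^ (- delta)).

(** * The parameter delta and the conditional second moments *)

Section exponent.
Context {R : realType} (G : R -> probability R R) (psi : R -> R).
Hypothesis G_itv01 : forall sigma, 1 <= sigma -> G sigma `[0, 1]%classic = 1%E.
Hypothesis G_laplace : has_laplace_exponent G psi.

Lemma laplaceE sigma lambda : 1 <= sigma -> 0 < lambda ->
  ('E_(G sigma)[(fun r : R => r `^ lambda)%R])%E = (sigma `^ (- psi lambda))%:E.
Proof. by move=> s1 l0; case: G_laplace => beta [nu [_ _ _ _ ->]]. Qed.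

(** The single value [sigma = 2] decides: a mean at most 1 gives [2^(- psi 1) <= 1], and Jensen's
    inequality gives [2^(-2) <= 2^(- psi 1)]. *)
Lemma delta_itv01 : psi (1 / 2) = 1 -> 0 <= psi 1 / 2 <= 1.
Proof.
move=> psi_half.
have two1 : 1 <= 2 :> R by rewrite ler1n.
have e1 := laplaceE two1 (ltr01 : 0 < 1).
have e2 := laplaceE two1 (ltac:(by rewrite divr_gt0) : 0 < 1 / 2).
rewrite psi_half in e2.
have /andP[_ m1] := prob01_mean_itv01 (G_itv01 two1) e1.
have := prob01_jensen (G_itv01 two1) e1 e2.
have twogt1 : 1 < 2 :> R by rewrite ltr1n.
have l2 : 0 < ln (2 : R) by rewrite ln_gt0.
have E (x : R) : 2 `^ x = expR (x * ln 2) by rewrite /powR pnatr_eq0.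
rewrite -powR_mulrn ?powR_ge0// -powRrM !E ler_expR ler_pM2r// => m2.
have {}m1 : - psi 1 <= 0.
  by rewrite E -[leRHS]expR0 ler_expR pmulr_lle0 in m1.
by apply/andP; split; lra.
Qed.

End exponent.

Section moments.
Context {R : realType} {d : measure_display} {T : measurableType d}.
Variables (G : R -> probability R R) (psi : R -> R) (P : probability T R).
Variables (F : R -> set_system T) (X : R -> T -> R).
Hypothesis G_itv01 : forall sigma, 1 <= sigma -> G sigma `[0, 1]%classic = 1%E.
Hypothesis G_laplace : has_laplace_exponent G psi.
Hypothesis F_filtration : filtration F.
Hypothesis X_0 : forall w, X 0 w = 0.
Hypothesis X_adapted : adapted F X.
Hypothesis X_markov : markov_process P F X (transition G).
Local Notation delta := (psi 1 / 2).
Local Notation mu := (@lebesgue_measure R).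

Lemma filtration_sub t : 0 <= t -> F t `<=` measurable.
Proof. by case: F_filtration => _ Fm _ /Fm. Qed.

Lemma adapted_measurable (Y : R -> T -> R) : adapted F Y ->
  forall t, 0 <= t -> measurable_fun setT (Y t).
Proof.
by move=> aY t t0; apply: (measurable_fun_wrt (filtration_sub t0)); exact: aY.
Qed.

(** Since [X 0] is identically 0 the kernel does not depend on [w]: [X t] is Gaussian and
    independent of [F 0]. *)
Lemma markov_start t A (h : R -> R) : 0 < t -> F 0 A -> measurable_fun setT h ->
  (forall y, 0 <= h y) ->
  (\int[P]_(w in A) (h (X t w))%:E =
   P A * \int[mu]_y (h y * normal_pdf 0 (Num.sqrt t) y)%:E)%E.
Proof.
move=> t0 FA mh h0.
pose q (x y : R) : \bar R := (phi x t y)%:E.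
have mq x : measurable_fun setT (q x).
  by apply/measurable_EFinP; exact: measurable_normal_pdf.
have q0 x y : (0 <= q x y)%E by rewrite lee_fin normal_pdf_ge0.
have [||||_ ->//] := @markov_integral _ _ _ P (F 0) (filtration_sub (lexx 0))
  0%E (fun=> 0) q (lexx _) mq q0 _ _ (X 0) (X t) _ _ h mh h0.
- by [].
- move=> x; rewrite /mixed_integral mul0e add0e.
  by under eq_integral do rewrite mul1e; rewrite integral_normal_pdf ltry.
- by apply: adapted_measurable => //; exact: ltW.
- move=> B mB; have := X_markov (lexx 0) t0 mB.
  rewrite /transition eqxx (_ : (fun w => fine (mixed_integral _ _ _ _ _)) =
    fun w => fine (\int[mu]_(y in B) (phi (X 0 w) t y)%:E)%E)//.
  by apply/funext => w; rewrite mixed_integral_indic// mul0e add0e.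
have mA : measurable A by exact: filtration_sub FA.
rewrite /mixed_integral; under eq_integral do rewrite mul0e add0e X_0.
by rewrite integral_cst// muleC.
Qed.

Lemma integral_square_start t A : 0 < t -> F 0 A ->
  (\int[P]_(w in A) (X t w ^+ 2)%:E = \int[P]_(w in A) t%:E)%E.
Proof.
move=> t0 FA; rewrite (markov_start t0 FA (h := fun y => y ^+ 2))//; last first.
  by move=> y; exact: sqr_ge0.
rewrite normal_second_moment ?sqrtr_gt0// integral_cst//.
  by rewrite expr0n/= add0r sqr_sqrtr ?ltW// muleC.
exact: filtration_sub FA.
Qed.

Lemma fourth_moment t : 0 <= t ->
  (\int[P]_w (X t w ^+ 4)%:E <= (64 * t ^+ 2)%:E)%E.
Proof.
rewrite le_eqVlt => /predU1P[<-|t0].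
  under eq_integral do rewrite X_0 expr0n/=.
  by rewrite integral0 expr0n/= mulr0.
have FT : F 0 setT.
  by apply: sub_sigma_setT; case: F_filtration => sF _ _; exact: sF.
rewrite (markov_start t0 FT (h := fun y => y ^+ 4))//; last first.
  by move=> y; rewrite exprn_even_ge0.
rewrite probability_setT mul1e.
apply: le_trans (normal_fourth_moment _) _; first by rewrite sqrtr_gt0.
by rewrite lee_fin (exprM _ 2 2) sqr_sqrtr// ltW.
Qed.

Lemma integral_square_condexp s t A : 0 <= s -> s < t -> F s A ->
  (\int[P]_(w in A) (X t w ^+ 2)%:E =
   \int[P]_(w in A) (cond_square delta s t (X s w ^+ 2))%:E)%E.
Proof.
rewrite le_eqVlt => /predU1P[<-|s0] st FA.
  by rewrite /cond_square eqxx integral_square_start.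
have t0 : 0 < t := lt_trans s0 st.
set sigma := Num.sqrt (t / s).
have ts1 : 1 <= t / s by rewrite ler_pdivlMr// mul1r ltW.
have ts0 : 0 < t / s by rewrite divr_gt0.
have sigma1 : 1 <= sigma by rewrite -[leLHS]sqrtr1 ler_sqrt// ltW.
have sigma0 : 0 < sigma by rewrite (lt_le_trans ltr01).
have gm := laplaceE G_laplace sigma1 (ltr01 : 0 < 1).
pose q := mixture_density (G sigma) sigma t.
have mq x : measurable_fun setT (q x) by exact: measurable_mixture_density.
have q0 x y : (0 <= q x y)%E by exact: mixture_density_ge0.
have [|||||_ ->//] := @markov_integral _ _ _ P (F s) (filtration_sub (ltW s0))
  (G sigma [set 1%R]) (fun x => sigma * x) q (measure_ge0 _ _) mq q0 _ _ (X s) (X t) _ _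
  (fun y => y ^+ 2) _ (fun y => sqr_ge0 y).
- exact: fin_num_measure.
- move=> x; rewrite /mixed_integral mule1.
  under eq_integral do rewrite mul1e.
  by rewrite (mixture_density_mass (G_itv01 sigma1))// ltry.
- by apply: adapted_measurable => //; exact: ltW.
- move=> B mB; have := X_markov (ltW s0) st mB.
  rewrite /transition gt_eqF//=.
  rewrite (_ : (fun w => fine (mixed_integral _ _ _ _ _)) =
    fun w => fine (G sigma [set 1%R] * \d_(sigma * X s w)%R B +
      \int[mu]_(y in B) q (X s w) y)%E)//.
  by apply/funext => w; rewrite mixed_integral_indic.
- exact: measurable_funX.
apply: eq_integral => w _.
rewrite /mixed_integral (mixture_density_second_moment (G_itv01 sigma1) gm)//.
rewrite /cond_square gt_eqF//; congr EFin.
(* [sigma] is the square root of [t / s], which halves the exponent [psi 1] to [delta]. *)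
have mE : sigma `^ (- psi 1) = (t / s) `^ (- delta).
  by rewrite /sigma -powR12_sqrt ?ltW// -powRrM; congr (_ `^ _); field.
have sE : sigma ^+ 2 = t / s by rewrite sqr_sqrtr// ltW.
rewrite mE sE powRD; last by rewrite (gt_eqF ts0) implybT.
by rewrite powRr1 ?ltW//; ring.
Qed.

End moments.

(** * Right-continuous processes *)

Section ceil_index.
Context {R : realType}.
Implicit Types (y : R) (k : nat).

(* The predecessor of the ceiling: [k < y <= k + 1] for [y > 0]. *)
Definition ceil_index y : nat :=
  if (Num.truncn y)%:R < y then Num.truncn y else (Num.truncn y).-1.

Lemma ceil_index_itv y : 0 < y -> (ceil_index y)%:R < y <= (ceil_index y).+1%:R.
Proof.
move=> y0; have /andP[ly yl] := truncn_itv (ltW y0).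
rewrite /ceil_index; case: ifPn => [->/=|]; first exact: ltW.
rewrite -leNgt => ty; have {ly ty}yE : y = (Num.truncn y)%:R by apply/eqP; rewrite eq_le ty.
have : (0 < Num.truncn y)%N by rewrite lt0n; apply: contraTneq y0 => e; rewrite yE e ltxx.
by move: yE; case: (Num.truncn y) => //= k -> _; rewrite ltr_nat ltnSn lexx.
Qed.

Lemma ceil_index_eq y k : 0 < y -> (ceil_index y == k) = (k%:R < y <= k.+1%:R).
Proof.
move=> y0; have /andP[iy yi] := ceil_index_itv y0.
apply/eqP/idP => [<-|/andP[ky yk]]; first by rewrite iy.
apply/eqP; rewrite eqn_leq -ltnS -(ltnS k) -!(ltr_nat R).
by rewrite (lt_le_trans iy yk) (lt_le_trans ky yi).
Qed.

End ceil_index.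

Section grid.
Context {R : realType} (c : R).
Hypothesis c0 : 0 < c.

(** [n.+1] equal cells on [[0, c]], continued past [c] by larger indices. [grid_index] uses cells
    open on the left and closed on the right, like predictable rectangles. *)
Definition grid (n k : nat) : R := c * k%:R / n.+1%:R.
Definition grid_index (n : nat) (s : R) : nat := ceil_index (s * n.+1%:R / c).

Lemma grid0 n : grid n 0 = 0. Proof. by rewrite /grid mulr0 mul0r. Qed.

Lemma grid_last n : grid n n.+1 = c.
Proof. by rewrite /grid mulfK. Qed.

Lemma grid_ge0 n k : 0 <= grid n k.
Proof. by rewrite /grid mulr_ge0// mulr_ge0// ltW. Qed.

Lemma grid_lt n k : grid n k < grid n k.+1.
Proof. by rewrite /grid ltr_pM2r// ltr_pM2l// ltr_nat. Qed.

Lemma grid_le n k j : (k <= j)%N -> grid n k <= grid n j.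
Proof. by move=> kj; rewrite /grid ler_pM2r// ler_pM2l// ler_nat. Qed.

Lemma grid_index_eq n s k : 0 < s ->
  (grid_index n s == k) = (grid n k < s <= grid n k.+1).
Proof.
move=> s0; rewrite /grid_index ceil_index_eq; last by rewrite divr_gt0// mulr_gt0.
rewrite ltr_pdivlMr// ler_pdivrMr// /grid ltr_pdivrMr// ler_pdivlMr//.
by rewrite !(mulrC c).
Qed.

Lemma grid_index_itv n s : 0 < s ->
  grid n (grid_index n s) < s <= grid n (grid_index n s).+1.
Proof. by move=> s0; rewrite -grid_index_eq. Qed.

Lemma grid_step n k : grid n k.+1 = grid n k + c / n.+1%:R.
Proof. by rewrite /grid -[k.+1]addn1 natrD mulrDr mulr1 mulrDl. Qed.

Let cvg_step : (c / n.+1%:R) @[n --> \oo] --> (0 : R).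
Proof.
rewrite -[X in _ --> X](mulr0 c); apply: cvgMr.
exact: cvg_harmonic.
Qed.

Lemma grid_index_ubE n s : 0 < s -> s <= c -> (grid_index n s < n.+1)%N.
Proof.
move=> s0 sc; rewrite ltnNge; apply/negP => ni.
have /andP[h _] := grid_index_itv n s0.
by have := le_lt_trans (grid_le n ni) h; rewrite grid_last ltNge sc.
Qed.

Lemma cvg_grid_up s : 0 < s -> grid n (grid_index n s).+1 @[n --> \oo] --> s.
Proof.
move=> s0; apply: (@squeeze_cvgr _ _ _ _ (cst s) (fun n => s + c / n.+1%:R)).
- apply: nearW => n; have /andP[h ->] := grid_index_itv n s0.
  by rewrite grid_step lerD2r ltW.
- exact: cvg_cst.
- by rewrite -[X in _ --> X]addr0; apply: cvgD => //; exact: cvg_cst.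
Qed.

Lemma cvg_grid_down s : 0 < s -> grid n (grid_index n s) @[n --> \oo] --> s.
Proof.
move=> s0; apply: (@squeeze_cvgr _ _ _ _ (fun n => s - c / n.+1%:R) (cst s)).
- apply: nearW => n; have /andP[h1 h2] := grid_index_itv n s0.
  by rewrite (ltW h1) andbT lerBlDr -grid_step.
- by rewrite -[X in _ --> X]subr0; apply: cvgB => //; exact: cvg_cst.
- exact: cvg_cst.
Qed.

End grid.

(** Terms of the sequence may equal [s], a point that [s^'+] excludes; it can be added because the
    limit is the value [x s]. *)
Lemma cvg_right_sequence (R : realType) (x : R -> R) (s : R) (u : nat -> R) :
  x v @[v --> s^'+] --> x s -> (forall n, s <= u n) ->
  u n @[n --> \oo] --> s -> x (u n) @[n --> \oo] --> x s.
Proof.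
move=> xs su us; apply: cvg_comp; last exact: cvg_at_right_within xs.
move=> U HU; have H : \forall n \near \oo, s <= u n -> U (u n) := us _ HU.
have {}H : \forall n \near \oo, U (u n) by apply: filterS H => n; apply.
exact: H.
Qed.

Lemma cvg_left_sequence (R : realType) (x : R -> R) (s : R) (u : nat -> R) :
  x v @[v --> s^'-] --> x s -> (forall n, u n <= s) ->
  u n @[n --> \oo] --> s -> x (u n) @[n --> \oo] --> x s.
Proof.
move=> xs su us; apply: cvg_comp; last exact: cvg_at_left_within xs.
move=> U HU; have H : \forall n \near \oo, u n <= s -> U (u n) := us _ HU.
have {}H : \forall n \near \oo, U (u n) by apply: filterS H => n; apply.
exact: H.
Qed.

(** Countable gluing over the level sets of [N]: each [f k] matters only on its own level set. *)
Lemma measurable_fun_index d d' (T : measurableType d) (U : measurableType d')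
    (D : set T) (N : T -> nat) (f : nat -> T -> U) :
  (forall k B, measurable B ->
     measurable (D `&` [set z | N z = k] `&` f k @^-1` B)) ->
  measurable_fun D (fun z => f (N z) z).
Proof.
move=> mk mD B mB.
rewrite [X in measurable X](_ : _ =
    \bigcup_k (D `&` [set z | N z = k] `&` f k @^-1` B)).
  by apply: bigcupT_measurable => k; exact: mk.
apply/seteqP; split => [z [Dz /= Bz]|z [k _ [[Dz /= <-] Bz]]]; last by split.
by exists (N z).
Qed.

(** [X] is the limit of its values at the right end of the cell containing the time. The grid stops
    at [c], so only times up to [c] enter: on the space retyped with [F c] this is progressive
    measurability. *)
Lemma measurable_right_continuous (R : realType) d (T : measurableType d)
    (X : R -> T -> R) (c : R) : 0 <= c ->
  (forall s, 0 <= s <= c -> measurable_fun setT (X s)) ->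
  (forall w s, 0 <= s -> X u w @[u --> s^'+] --> X s w) ->
  measurable_fun (`[0, c]%classic `*` setT) (fun z : R * T => X z.1 z.2).
Proof.
rewrite le_eqVlt => /predU1P[<-|c0] mX rX.
  apply: (@eq_measurable_fun _ _ _ _ _ (fun z => X 0 z.2)) => //=.
    by move=> [s w]; rewrite inE/= in_itv/= -eq_le => -[/eqP <-].
  apply: measurable_funTS; apply: measurableT_comp; last exact: measurable_snd.
  by apply: mX; rewrite lexx.
pose D := `[0, c]%classic `*` [set: T].
have mD : measurable D by exact: measurableX.
(* [grid_index] is meaningful for positive times only, so time 0 is read off from [X 0]. *)
pose h (n : nat) (z : R * T) : R :=
  if z.1 <= 0 then X 0 z.2 else X (grid c n (grid_index c n z.1).+1) z.2.
apply: (@measurable_fun_cvg _ _ _ D h) => [n|[s w] [/= + _]]; last first.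
  rewrite in_itv/= le_eqVlt => /andP[/predU1P[<- _|s0 sc]].
    rewrite /h/= lexx; exact: cvg_cst.
  rewrite /h/= leNgt s0/=; apply: (@cvg_right_sequence R (X ^~ w)).
  - by apply: rX; exact: ltW.
  - by move=> n; have /andP[] := grid_index_itv c0 n s0.
  - exact: cvg_grid_up.
have mz : measurable_fun D (fun z : R * T => z.1).
  by apply: measurable_funTS; exact: measurable_fst.
apply: measurable_fun_if => //.
- by apply: measurable_fun_ler.
- apply: measurable_funTS; apply: measurableT_comp; last exact: measurable_snd.
  by apply: mX; rewrite lexx ltW.
pose D1 := `]0, c]%classic `*` [set: T].
rewrite [X in measurable_fun X _](_ : _ = D1); last first.
  apply/seteqP; split => [[s w]|[s w]]; rewrite /D /D1 /= !in_itv/=.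
    by move=> [[/andP[s0 sc] _]] /negbT; rewrite -ltNge => ->; rewrite sc.
  move=> [/andP[s0 sc] _]; split; first by rewrite (ltW s0).
  by apply: negbTE; rewrite -ltNge.
apply: (@measurable_fun_index _ _ _ _ D1 (fun z => grid_index c n z.1)
  (fun k z => X (grid c n k.+1) z.2)) => k B mB.
have [kn|nk] := leqP k n; last first.
  rewrite [X in measurable X](_ : _ = set0)//.
  apply/seteqP; split => // -[s w] [[[/=]]]; rewrite in_itv/= => /andP[s0 sc] _ sk _.
  by have := grid_index_ubE c0 n s0 sc; rewrite sk ltnS leqNgt nk.
rewrite [X in measurable X](_ : _ =
    `]grid c n k, grid c n k.+1] `*` (X (grid c n k.+1) @^-1` B)).
  apply: measurableX => //; rewrite -[X in measurable X]setTI; apply: mX => //.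
  by rewrite grid_ge0//= -[leRHS](grid_last c n) grid_le.
apply/seteqP; split => [[s w] [[[/=]]]|[s w] [/=]].
  rewrite !in_itv/= => /andP[s0 sc] _ /eqP.
  by rewrite grid_index_eq// => -> Bw.
rewrite !in_itv/= => h1 Bw; have /andP[h2 h3] := h1.
have s0 : 0 < s by apply: le_lt_trans h2; exact: grid_ge0.
split => //; split; last by apply/eqP; rewrite grid_index_eq.
rewrite /D1/= in_itv/=; split => //; rewrite s0 (le_trans h3)// -[leRHS](grid_last c n).
exact: grid_le.
Qed.

(** * Paths of the bracket *)

(** On a path where the integral is infinite, the real integral is 0 by default. *)
Definition bracket {R : realType} (delta : R) (x : R -> R) (t : R) : R :=
  delta * t +
  (1 - delta) * \int[lebesgue_measure]_(s in `[0, t]) (x s ^+ 2 / s).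

Section bracket_path.
Context {R : realType} (delta : R) (x : R -> R).
Local Notation mu := (@lebesgue_measure R).
Hypothesis delta01 : 0 <= delta <= 1.
Hypothesis x_right : forall s : R, 0 <= s -> x u @[u --> s^'+] --> x s.
Hypothesis x_left : forall s : R, 0 < s -> cvg (x u @[u --> s^'-]).
Hypothesis x_measurable : forall c : R, 0 <= c -> measurable_fun `[0, c]%classic x.

Let f (s : R) := x s ^+ 2 / s.

Let f0 (s : R) : 0 <= s -> 0 <= f s.
Proof. by move=> s0; rewrite /f mulr_ge0 ?sqr_ge0// invr_ge0. Qed.

Let mf (c : R) : measurable_fun `[0, c]%classic f.
Proof.
have [c0|c0] := leP 0 c; last first.
  by rewrite set_itv_ge ?bnd_simp -?ltNge//; exact: measurable_fun_set0.
apply: measurable_funM; first by apply: measurable_funX; exact: x_measurable.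
exact: measurable_funV.
Qed.

(** One-sided limits bound the path near each point; compactness of [[a, b]], in its near-covering
    form, makes the bound uniform. *)
Lemma cadlag_bounded (a b : R) : 0 < a ->
  exists M, forall s, a <= s <= b -> `|x s| <= M.
Proof.
move=> a0.
have := (compact_near_coveringP `[a, b]%classic).1 (@segment_compact R a b).
move=> /(_ R +oo%R (fun M s => `|x s| <= M) _) [].
  move=> s; rewrite /= in_itv/= => /andP[as_ _].
  have s0 : 0 < s := lt_le_trans a0 as_.
  have near_bound (l : R) (B : set_system R) : Filter B -> x u @[u --> B] --> l ->
      \forall u \near B, `|x u| <= `|l| + 1.
    move=> FB /cvgrPdist_le/(_ 1 ltr01); apply: filterS => u ux.
    have := ler_normB l (l - x u); rewrite opprB addrCA subrr addr0 => h.
    by apply: le_trans h _; rewrite lerD2l.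
  have r := near_bound _ _ _ (x_right (ltW s0)).
  have [l xl] := (cvg_ex _).1 (x_left s0).
  have lft := near_bound _ _ _ xl.
  pose M := Num.max (`|x s| + 1) (`|l| + 1).
  exists ([set u | `|x u| <= M], [set N | M <= N]) => /=.
    split; last by apply: nbhs_pinfty_ge; exact: num_real.
    move: r lft; rewrite /at_right /at_left !near_withinE => r lft.
    near=> u; rewrite /= /M le_max; case: (ltgtP u s) => us.
    - apply/orP; right; move: us; near: u; exact: lft.
    - apply/orP; left; move: us; near: u; exact: r.
    - by rewrite us lerDl ler01.
  by move=> [u N] /= [uM MN]; exact: le_trans MN.
move=> M [_ HM].
exists (M + 1) => s sab; apply: (HM (M + 1)); first by rewrite ltrDl.
by rewrite /= in_itv.
Unshelve. all: by end_near. Qed.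

Let intf_pos (a b : R) : 0 < a -> mu.-integrable `[a, b] (EFin \o f).
Proof.
move=> a0; have [M HM] := cadlag_bounded b a0.
apply: measurable_bounded_integrable => //.
- rewrite /= lebesgue_measure_itv; case: ifP => _ //=.
  by rewrite -EFinB ltry.
- suff : measurable_fun (`[a, b]%classic : set R) f by [].
  apply: (measurable_funS _ _ (mf (c := b))) => // s.
  rewrite /= !in_itv/= => /andP[a_s ->].
  by rewrite (le_trans (ltW a0) a_s).
- exists (M ^+ 2 / a); split; first exact: num_real.
  move=> N MN s /=; rewrite in_itv/= => /andP[a_s sb].
  have s0 : 0 < s := lt_le_trans a0 a_s.
  rewrite ger0_norm ?f0 ?(ltW s0)//; apply: le_trans (ltW MN).
  rewrite /f ler_pM ?sqr_ge0 ?invr_ge0 ?(ltW s0)//; last by rewrite lef_pV2 ?posrE.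
  have Mx : `|x s| <= M by apply: HM; rewrite a_s.
  rewrite -[leLHS]real_normK ?num_real// ler_sqr ?nnegrE//.
  exact: le_trans Mx.
Qed.

(** Away from 0 the integrand is bounded on compact intervals, so integrability at 0 is the only
    question and does not depend on the interval. *)
Lemma bracket_integrable_all (c0 : R) : 0 < c0 ->
  mu.-integrable `[0, c0] (EFin \o f) ->
  forall c, mu.-integrable `[0, c] (EFin \o f).
Proof.
move=> c00 i0 c; have [cc0|c0c] := leP c c0.
  apply: integrableS i0 => // s; rewrite /= !in_itv/= => /andP[-> sc].
  exact: le_trans cc0.
have c_ge0 : 0 <= c by rewrite ltW// (lt_trans c00).
apply: ge0_rintegrable => //; first exact: mf.
  by move=> s; rewrite /= in_itv/= => /andP[s0 _]; exact: f0.
have E : `[0, c]%classic = `[0, c0] `|` `]c0, c] :> set R.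
  by rewrite -itv_bndbnd_setU// bnd_simp ltW.
rewrite E ge0_integral_setU//.
- apply: lte_add_pinfty.
    by rewrite integral_Rintegral// ltry.
  rewrite integral_Rintegral ?ltry//; apply: integrableS (intf_pos c c00) => //.
  by apply: subset_itvr; rewrite bnd_simp.
- rewrite -E; apply/measurable_EFinP; exact: mf.
- by rewrite -E => s /=; rewrite in_itv/= => /andP[s0 _]; rewrite lee_fin f0.
- apply/disj_setPS => s [/=]; rewrite !in_itv/= => /andP[_ sc] /andP[cs _].
  by have := lt_le_trans cs sc; rewrite ltxx.
Qed.

(** The other half of the dichotomy: all integrals over [[0, c]] with [c > 0] are then infinite, and
    take the default value 0. *)
Lemma bracket_not_integrable (c0 : R) : 0 < c0 ->
  ~ mu.-integrable `[0, c0] (EFin \o f) ->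
  forall c, \int[mu]_(s in `[0, c]) f s = 0.
Proof.
move=> c00 ni c; have [c_gt0|c_le0] := ltP 0 c; last first.
  have [->|cN0] := eqVneq c 0; first by rewrite set_itv1 Rintegral_set1.
  by rewrite set_itv_ge ?Rintegral_set0// bnd_simp -ltNge lt_neqAle cN0.
rewrite /Rintegral; have [foo|] := ltP (\int[mu]_(s in `[0%R, c]) (f s)%:E)%E +oo%E.
  exfalso; apply: ni; apply: (bracket_integrable_all c_gt0).
  apply: ge0_rintegrable => //; first exact: mf.
  by move=> s; rewrite /= in_itv/= => /andP[s0 _]; exact: f0.
by rewrite leye_eq => /eqP ->.
Qed.

Lemma bracket0 : bracket delta x 0 = 0.
Proof. by rewrite /bracket set_itv1 Rintegral_set1 !mulr0 addr0. Qed.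

Lemma bracket_nd s t : 0 <= s -> s <= t -> bracket delta x s <= bracket delta x t.
Proof.
move=> s0 st; have /andP[d0 d1] := delta01.
apply: lerD; first by rewrite ler_wpM2l.
rewrite ler_wpM2l ?subr_ge0//.
have [i1|ni] := pselect (mu.-integrable `[0, 1] (EFin \o f)); last first.
  by rewrite !(bracket_not_integrable ltr01 ni).
have ia := bracket_integrable_all ltr01 i1.
rewrite -lee_fin -!integral_Rintegral//; [|exact: ia..].
apply: ge0_subset_integral => //.
- by apply/measurable_EFinP; exact: mf.
- by move=> u; rewrite /= in_itv/= => /andP[u0 _]; rewrite lee_fin f0.
- by move=> u; rewrite /= !in_itv/= => /andP[-> us]; exact: le_trans st.
Qed.

Lemma bracket_continuous (c : R) : 0 <= c ->
  {within `[0, c], continuous (bracket delta x)}.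
Proof.
move=> c0.
have cont_lin : {within `[0, c], continuous (fun t : R => delta * t)}.
  by apply: continuous_subspaceT => t; apply: cvgMr; exact: cvg_id.
have [i1|ni] := pselect (mu.-integrable `[0, 1] (EFin \o f)); last first.
  rewrite (_ : bracket delta x = fun t => delta * t)//.
  by apply/funext => t; rewrite /bracket (bracket_not_integrable ltr01 ni) mulr0 addr0.
have ci := parameterized_integral_continuous c0 (bracket_integrable_all ltr01 i1 c).
move=> t; apply: cvgD; first exact: cont_lin.
by apply: cvgMr; exact: ci.
Qed.

Lemma bracket_right t : 0 <= t ->
  bracket delta x u @[u --> t^'+] --> bracket delta x t.
Proof.
rewrite le_eqVlt => /predU1P[<-|t0].
  by have /(continuous_within_itvP _ ltr01)[_ ? _] := bracket_continuous ler01.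
have t1 : 0 < t + 1 by rewrite addr_gt0.
have /(continuous_within_itvP _ t1)[h _ _] := bracket_continuous (ltW t1).
by apply: cvg_at_right_filter; apply: h; rewrite in_itv/= t0 ltrDl ltr01.
Qed.

Lemma bracket_left t : 0 < t ->
  bracket delta x u @[u --> t^'-] --> bracket delta x t.
Proof.
move=> t0; have t1 : 0 < t + 1 by rewrite addr_gt0.
have /(continuous_within_itvP _ t1)[h _ _] := bracket_continuous (ltW t1).
by apply: cvg_at_left_filter; apply: h; rewrite in_itv/= t0 ltrDl ltr01.
Qed.

End bracket_path.

Section bracket_measurability.
Context {R : realType} d (T : measurableType d).
Local Notation mu := (@lebesgue_measure R).
Variables (X : R -> T -> R) (c : R).
Hypothesis c0 : 0 <= c.
Hypothesis mX : forall s, 0 <= s <= c -> measurable_fun setT (X s).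
Hypothesis X_right : forall w s, 0 <= s -> X u w @[u --> s^'+] --> X s w.

Lemma measurable_path w : measurable_fun `[0, c]%classic (X ^~ w).
Proof.
have mD : measurable (`[0, c]%classic `*` [set: T] : set (R * T)).
  exact: measurableX.
have := measurable_right_continuous c0 mX X_right.
move=> /(measurable_restrictT _ mD) h.
have h1 : measurable_fun setT (fun s : R => ((fun z => X z.1 z.2) \_
    (`[0, c]%classic `*` [set: T])) (s, w)).
  exact: (measurableT_comp h (measurable_pair2 w)).
apply: (eq_measurable_fun _ _ (measurable_funTS h1)) => s sc.
by rewrite patchE ifT// inE; split => //; rewrite inE in sc.
Qed.

Definition weighted_square (z : R * T) : \bar R :=
  ((fun z : R * T => (X z.1 z.2 ^+ 2 / z.1)%:E) \_ (`[0%R, c]%classic `*` setT)) z.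

Lemma measurable_weighted_square : measurable_fun setT weighted_square.
Proof.
apply/(measurable_restrictT _ _).1; first exact: measurableX.
apply/measurable_EFinP; apply: measurable_funM.
  by apply: measurable_funX; exact: measurable_right_continuous.
by apply: measurable_funV; apply: measurable_funTS; exact: measurable_fst.
Qed.

Lemma weighted_square_ge0 z : (0 <= weighted_square z)%E.
Proof.
rewrite /weighted_square patchE; case: ifPn => // /set_mem[/=].
rewrite in_itv/= => /andP[s0 _] _.
by rewrite lee_fin mulr_ge0 ?sqr_ge0// invr_ge0.
Qed.

Lemma integral_weighted_square w :
  (\int[mu]_s weighted_square (s, w) =
   \int[mu]_(s in `[0%R, c]) (X s w ^+ 2 / s)%:E)%E.
Proof.
rewrite [RHS]integral_mkcond; apply: eq_integral => s _.
rewrite /weighted_square !patchE; case: ifPn => [/set_mem[/= sc _]|sc].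
  by rewrite mem_set.
by case: ifPn => // /set_mem sc'; case/negP: sc; apply/mem_set.
Qed.

Lemma measurable_integral_weighted_square : measurable_fun setT (fun w =>
  (\int[mu]_(s in `[0%R, c]) (X s w ^+ 2 / s)%:E)%E).
Proof.
under eq_fun do rewrite -integral_weighted_square.
apply: (@measurable_fun_fubini_tonelli_G _ _ _ _ R mu).
  exact: measurable_weighted_square.
exact: weighted_square_ge0.
Qed.

Lemma measurable_bracket delta :
  measurable_fun setT (fun w => bracket delta (X ^~ w) c).
Proof.
apply: measurable_funD => //; apply: measurable_funM => //.
rewrite /Rintegral; apply: (@measurableT_comp _ _ _ _ _ _ (@fine R)).
  exact: fine_measurable.
exact: measurable_integral_weighted_square.
Qed.

End bracket_measurability.

(** * Adapted and predictable processes *)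

Section predictability.
Context {R : realType} {d : measure_display} {T : measurableType d}.
Variable F : R -> set_system T.
Hypothesis F_filtration : filtration F.

Local Notation rect := (predictable_rectangles F).
Local Notation PT := (g_sigma_algebraType rect).

(** Measurability of the bracket, applied to the space retyped with [F t]: only values of [X] at
    times up to [t] occur. *)
Lemma bracket_adapted (X : R -> T -> R) delta : adapted F X ->
  (forall w s, 0 <= s -> X u w @[u --> s^'+] --> X s w) ->
  adapted F (fun t w => bracket delta (X ^~ w) t).
Proof.
move=> aX rX t t0; have [sF _ FS] := F_filtration.
apply/(measurable_wrtP (sF _ t0)).
apply: (@measurable_bracket _ _ (g_sigma_algebraType (F t)) X t t0) => //.
move=> s /andP[s0 st]; apply/(measurable_wrtP (sF _ t0)).
by move=> A /(aX _ s0); exact: FS.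
Qed.

Let rect_sub A : rect A -> A `<=` `[0, +oo[%classic `*` setT.
Proof.
move=> [[B _ ->]|[s [t [B [s0 st _ ->]]]]] [u w] /=.
  by move=> [-> _]; rewrite in_itv/= lexx.
by rewrite !in_itv/= andbT => -[/andP[su _] _]; split => //; rewrite ltW// (le_lt_trans s0).
Qed.

Let rect_trace : preimage_set_system (`[0, +oo[%classic `*` setT) id rect = rect.
Proof.
apply/seteqP; split => [A [B RB <-]|A RA]; last first.
  by exists A => //; rewrite preimage_id setIidr//; exact: rect_sub.
by rewrite preimage_id setIidr//; exact: rect_sub.
Qed.

Lemma measurable_halfspace :
  measurable (`[0, +oo[%classic `*` setT : set PT).
Proof.
have [sF _ _] := F_filtration.
have FT t : 0 <= t -> F t setT by move=> t0; apply: sub_sigma_setT; exact: sF.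
rewrite (_ : _ `*` _ = ([set 0] `*` setT) `|`
    \bigcup_n (`]0, n.+1%:R]%classic `*` setT)); last first.
  apply/seteqP; split => [[s w] [/=]|[s w] [[/= -> _]|[n _ [/=]]]].
  - rewrite in_itv/= andbT le_eqVlt => /predU1P[<- _|s0 _]; first by left.
    right; exists (Num.truncn s) => //; split => //=.
    by rewrite in_itv/= s0/= ltW// truncnS_gt.
  - by rewrite in_itv/= lexx.
  - by rewrite !in_itv/= andbT => /andP[s0 _] _; split => //; exact: ltW.
apply: measurableU.
  by apply: sub_sigma_algebra; left; exists setT => //; exact: FT.
apply: bigcupT_measurable => n; apply: sub_sigma_algebra; right.
by exists 0, n.+1%:R, setT; split => //; exact: FT.
Qed.

(** Rectangles lie in the half-space, and the half-space is itself a countable union of rectangles.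
    The sigma-algebra generated on it is therefore the trace of the one generated on the whole
    product. *)
Lemma predictableP (A : R -> T -> R) : predictable F A <->
  measurable_fun (`[0, +oo[%classic `*` setT : set PT) (fun p : PT => A p.1 p.2).
Proof.
have E : <<s `[0, +oo[%classic `*` setT, rect >> =
    preimage_set_system (`[0, +oo[%classic `*` setT) id (rect.-sigma.-measurable).
  by rewrite -[in LHS]rect_trace g_sigma_preimageE.
rewrite /predictable E; split => [pA _ B mB|mA _ [B mB <-]].
  have [|C mC <-] := pA ((`[0, +oo[%classic `*` setT) `&` (fun p => A p.1 p.2) @^-1` B).
    by exists B.
  by rewrite preimage_id; apply: measurableI => //; exact: measurable_halfspace.
exists ((`[0, +oo[%classic `*` setT) `&` (fun p => A p.1 p.2) @^-1` B).
  by apply: mA => //; exact: measurable_halfspace.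
by rewrite preimage_id setIA setIid.
Qed.

(** The approximation takes the value at the left end of the cell. There [Y] is known at the start
    of the cell, so level sets are unions of predictable rectangles. *)
Lemma left_continuous_predictable (Y : R -> T -> R) : adapted F Y ->
  (forall w t, 0 < t -> Y u w @[u --> t^'-] --> Y t w) -> predictable F Y.
Proof.
move=> aY lY; apply/predictableP.
have [sF _ _] := F_filtration.
pose D : set PT := `[0, +oo[%classic `*` setT.
have mD : measurable D by exact: measurable_halfspace.
have mD0 : measurable ([set 0] `*` setT : set PT).
  apply: sub_sigma_algebra; left; exists setT => //.
  by apply: sub_sigma_setT; exact: sF.
pose N n (z : PT) := if z.1 <= 0 then 0%N else grid_index 1 n z.1.
pose h n (z : PT) := Y (grid 1 n (N n z)) z.2.
apply: (@measurable_fun_cvg _ _ _ D h) => [n|[t w] [/= + _]]; last first.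
  rewrite in_itv/= andbT le_eqVlt => /predU1P[<-|t0].
    rewrite /h /N/= lexx; under eq_fun do rewrite grid0; exact: cvg_cst.
  rewrite /h /N/= leNgt t0/=; apply: (@cvg_left_sequence R (Y ^~ w)).
  - exact: lY.
  - by move=> n; have /andP[/ltW] := grid_index_itv (c := 1) ltr01 n t0.
  - exact: (cvg_grid_down (c := 1) ltr01).
apply: (@measurable_fun_index _ _ PT _ D (N n) (fun k z => Y (grid 1 n k) z.2)) => k B mB.
have FY : F (grid 1 n k) (Y (grid 1 n k) @^-1` B).
  have g0 : 0 <= grid 1 n k :> R by exact: grid_ge0.
  by apply: (aY _ g0); exists B => //; rewrite setTI.
pose C : set PT := `]grid 1 n k, grid 1 n k.+1]%classic `*` (Y (grid 1 n k) @^-1` B).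
have mC : measurable C.
  apply: sub_sigma_algebra; right.
  exists (grid 1 n k), (grid 1 n k.+1), (Y (grid 1 n k) @^-1` B); split => //.
    exact: grid_ge0.
  exact: grid_lt.
(* [N] sends time 0 to index 0 as well, although the first cell is open at 0; this adds a rectangle
   over the single time 0. *)
pose C0 : set PT := if k == 0%N then [set 0] `*` (Y (grid 1 n k) @^-1` B) else set0.
have mC0 : measurable C0.
  rewrite /C0; case: eqP => // k0; apply: sub_sigma_algebra; left.
  by move: FY; rewrite k0 grid0 => FY; exists (Y 0 @^-1` B).
rewrite [X in measurable X](_ : _ = C `|` C0); first exact: measurableU.
apply/seteqP; split => [[s w]|[s w]].
  rewrite /D /C /C0 /N /= in_itv/= andbT => -[[[+ _]]].
  rewrite le_eqVlt => /predU1P[<-|s0].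
    by rewrite lexx => <-; right => /=.
  by rewrite leNgt s0/= => /eqP; rewrite grid_index_eq// => sk Bw; left; rewrite in_itv.
move=> [|].
  rewrite /C /D /N /= !in_itv/= andbT => -[sk Bw].
  have s0 : 0 < s by have /andP[h1 _] := sk; apply: le_lt_trans h1; exact: grid_ge0.
  rewrite (ltW s0); split => //; split => //.
  by rewrite leNgt s0/=; apply/eqP; rewrite grid_index_eq.
rewrite /C0; case: eqP => // -> [/= -> Bw]; rewrite /D /N /= in_itv/= lexx.
by split.
Qed.

End predictability.

Lemma ge0_integral_mrestr d (T : measurableType d) (R : realType)
    (mu : {measure set T -> \bar R}) (D : set T) (mD : measurable D) (f : T -> R) :
  measurable_fun setT f -> (forall x, 0 <= f x) ->
  (\int[mrestr mu mD]_x (f x)%:E = \int[mu]_(x in D) (f x)%:E)%E.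
Proof.
move: f; apply: (@nnfun_ind _ T R (fun f =>
  (\int[mrestr mu mD]_x (f x)%:E = \int[mu]_(x in D) (f x)%:E)%E)).
- by move=> A mA; rewrite !integral_indic// setIT.
- move=> f g mf mg f0 g0 ef eg; under [LHS]eq_integral do rewrite EFinD.
  rewrite [LHS]ge0_integralD ?ef ?eg//; last 4 first.
  + by move=> x _; rewrite lee_fin.
  + exact/measurable_EFinP.
  + by move=> x _; rewrite lee_fin.
  + exact/measurable_EFinP.
  under [RHS]eq_integral do rewrite EFinD.
  rewrite ge0_integralD//.
  + by move=> x _; rewrite lee_fin.
  + by apply: measurable_funTS; exact/measurable_EFinP.
  + by move=> x _; rewrite lee_fin.
  + by apply: measurable_funTS; exact/measurable_EFinP.
- move=> k f k0 mf f0 ef; under [LHS]eq_integral do rewrite EFinM.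
  rewrite [LHS]ge0_integralZl_EFin ?ef//; last 2 first.
  + by move=> x _; rewrite lee_fin.
  + exact/measurable_EFinP.
  under [RHS]eq_integral do rewrite EFinM.
  rewrite ge0_integralZl_EFin//.
  + by move=> x _; rewrite lee_fin.
  + by apply: measurable_funTS; exact/measurable_EFinP.
- move=> h f mh h0 ndh mf hf eh.
  have c1 (E : set T) (m : {measure set T -> \bar R}) : measurable E ->
      (\int[m]_(x in E) (h n x)%:E)%E @[n --> \oo] --> (\int[m]_(x in E) (f x)%:E)%E.
    move=> mE.
    rewrite (_ : (\int[m]_(x in E) (f x)%:E)%E =
        (\int[m]_(x in E) limn (fun n => (h n x)%:E))%E); last first.
      apply: eq_integral => x _; apply/esym/cvg_lim => //.
      by apply: cvg_EFin; [exact: nearW|exact: hf].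
    apply: cvg_monotone_convergence => //.
    + by move=> n; apply: measurable_funTS; exact/measurable_EFinP.
    + by move=> n x _; rewrite lee_fin.
    + by move=> x _ m' n' mn; rewrite lee_fin; exact: ndh.
  rewrite -(cvg_lim _ (c1 setT (mrestr mu mD) measurableT))//.
  rewrite -(cvg_lim _ (c1 D mu mD))//.
  by congr (limn _); apply/funext => n; exact: eh.
Qed.

(** * The measure of an increasing process on the product *)

Section stieltjes_on_product.
Context {R : realType} {d : measure_display} {T : measurableType d}.
Variables (P : probability T R) (B : R -> T -> R) (c : R).
Local Notation mu := (@lebesgue_measure R).
Hypothesis c0 : 0 < c.
Hypothesis B_increasing : increasing_process B.
Hypothesis B_0 : forall w, B 0 w = 0.
Hypothesis mB : forall t, 0 <= t -> measurable_fun setT (B t).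

Let B_nd w s t : 0 <= s -> s <= t -> B s w <= B t w.
Proof. by have [h _] := B_increasing w; exact: h. Qed.

Let B_ge0 w t : 0 <= t -> 0 <= B t w.
Proof. by move=> t0; rewrite -(B_0 w); exact: B_nd. Qed.

Let dom : set (R * T) := [set z | 0 < z.1 <= B c z.2].

Let mdom : measurable dom.
Proof.
have mBc : measurable_fun setT (fun z : R * T => B c z.2).
  by apply: measurableT_comp; [exact: mB (ltW c0)|exact: measurable_snd].
have h : measurable_fun setT (fun z : R * T => 0 < z.1 <= B c z.2).
  apply: measurable_and; first by apply: measurable_fun_ltr => //; exact: measurable_fst.
  by apply: measurable_fun_ler => //; exact: measurable_fst.
have := h measurableT [set true]; rewrite setTI; exact.
Qed.

(* Generalized inverse of the path, with junk value [0] off [dom]. *)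
Definition hitting_time (z : R * T) : R :=
  if 0 < z.1 <= B c z.2 then inf [set s | 0 <= s <= c /\ z.1 <= B s z.2] else 0.

(** The Galois connection between a right-continuous increasing path and its generalized inverse;
    right continuity makes the infimum attained. *)
Lemma hitting_time_le u w s : 0 < u <= B c w -> 0 <= s <= c ->
  (hitting_time (u, w) <= s) = (u <= B s w).
Proof.
move=> uw sc; rewrite /hitting_time uw.
set S := [set s | _]; have /andP[u0 uB] := uw; have /andP[s0 sc'] := sc.
have lbS : lbound S 0 by move=> v [/andP[]].
have Sc : S c by split => //; rewrite (ltW c0) lexx.
have infS : has_inf S by split; [exists c|exists 0].
apply/idP/idP => [h|h]; last by apply: ge_inf; [exists 0|split].
have t0 : 0 <= inf S by apply: lb_le_inf => //; exists c.
apply: le_trans (B_nd w t0 h); rewrite leNgt; apply/negP => Bu.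
have [_ rB] := B_increasing w.
(* If the path were below [u] at the infimum, it would remain so just after it, where elements of
   the set exist. *)
have := cvgr_lt (B (inf S) w) (rB _ t0) u Bu.
rewrite near_withinE /= => -[e /= e0 he].
have [v [[/andP[v0 vc] uv] ve]] := inf_adherent e0 infS.
have iv : inf S <= v by apply: ge_inf; [exists 0|split; [rewrite v0|]].
move: iv; rewrite le_eqVlt => /predU1P[iv|iv].
  by move: Bu; rewrite iv ltNge uv.
have := he v; rewrite /ball/= distrC gtr0_norm ?subr_gt0// ltrBlDl => /(_ ve iv).
by rewrite ltNge uv.
Qed.

Lemma hitting_time_itv z : 0 <= hitting_time z <= c.
Proof.
case: z => u w; rewrite /hitting_time; case: ifPn => [/andP[u0 uB]|_]; last first.
  by rewrite lexx ltW.
set S := [set s | _].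
have Sc : S c by split => //; rewrite (ltW c0) lexx.
have lbS : lbound S 0 by move=> v [/andP[]].
apply/andP; split; first by apply: lb_le_inf => //; exists c.
by apply: ge_inf => //; exists 0.
Qed.

(** By the Galois connection, for [0 <= s < c], the event that the hitting time exceeds [s] is the
    part of [dom] on which [B s] is less than [u]. *)
Lemma measurable_hitting_time : measurable_fun setT hitting_time.
Proof.
apply: (measurability _ (RGenOInfty.measurableE R)) => //.
move=> _ [_ [s ->] <-]; rewrite setTI.
have [s0|s0] := ltP s 0.
  rewrite (_ : _ @^-1` _ = setT)//; apply/seteqP; split => // z _ /=.
  rewrite in_itv/= andbT; apply: lt_le_trans s0 _.
  by have /andP[] := hitting_time_itv z.
have [cs|sc] := leP c s.
  rewrite (_ : _ @^-1` _ = set0)//; apply/seteqP; split => // z /=.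
  rewrite in_itv/= andbT ltNge => /negP; apply.
  by apply: le_trans cs; have /andP[] := hitting_time_itv z.
rewrite (_ : _ @^-1` _ = dom `&` [set z | B s z.2 < z.1]).
  apply: measurableI => //.
  have mBs : measurable_fun setT (fun z : R * T => B s z.2).
    by apply: measurableT_comp; [exact: mB|exact: measurable_snd].
  have h : measurable_fun setT (fun z : R * T => B s z.2 < z.1).
    by apply: measurable_fun_ltr => //; exact: measurable_fst.
  have := h measurableT [set true]; rewrite setTI; exact.
apply/seteqP; split => [[u w]|[u w]] /=; rewrite in_itv/= andbT.
  have [uw|uw] := boolP (0 < u <= B c w).
    by rewrite ltNge hitting_time_le ?s0 ?(ltW sc)// -ltNge => h; split.
  by rewrite /hitting_time (negbTE uw) ltNge s0.
move=> [uw]; rewrite [B s w < u]ltNge -hitting_time_le ?s0 ?(ltW sc)//.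
by rewrite -ltNge.
Qed.

Let phi (z : R * T) : R * T := (hitting_time z, z.2).

Let mphi : measurable_fun setT phi.
Proof.
by apply: measurable_fun_pair; [exact: measurable_hitting_time|exact: measurable_snd].
Qed.

(* The measure [dB_s(w) P(dw)] on [0, c] x T: the image of Lebesgue measure
   under the change of time [u = B_s]. *)
Lemma stieltjes_measure : exists M : {measure set (R * T) -> \bar R},
  forall f : R * T -> R, measurable_fun setT f -> (forall z, 0 <= f z) ->
  (\int[M]_z (f z)%:E = \int[P]_w \int[mu]_u
     ((f (hitting_time (u, w), w))%:E * (\1_dom (u, w))%:E))%E.
Proof.
unshelve refine (ex_intro _ (pushforward (mrestr (mu \x P)%E mdom) phi
  : {measure set (R * T) -> \bar R}) _); first exact: mphi.
move=> f mf f0; rewrite ge0_integral_pushforward//; last 2 first.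
- exact/measurable_EFinP.
- by move=> z _; rewrite lee_fin.
rewrite preimage_setT.
transitivity (\int[mu \x P]_(z in dom) ((f \o phi) z)%:E)%E.
  apply: (@ge0_integral_mrestr _ _ R (mu \x P)%E dom mdom (f \o phi)); last by move=> z; exact: f0.
  exact: (measurableT_comp mf mphi).
rewrite integral_mkcond.
pose g z : \bar R := ((f (hitting_time z, z.2))%:E * (\1_dom z)%:E)%E.
transitivity (\int[mu \x P]_z g z)%E.
  apply: eq_integral => z _; rewrite patchE /g indicE.
  by case: ifPn => _; rewrite ?mule1 ?mule0.
rewrite (@fubini_tonelli2 _ _ _ _ R mu P g)//.
- apply: emeasurable_funM; last exact/measurable_EFinP/measurable_indic.
  by apply/measurable_EFinP; exact: (measurableT_comp mf mphi).
- by move=> z; rewrite /g mule_ge0 ?lee_fin.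
Qed.

(** The hitting time of level [u] lies in []a, b]] exactly when [u] lies in []B a, B b]], whose
    length is the increment. It is positive on [dom] because [B] starts at 0, hence no mass sits at
    time 0. *)
Lemma stieltjes_measure_step : exists M : {measure set (R * T) -> \bar R},
  [/\ forall a b (g : T -> R), 0 <= a -> a <= b -> b <= c ->
        measurable_fun setT g -> (forall w, 0 <= g w) ->
        (\int[M]_z (\1_(`]a, b]%classic : set R) z.1 * g z.2)%:E =
         \int[P]_w (g w * (B b w - B a w))%:E)%E,
      M (~` (`]0, c]%classic `*` setT)) = 0%E &
      M setT = (\int[P]_w (B c w)%:E)%E].
Proof.
have [M HM] := stieltjes_measure; exists M.
have key a b w : 0 <= a -> a <= b -> b <= c ->
    (fun u => \1_(`]a, b]%classic : set R) (hitting_time (u, w)) * \1_dom (u, w)) =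
    \1_(`]B a w, B b w]%classic : set R) :> (R -> R).
  move=> a0 ab bc; apply/funext => u; rewrite !indicE.
  have -> : ((u, w) \in dom) = (0 < u <= B c w) by apply/idP/idP; rewrite inE.
  have b0 := le_trans a0 ab; have ac := le_trans ab bc.
  rewrite !mem_setE !in_itv/= ltNge.
  have [uw|uw] := boolP (0 < u <= B c w).
    by rewrite mulr1 !hitting_time_le ?a0 ?b0// -ltNge.
  rewrite mulr0; case: (boolP (B a w < u <= B b w)) => // /andP[Bu uB]; case/negP: uw.
  by rewrite (le_lt_trans _ Bu) ?B_ge0//= (le_trans uB)// B_nd.
have step a b (g : T -> R) : 0 <= a -> a <= b -> b <= c ->
        measurable_fun setT g -> (forall w, 0 <= g w) ->
        (\int[M]_z (\1_(`]a, b]%classic : set R) z.1 * g z.2)%:E =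
         \int[P]_w (g w * (B b w - B a w))%:E)%E.
  move=> a0 ab bc mg g0; rewrite HM; last 2 first.
  - apply: measurable_funM; first exact: measurable_indic_comp.
    exact: measurableT_comp.
  - by move=> z; rewrite mulr_ge0.
  apply: eq_integral => w _.
  transitivity (\int[mu]_u ((g w)%:E * (\1_(`]B a w, B b w]%classic : set R) u)%:E))%E.
    apply: eq_integral => u _; rewrite -(key a b w a0 ab bc)/= -!EFinM.
    by congr EFin; ring.
  rewrite ge0_integralZl_EFin//; last exact/measurable_EFinP/measurable_indic.
  rewrite integral_indic// setIT /= lebesgue_measure_itv/= lte_fin EFinM; congr (_ * _)%E.
  case: ltP => // Bba; have Bab := B_nd w a0 ab.
  by rewrite (_ : B b w = B a w) ?subrr//; apply/eqP; rewrite eq_le Bba.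
split => //.
- have mC : measurable (~` (`]0, c]%classic `*` setT) : set (R * T)).
    by apply: measurableC; exact: measurableX.
  have := HM (\1_(~` (`]0, c]%classic `*` setT))).
  rewrite integral_indic// setIT => ->//.
  apply: integral0_eq => w _; apply: integral0_eq => u _.
  rewrite -EFinM; congr EFin; rewrite !indicE; have [uw|] := boolP ((u, w) \in dom).
    rewrite mulr1 memNset//= => -[] /=; split => //; rewrite in_itv/=.
    move: uw; rewrite inE => uw; have /andP[_ ->] := hitting_time_itv (u, w).
    rewrite andbT ltNge hitting_time_le ?lexx ?(ltW c0)// B_0 -ltNge.
    by have /andP[] := uw.
  by rewrite mulr0.
- rewrite -[LHS]mul1e -integral_cst//.
  have -> : (\int[M]_z cst 1 z = \int[M]_z (cst 1%R z)%:E)%E by [].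
  rewrite HM//.
  apply: eq_integral => w _.
  transitivity (\int[mu]_u (\1_(`]B 0 w, B c w]%classic : set R) u)%:E)%E.
    apply: eq_integral => u _; rewrite -(key 0 c w)// ?ltW// mul1e; congr EFin.
    rewrite !indicE; have [uw|] := boolP ((u, w) \in dom); last by rewrite mulr0.
    rewrite mulr1 mem_set//= in_itv/=.
    move: uw; rewrite inE => uw; have /andP[_ ->] := hitting_time_itv (u, w).
    rewrite andbT ltNge hitting_time_le ?lexx ?(ltW c0)// B_0 -ltNge.
    by have /andP[] := uw.
  rewrite integral_indic// setIT /= lebesgue_measure_itv/= lte_fin B_0.
  case: ltP => [_|]; first by rewrite oppr0 adde0.
  by have := B_ge0 w (ltW c0) => h1 h2; congr EFin; apply/eqP; rewrite eq_le h1.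
Qed.

End stieltjes_on_product.

(** * Uniqueness of the compensator *)

Section pseudo_huber.
Context {R : realType}.
Implicit Types x y : R.

(** A convex function, quadratic near 0 and linear at infinity, vanishing only at 0; [pseudo_huber']
    is its derivative. *)
Definition pseudo_huber x : R := Num.sqrt (1 + x ^+ 2) - 1.
Definition pseudo_huber' x : R := x / Num.sqrt (1 + x ^+ 2).

Let sq1 x : 1 <= 1 + x ^+ 2. Proof. by rewrite lerDl sqr_ge0. Qed.

Let sq_ge1 x : 1 <= Num.sqrt (1 + x ^+ 2).
Proof. by rewrite -[leLHS]sqrtr1 ler_sqrt// (le_trans _ (sq1 x)). Qed.

Let sqK x : Num.sqrt (1 + x ^+ 2) ^+ 2 = 1 + x ^+ 2.
Proof. by rewrite sqr_sqrtr// (le_trans _ (sq1 x)). Qed.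

Lemma pseudo_huber_ge0 x : 0 <= pseudo_huber x.
Proof. by rewrite subr_ge0. Qed.

Lemma pseudo_huber_eq0 x : pseudo_huber x = 0 -> x = 0.
Proof.
move=> /eqP; rewrite subr_eq0 => /eqP e.
by have := sqK x; rewrite e expr1n => /eqP; rewrite eq_sym addrC -subr_eq0 addrK sqrf_eq0 => /eqP.
Qed.

Lemma pseudo_huber_le_norm x : pseudo_huber x <= `|x|.
Proof.
rewrite lerBlDr -ler_sqr ?nnegrE ?addr_ge0//.
rewrite sqK sqrrD real_normK ?num_real// expr1n mulr1 addrC lerD2r lerDl.
by rewrite mulrn_wge0.
Qed.

Lemma pseudo_huber'_norm x : `|pseudo_huber' x| <= 1.
Proof.
have s0 : 0 < Num.sqrt (1 + x ^+ 2) := lt_le_trans ltr01 (sq_ge1 x).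
rewrite normrM normfV (gtr0_norm s0) ler_pdivrMr// mul1r.
rewrite -ler_sqr ?nnegrE ?(ltW s0)// sqK real_normK ?num_real//.
by rewrite lerDr.
Qed.

(** The tangent inequality at [y]. After clearing the denominator it is the Cauchy-Schwarz
    inequality for the vectors [(1, x)] and [(1, y)]. *)
Lemma pseudo_huber_convex x y :
  pseudo_huber y - pseudo_huber x <= pseudo_huber' y * (y - x).
Proof.
rewrite /pseudo_huber /pseudo_huber' opprB addrA subrK.
have := sqK x; have := sqK y; have := sq_ge1 x; have := sq_ge1 y.
set a := Num.sqrt (1 + x ^+ 2); set b := Num.sqrt (1 + y ^+ 2) => b1 a1 b2 a2.
have b0 : 0 < b := lt_le_trans ltr01 b1.
have a0 : 0 < a := lt_le_trans ltr01 a1.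
have ab : 1 + x * y <= a * b.
  have [h|h] := leP (1 + x * y) 0; first by apply: le_trans h _; rewrite mulr_ge0 ?ltW.
  rewrite -ler_sqr ?nnegrE ?mulr_ge0 ?(ltW h) ?(ltW a0) ?(ltW b0)//.
  rewrite exprMn a2 b2; have := sqr_ge0 (x - y); nra.
rewrite -(ler_pM2r b0) (_ : y / b * (y - x) * b = y * (y - x)); last first.
  by field; rewrite gt_eqF.
nra.
Qed.

Lemma measurable_pseudo_huber : measurable_fun setT pseudo_huber.
Proof.
apply: measurable_funB => //.
apply: (@measurableT_comp _ _ _ _ _ _ (@Num.sqrt R)).
  exact: continuous_measurable_fun (@sqrt_continuous R).
by apply: measurable_funD => //; exact: measurable_funX.
Qed.

Lemma continuous_pseudo_huber' : continuous pseudo_huber'.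
Proof.
move=> x; apply: cvgM; first exact: cvg_id.
apply: cvgV; first by rewrite gt_eqF// (lt_le_trans ltr01 (sq_ge1 x)).
apply: (@cvg_comp _ _ _ (fun x : R => 1 + x ^+ 2) (@Num.sqrt R)).
  by apply: cvgD; [exact: cvg_cst|exact: exprn_continuous].
exact: sqrt_continuous.
Qed.

End pseudo_huber.

(** * Comparison of two compensators *)

Section compensator_uniqueness.
Context {R : realType} {d : measure_display} {T : measurableType d}.
Variables (P : probability T R) (F : R -> set_system T) (X : R -> T -> R).
Hypothesis F_filtration : filtration F.
Hypothesis iX2 : forall t, 0 <= t -> P.-integrable setT (EFin \o (fun w => X t w ^+ 2)).
Local Notation mu := (@lebesgue_measure R).
Local Notation intg f := (P.-integrable setT (EFin \o f)).
Local Notation rect := (predictable_rectangles F).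

Let Fm t : 0 <= t -> F t `<=` measurable.
Proof. by case: F_filtration => _ h _ /h. Qed.

Let rect_measurable : rect `<=` measurable.
Proof.
move=> C [[E FE ->]|[s [t [E [s0 st FE ->]]]]]; apply: measurableX => //.
  exact: Fm FE.
exact: Fm FE.
Qed.

Section one_compensator.
Variable A : R -> T -> R.
Hypothesis compA : compensates_square P F X A.

(** [A t] is the difference of [X t ^+ 2] and the martingale, both integrable. *)
Lemma compensator_integrable t : 0 <= t -> intg (A t).
Proof.
move=> t0; case: compA => _ _ _ [_ /(_ t t t0 (lexx t)) [iM _ _ _]].
have := rintegrableB measurableT (iX2 t0) iM.
by apply: eq_integrable => // w _ /=; rewrite opprB addrC subrK.
Qed.

Lemma compensator_measurable t : 0 <= t -> measurable_fun setT (A t).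
Proof. by move=> t0; exact: rintegrable_measurable (compensator_integrable t0). Qed.

Lemma compensator_increment s t E : 0 <= s -> s <= t -> F s E ->
  \int[P]_(w in E) (A t w - A s w) = \int[P]_(w in E) (X t w ^+ 2 - X s w ^+ 2).
Proof.
move=> s0 st FE; have t0 := le_trans s0 st; have mE := Fm s0 FE.
have iE (f : T -> R) : intg f -> P.-integrable E (EFin \o f).
  by apply: integrableS.
case: compA => _ _ _ [_ /(_ s t s0 st) [iMt iMs _ /(_ E FE)]].
move=> /(congr1 fine); rewrite -2![fine _]/(Rintegral _ _ _).
rewrite !RintegralB//; try by apply: iE; rewrite ?iX2 ?compensator_integrable.
move=> h; apply/eqP; rewrite -subr_eq0; apply/eqP.
by move/eqP: h; rewrite -subr_eq0 => /eqP h; rewrite -[RHS]oppr0 -h; ring.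
Qed.

(** The total mass and the values on rectangles are written in terms of [X] alone, which is what
    allows two compensators to be compared. As [M] lives on []0, c]], a rectangle may be cut at time
    [c]; this explains the minimum. *)
Lemma compensator_measure c : 0 < c ->
  exists M : {measure set (R * T) -> \bar R},
  [/\ forall a b (g : T -> R), 0 <= a -> a <= b -> b <= c ->
        measurable_fun setT g -> (forall w, 0 <= g w) ->
        (\int[M]_z (\1_(`]a, b]%classic : set R) z.1 * g z.2)%:E =
         \int[P]_w (g w * (A b w - A a w))%:E)%E,
      M setT = (\int[P]_w (X c w ^+ 2 - X 0 w ^+ 2))%:E,
      forall E, F 0 E -> M ([set 0] `*` E) = 0%E &
      forall s t E, 0 <= s -> s < t -> F s E ->
        M (`]s, t]%classic `*` E) = if s < c
          then (\int[P]_(w in E) (X (Num.min t c) w ^+ 2 - X s w ^+ 2))%:E else 0%E].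
Proof.
move=> c0; have [_ incA A0 [_ mart]] := compA.
have [M [stepM nullM totM]] := stieltjes_measure_step P c0 incA A0 compensator_measurable.
pose D : set (R * T) := `]0, c]%classic `*` setT.
have mD : measurable D by exact: measurableX.
have M_D C : measurable C -> M C = M (C `&` D).
  move=> mC; rewrite (measureDI M mC mD).
  rewrite [X in (X + _)%E](_ : _ = 0%E) ?add0e//.
  by apply: (subset_measure0 _ _ _ nullM) => //; [exact: measurableD|exact: measurableC].
exists M; split => //.
- rewrite totM; rewrite (eq_integral (fun w => (A c w - A 0 w)%:E)); last first.
    by move=> w _; rewrite A0 subr0.
  rewrite integral_Rintegral//; last first.
    apply: rintegrableB => //; apply: compensator_integrable; last exact: lexx.
    exact: ltW.
  rewrite compensator_increment ?lexx ?(ltW c0)//.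
  by apply: sub_sigma_setT; case: F_filtration => h _ _; exact: h.
- move=> E FE; apply: (subset_measure0 _ _ _ nullM).
  + by apply: measurableX => //; exact: Fm FE.
  + exact: measurableC.
  + by move=> [u w] /= [-> _] [/=]; rewrite in_itv/= ltxx.
- move=> s t E s0 st FE; have mE := Fm s0 FE.
  rewrite M_D; last exact: measurableX.
  case: ltP => sc; last first.
    rewrite (_ : _ `&` _ = set0) ?measure0//; apply/seteqP; split => // -[u w] [[/=]].
    rewrite !in_itv/= => /andP[su _] _ [/andP[_ uc] _].
    by have := lt_le_trans su uc; rewrite ltNge sc.
  have s_min : s <= Num.min t c by rewrite le_min !ltW.
  have min0 : 0 <= Num.min t c := le_trans s0 s_min.
  rewrite (_ : _ `&` _ = `]s, Num.min t c]%classic `*` E); last first.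
    apply/seteqP; split => [[u w] [[/= + Ew] [/= + _]]|[u w] [/= + Ew]].
      rewrite !in_itv/= => /andP[su ut] /andP[_ uc]; split => //=.
      by rewrite ?in_itv/= su le_min ut.
    rewrite in_itv/= le_min => /and3P[su ut uc].
    by split; split; rewrite //= in_itv/= ?su// uc (le_lt_trans s0 su).
  rewrite -compensator_increment//.
  have mI : measurable_fun setT (\1_E : T -> R) by exact: measurable_indic.
  have minc : Num.min t c <= c by rewrite ge_min lexx orbT.
  have h := stepM s (Num.min t c) \1_E s0 s_min minc mI (fun w => ler0n _ _).
  rewrite -[LHS]mul1e -integral_cst//; last exact: measurableX.
  rewrite integral_mkcond.
  transitivity (\int[M]_z (\1_(`]s, Num.min t c]%classic : set R) z.1 * \1_E z.2)%:E)%E.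
    apply: eq_integral => z _; rewrite patchE !indicE -natrM mulnb.
    case: ifPn => [/set_mem[/= zs zE]|zN]; first by rewrite !mem_set.
    rewrite (_ : _ && _ = false)//; apply: contraNF zN => /andP[/set_mem z1 /set_mem z2].
    by apply/mem_set.
  rewrite h//.
  rewrite -[RHS]integral_Rintegral//; last first.
    apply: (integrableS measurableT mE (subsetT E)).
    by apply: rintegrableB => //; exact: compensator_integrable.
  rewrite [RHS]integral_mkcond; apply: eq_integral => w _.
  by rewrite patchE indicE; case: ifPn => _; rewrite ?mul1r ?mul0r.
Qed.

End one_compensator.

Section two_compensators.
Variables A B : R -> T -> R.
Hypotheses (compA : compensates_square P F X A) (compB : compensates_square P F X B).

(** The whole product is not a rectangle; adding it gives a pi-system that contains a set of finite
    measure covering the space, as uniqueness of measures requires. *)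
Let G := rect `|` [set setT].

Let setI_G : setI_closed G.
Proof.
have [sF _ FS] := F_filtration.
have FI t E E' : 0 <= t -> F t E -> F t E' -> F t (E `&` E').
  move=> t0 FE FE'; have [F0 FC FU] := sF _ t0.
  rewrite -(setCK (E `&` E')) setCI -setTD; apply: (FC).
  rewrite -bigcup2E; apply: FU => -[|[|n]] //=; by rewrite -setTD; exact: FC.
have F0 t : 0 <= t -> F t set0 by move=> t0; have [] := sF _ t0.
have rect0 : rect set0.
  by left; exists set0; [exact: F0|rewrite setX0].
move=> C C' [RC|->] [RC'|->]; rewrite ?setTI ?setIT; try by [left|right].
left; case: RC => [[E FE ->]|[s [t [E [s0 st FE ->]]]]];
    case: RC' => [[E' FE' ->]|[s' [t' [E' [s'0 s't' FE' ->]]]]].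
- left; exists (E `&` E'); first exact: FI.
  by rewrite -setXI setIid.
- rewrite -setXI (_ : [set 0] `&` _ = set0) ?set0X//.
  by apply/seteqP; split => // u [/= ->]; rewrite in_itv/= ltNge s'0.
- rewrite -setXI (_ : _ `&` [set 0] = set0) ?set0X//.
  by apply/seteqP; split => // u [/= + u0]; rewrite u0 in_itv/= ltNge s0.
- rewrite -setXI (_ : _ `&` _ = `]Num.max s s', Num.min t t']%classic); last first.
    apply/seteqP; split => u /=; rewrite !in_itv/= gt_max le_min.
      by move=> [/andP[-> ->] /andP[-> ->]].
    by move=> /andP[/andP[-> ->] /andP[-> ->]].
  have [mm|mm] := ltP (Num.max s s') (Num.min t t'); last first.
    by rewrite set_itv_ge ?set0X// bnd_simp -leNgt.
  have max0 : 0 <= Num.max s s' by rewrite le_max s0.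
  right; exists (Num.max s s'), (Num.min t t'), (E `&` E'); split => //.
  apply: FI => //; [apply: FS FE|apply: FS FE'] => //; by rewrite le_max lexx ?orbT.
Qed.

(** The Riemann sums of [f (N)] against [dN] tend to 0, because both measures give [f (N_s)] the
    same integral; by convexity each sum dominates the mean of [pseudo_huber (N c)]. *)
Lemma compensator_terminal c : 0 < c -> ae_eq P setT (A c) (B c).
Proof.
move=> c0.
have [MA [stepA totA zeroA rectA]] := compensator_measure compA c0.
have [MB [stepB totB zeroB rectB]] := compensator_measure compB c0.
have agree C : <<s rect >> C -> MA C = MB C.
  move=> sC; have {}sC : <<s G >> C.
    by apply: sub_smallest2r sC; [exact: smallest_sigma_algebra|move=> ?; left].
  apply: (g_sigma_algebra_measure_unique G _ (fun=> setT)) => //.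
  - move=> E [|->//]; exact: rect_measurable.
  - by move=> _; right.
  - by rewrite bigcup_const//; exists 0%N.
  - move=> E [[[E' FE' ->]|[s [t [E' [s0 st FE' ->]]]]]|->].
    + by rewrite zeroA// zeroB.
    + by rewrite rectA// rectB.
    + by rewrite totA totB.
  - by move=> _; rewrite totA ltry.
pose N t w := B t w - A t w.
have mN t : 0 <= t -> measurable_fun setT (N t).
  by move=> t0; apply: measurable_funB; exact: compensator_measurable.
have iA t : 0 <= t -> intg (A t) by exact: compensator_integrable.
have iB t : 0 <= t -> intg (B t) by exact: compensator_integrable.
have iN t : 0 <= t -> intg (N t) by move=> t0; apply: rintegrableB => //; [exact: iB|exact: iA].
have [_ incA A0 _] := compA; have [_ incB B0 _] := compB.
have N0 w : N 0 w = 0 by rewrite /N A0 B0 subr0.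
(* The shift by 1 makes the integrand nonnegative; what it adds is [E[N c] = 0]. *)
pose f (x : R) : R := pseudo_huber' x + 1.
have f02 x : 0 <= f x <= 2.
  have := pseudo_huber'_norm x; rewrite ler_norml => /andP[h1 h2].
  by rewrite /f; apply/andP; split; lra.
have cf : continuous f.
  by move=> x; apply: cvgD; [exact: continuous_pseudo_huber'|exact: cvg_cst].
have mf : measurable_fun setT f by exact: continuous_measurable_fun.
pose t_ n k := grid c n k.
(* The value on a cell is taken at its right end. [S n] need not be predictable, but its limit [L]
   is, and only [L] is compared under the two measures. *)
pose S n (z : R * T) : R := \sum_(k < n.+1)
  \1_(`]t_ n k, t_ n k.+1]%classic : set R) z.1 * f (N (t_ n k.+1) z.2).
have t0 n k : 0 <= t_ n k by exact: grid_ge0.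
have mfN n k : measurable_fun setT (fun w => f (N (t_ n k) w)).
  by apply: measurableT_comp => //; exact: mN.
have mterm n k : measurable_fun setT (fun z : R * T =>
    \1_(`]t_ n k, t_ n k.+1]%classic : set R) z.1 * f (N (t_ n k.+1) z.2)).
  apply: measurable_funM; first exact: measurable_indic_comp.
  exact: (measurableT_comp (mfN n k.+1) measurable_snd).
have SE n s w : 0 < s -> s <= c ->
    S n (s, w) = f (N (t_ n (grid_index c n s).+1) w).
  move=> s0 sc; have ln := grid_index_ubE c0 n s0 sc.
  rewrite /S (bigD1 (Ordinal ln))//= big1 ?addr0.
    rewrite indicE mem_set ?mul1r//= in_itv/=; exact: grid_index_itv.
  move=> k kN; rewrite indicE memNset ?mul0r//= in_itv/= -grid_index_eq//.
  by move=> /eqP e; case/eqP: kN; apply/val_inj; rewrite /= e.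
have S0 n s w : ~~ (0 < s <= c) -> S n (s, w) = 0.
  move=> sN; rewrite /S big1// => k _; rewrite indicE memNset ?mul0r//= in_itv/=.
  move=> /andP[h1 h2]; case/negP: sN; rewrite (le_lt_trans (t0 n k) h1) (le_trans h2)//.
  by rewrite -[leRHS](grid_last c n) grid_le.
pose L (z : R * T) : R := if 0 < z.1 <= c then f (N z.1 z.2) else 0.
have SL z : S n z @[n --> \oo] --> L z.
  case: z => s w; rewrite /L/=; case: ifPn => sc; last first.
    by under eq_fun do rewrite S0//; exact: cvg_cst.
  have /andP[s0 sc'] := sc; under eq_fun do rewrite SE//.
  have NS : N (t_ n (grid_index c n s).+1) w @[n --> \oo] --> N s w.
    apply: (@cvg_right_sequence R (N ^~ w)).
    - by apply: cvgB; [have [_] := incB w|have [_] := incA w]; apply; exact: ltW.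
    - by move=> n; have /andP[] := grid_index_itv c0 n s0.
    - exact: cvg_grid_up.
  exact: (cvg_comp _ _ NS (cf _)).
have mS n : measurable_fun setT (S n) by exact: measurable_sum.
have mL : measurable_fun setT L.
  by apply: (@measurable_fun_cvg _ _ _ setT S) => // z _; exact: SL.
have S02 n z : 0 <= S n z <= 2.
  case: z => s w; have [/andP[s0 sc]|sN] := boolP (0 < s <= c); first by rewrite SE.
  by rewrite S0// lexx ler0n.
have cvgM (M : {measure set (R * T) -> \bar R}) : (M setT < +oo)%E ->
    (\int[M]_z (S n z)%:E)%E @[n --> \oo] --> (\int[M]_z (L z)%:E)%E.
  move=> Mfin.
  apply: (@dominated_cvg _ _ _ M setT measurableT (fun n z => (S n z)%:E) _ (cst 2%:E)) => //.
  - by move=> n; exact/measurable_EFinP.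
  - by move=> z _; apply: cvg_EFin; [exact: nearW|exact: SL].
  - apply/integrableP; split => //; rewrite (eq_integral (cst 2%:E)); last first.
      by move=> z _; rewrite /= ger0_norm.
    by rewrite integral_cst// lte_mul_pinfty ?lee_fin.
  - by move=> n z _; rewrite /= lee_fin ger0_norm; have /andP[] := S02 n z.
have LL : (\int[MA]_z (L z)%:E = \int[MB]_z (L z)%:E)%E.
  have mLp : measurable_fun setT (L : g_sigma_algebraType rect -> R).
    pose PT := g_sigma_algebraType rect.
    pose D : set PT := `[0, +oo[%classic `*` setT.
    have mD : measurable D by exact: measurable_halfspace.
    have mND : measurable_fun D (fun p : PT => N p.1 p.2).
      have [pA _ _ _] := compA; have [pB _ _ _] := compB.
      by apply: measurable_funB; exact/predictableP.
    have FT : F 0 setT by apply: sub_sigma_setT; case: F_filtration => h _ _; exact: h.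
    have mD1 : measurable (`]0, c]%classic `*` setT : set PT).
      by apply: sub_sigma_algebra; right; exists 0, c, setT.
    rewrite (_ : L = (fun p : PT => f (N p.1 p.2)) \_ (`]0, c]%classic `*` setT)).
      have mND1 : measurable_fun (`]0, c]%classic `*` setT : set PT)
          (fun p : PT => N p.1 p.2).
        apply: (measurable_funS mD _ mND) => -[s w] [/= + _].
        rewrite in_itv/= => /andP[s0 _].
        by split => //=; rewrite in_itv/= (ltW s0).
      exact: ((measurable_restrictT _ mD1).1 (measurableT_comp mf mND1)).
    apply/funext => -[s w]; rewrite /L patchE/=.
    have [sc|sc] := boolP (0 < s <= c); first by rewrite mem_set//; split => //=; rewrite in_itv.
    by rewrite memNset// => -[/=]; rewrite in_itv/= => h _; rewrite h in sc.
  have L0 z : 0 <= L z.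
    by rewrite /L; case: ifP => // _; have /andP[] := f02 (N z.1 z.2).
  have mrect E : <<s rect >> E -> measurable E.
    exact: (smallest_sub (@sigma_algebra_measurable _ _) rect_measurable).
  (* [L] is now replaced by an arbitrary nonnegative function measurable for the predictable
     sigma-algebra, for [nnfun_ind]. *)
  move: L0 mLp; move: (L) => L1 L10 mL1.
  move: L1 mL1 L10; apply: (@nnfun_ind _ (g_sigma_algebraType rect) R (fun g =>
     (\int[MA]_z (g z)%:E = \int[MB]_z (g z)%:E)%E)).
  - move=> E mE; have mE' := mrect _ mE; rewrite !integral_indic// !setIT; exact: agree.
  - move=> g h mg mh g0 h0 eg eh.
    have mg' : measurable_fun setT (g : R * T -> R).
      by move=> _ E mE; apply: mrect; exact: mg.
    have mh' : measurable_fun setT (h : R * T -> R).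
      by move=> _ E mE; apply: mrect; exact: mh.
    have D (M : {measure set (R * T) -> \bar R}) :
        (\int[M]_z ((g \+ h)%R z)%:E = \int[M]_z (g z)%:E + \int[M]_z (h z)%:E)%E.
      under eq_integral do rewrite /= EFinD.
      rewrite ge0_integralD//; try by move=> z _; rewrite lee_fin.
        exact/measurable_EFinP.
      exact/measurable_EFinP.
    by rewrite !D eg eh.
  - move=> k g k0 mg g0 eg.
    have mg' : measurable_fun setT (g : R * T -> R).
      by move=> _ E mE; apply: mrect; exact: mg.
    have D (M : {measure set (R * T) -> \bar R}) :
        (\int[M]_z (k * g z)%:E = k%:E * \int[M]_z (g z)%:E)%E.
      under eq_integral do rewrite EFinM.
      rewrite ge0_integralZl_EFin//; first by move=> z _; rewrite lee_fin.
      exact/measurable_EFinP.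
    by rewrite !D eg.
  - move=> h g mh h0 ndh mg hg eh.
    have mh' n : measurable_fun setT (h n : R * T -> R).
      by move=> _ E mE; apply: mrect; exact: mh.
    have D (M : {measure set (R * T) -> \bar R}) :
        (\int[M]_z (h n z)%:E @[n --> \oo] --> \int[M]_z (g z)%:E)%E.
      rewrite (_ : (\int[M]_z (g z)%:E)%E =
          (\int[M]_z limn (fun n => (h n z)%:E))%E); last first.
        apply: eq_integral => z _; apply/esym/cvg_lim => //.
        by apply: cvg_EFin; [exact: nearW|exact: hg].
      apply: cvg_monotone_convergence => //.
      + by move=> n; exact/measurable_EFinP.
      + by move=> n z _; rewrite lee_fin.
      + by move=> z _ m n mn; rewrite lee_fin; exact: ndh.
    rewrite -(cvg_lim _ (D MA))// -(cvg_lim _ (D MB))//.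
    by congr (limn _); apply/funext => n; exact: eh.
have intM (M : {measure set (R * T) -> \bar R}) (C : R -> T -> R) :
    (forall a b (g : T -> R), 0 <= a -> a <= b -> b <= c ->
        measurable_fun setT g -> (forall w, 0 <= g w) ->
        (\int[M]_z (\1_(`]a, b]%classic : set R) z.1 * g z.2)%:E =
         \int[P]_w (g w * (C b w - C a w))%:E)%E) ->
    (forall t, 0 <= t -> intg (C t)) -> forall n,
    (forall k : nat, intg (fun w => f (N (t_ n k.+1) w) * (C (t_ n k.+1) w - C (t_ n k) w))) /\
    (\int[M]_z (S n z)%:E)%E = (\int[P]_w (\sum_(k < n.+1)
       f (N (t_ n k.+1) w) * (C (t_ n k.+1) w - C (t_ n k) w)))%:E.
  move=> step iC n.
  have ik k : intg (fun w => f (N (t_ n k.+1) w) * (C (t_ n k.+1) w - C (t_ n k) w)).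
    have iD : intg (fun w => 2 * (C (t_ n k.+1) w - C (t_ n k) w)).
      apply: rintegrableZ => //; apply: rintegrableB => //; exact: iC.
    apply: rintegrable_le iD => //.
      apply: measurable_funM => //.
      by apply: measurable_funB; apply: rintegrable_measurable (iC _ (t0 n _)).
    move=> w _; rewrite /= !normrM ler_wpM2r// [leRHS]ger0_norm//.
    by rewrite ger0_norm; have /andP[] := f02 (N (t_ n k.+1) w).
  split => //.
  under eq_integral do rewrite /S -sumEFin.
  rewrite ge0_integral_sum//; last 2 first.
  - by move=> k; exact/measurable_EFinP.
  - move=> k z _; rewrite lee_fin mulr_ge0//.
    by have /andP[] := f02 (N (t_ n k.+1) z.2).
  rewrite -integral_Rintegral//; last first.
    rewrite (_ : _ \o _ = (fun w => \sum_(k < n.+1)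
       (f (N (t_ n k.+1) w) * (C (t_ n k.+1) w - C (t_ n k) w))%:E)%E); last first.
      by apply/funext => w /=; rewrite sumEFin.
    by apply: integrable_sum => // k _; exact: ik.
  under [RHS]eq_integral do rewrite -sumEFin.
  rewrite integral_sum//; last by move=> k; exact: ik.
  have stepk (k : 'I_n.+1) : (\int[M]_z (\1_(`]t_ n k, t_ n k.+1]%classic : set R) z.1 *
        f (N (t_ n k.+1) z.2))%:E =
      \int[P]_w (f (N (t_ n k.+1) w) * (C (t_ n k.+1) w - C (t_ n k) w))%:E)%E.
    rewrite (step _ _ (fun w => f (N (t_ n k.+1) w)))//.
    - exact/ltW/grid_lt.
    - by rewrite -[leRHS](grid_last c n) grid_le.
    - by move=> w; have /andP[] := f02 (N (t_ n k.+1) w).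
  by under [LHS]eq_bigr do rewrite stepk.
have MAfin : (MA setT < +oo)%E by rewrite totA ltry.
have MBfin : (MB setT < +oo)%E by rewrite totB ltry.
have SA := intM MA A stepA iA; have SB := intM MB B stepB iB.
set a := (X in X = _) in LL.
have Lfin : (\int[MB]_z (L z)%:E)%E \is a fin_num.
  rewrite ge0_fin_numE; last first.
    apply: integral_ge0 => z _; rewrite lee_fin /L; case: ifP => // _.
    by have /andP[] := f02 (N z.1 z.2).
  apply: (@le_lt_trans _ _ (\int[MB]_z (cst 2%:E z))%E).
    apply: ge0_le_integral => //.
    - move=> z _; rewrite lee_fin /L; case: ifP => // _.
      by have /andP[] := f02 (N z.1 z.2).
    - exact/measurable_EFinP.
    - move=> z _; rewrite lee_fin /L; case: ifP => // _.
      by have /andP[] := f02 (N z.1 z.2).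
  by rewrite integral_cst// lte_mul_pinfty ?lee_fin.
(* The mean of the Riemann sum of [f (N)] against [dB - dA]. *)
pose u n := \int[P]_w (\sum_(k < n.+1)
   f (N (t_ n k.+1) w) * (B (t_ n k.+1) w - B (t_ n k) w)) -
  \int[P]_w (\sum_(k < n.+1)
   f (N (t_ n k.+1) w) * (A (t_ n k.+1) w - A (t_ n k) w)).
have u0 : u n @[n --> \oo] --> 0.
  rewrite -(subrr (fine (\int[MB]_z (L z)%:E)%E)); apply: cvgB.
    have := cvgM MB MBfin; under eq_fun do rewrite (SB _).2.
    by rewrite -{1}(fineK Lfin) => /fine_cvg.
  have := cvgM MA MAfin; under eq_fun do rewrite (SA _).2.
  by rewrite -/a LL -{1}(fineK Lfin) => /fine_cvg.
have EN : \int[P]_w N c w = 0.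
  rewrite RintegralB ?iA ?iB ?(ltW c0)//.
  have FT : F 0 setT by apply: sub_sigma_setT; case: F_filtration => h _ _; exact: h.
  have hA := compensator_increment compA (lexx 0) (ltW c0) FT.
  have hB := compensator_increment compB (lexx 0) (ltW c0) FT.
  rewrite -hA in hB.
  have e (C : R -> T -> R) : (forall w, C 0 w = 0) ->
    \int[P]_w (C c w - C 0 w) = \int[P]_w (C c w).
    by move=> C0; apply: eq_Rintegral => w _; rewrite C0 subr0.
  by rewrite (e A A0) (e B B0) in hB; rewrite hB subrr.
have iH : intg (fun w => pseudo_huber (N c w)).
  apply: rintegrable_le (iN c (ltW c0)) => //.
    apply: (measurableT_comp (@measurable_pseudo_huber R)).
    exact: mN (ltW c0).
  by move=> w _; rewrite ger0_norm ?pseudo_huber_ge0// pseudo_huber_le_norm.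
(* The tangent inequality is summed over the cells. Subtracting [N c], of mean 0 and equal to the
   sum of its own increments, turns [f] back into the derivative. *)
have Hu n : \int[P]_w pseudo_huber (N c w) <= u n.
  have iS (C : R -> T -> R) : (forall k : nat, intg (fun w =>
      f (N (t_ n k.+1) w) * (C (t_ n k.+1) w - C (t_ n k) w))) ->
    intg (fun w => \sum_(k < n.+1) f (N (t_ n k.+1) w) * (C (t_ n k.+1) w - C (t_ n k) w)).
    move=> ik; rewrite (_ : _ \o _ = (fun w => \sum_(k < n.+1)
       (f (N (t_ n k.+1) w) * (C (t_ n k.+1) w - C (t_ n k) w))%:E)%E); last first.
      by apply/funext => w /=; rewrite sumEFin.
    by apply: integrable_sum => // k _; exact: ik.
  have iSA := iS A (SA n).1; have iSB := iS B (SB n).1.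
  rewrite /u -RintegralB// -[leRHS]subr0 -[X in _ <= _ - X]EN -RintegralB//; last 2 first.
  - exact: rintegrableB.
  - exact: iN (ltW c0).
  apply: le_Rintegral => //.
    by apply: rintegrableB => //; [exact: rintegrableB|exact: iN (ltW c0)].
  move=> w _; rewrite -sumrB.
  have -> : N c w = \sum_(k < n.+1) (N (t_ n k.+1) w - N (t_ n k) w).
    by rewrite -(big_mkord xpredT (fun k => N (t_ n k.+1) w - N (t_ n k) w))
      telescope_sumr// /t_ grid_last grid0 N0 subr0.
  rewrite -sumrB.
  rewrite (_ : pseudo_huber _ = \sum_(k < n.+1)
      (pseudo_huber (N (t_ n k.+1) w) - pseudo_huber (N (t_ n k) w))); last first.
    rewrite -(big_mkord xpredT (fun k => N (t_ n k.+1) w - N (t_ n k) w)).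
    rewrite telescope_sumr//.
    rewrite -(big_mkord xpredT (fun k => pseudo_huber (N (t_ n k.+1) w) - pseudo_huber (N (t_ n k) w))).
    rewrite telescope_sumr// /t_ grid_last grid0 N0 subr0.
    by rewrite [X in _ - X](_ : _ = 0) ?subr0// /pseudo_huber expr0n/= addr0 sqrtr1 subrr.
  apply: ler_sum => k _; apply: le_trans (pseudo_huber_convex _ _) _.
  rewrite le_eqVlt; apply/orP; left; apply/eqP.
  by rewrite /f /N; ring.
have : \int[P]_w pseudo_huber (N c w) <= 0.
  by apply: (cvgr_to_ge u0); exact: nearW.
move=> H0.
have e0 : (\int[P]_w `|(EFin \o (fun w => pseudo_huber (N c w))) w| = 0)%E.
  rewrite (eq_integral (fun w => (pseudo_huber (N c w))%:E)); last first.
    by move=> w _; rewrite /= ger0_norm ?pseudo_huber_ge0.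
  rewrite integral_Rintegral//; congr EFin; apply/eqP; rewrite eq_le H0/=.
  by apply: Rintegral_ge0 => w _; exact: pseudo_huber_ge0.
have mEH : measurable_fun setT (EFin \o (fun w => pseudo_huber (N c w))).
  exact: measurable_int iH.
have [h _] := ae_eq_integral_abs P measurableT mEH.
apply: filterS (h e0) => w hw Tw.
have [/pseudo_huber_eq0] := hw Tw; move=> /eqP; rewrite subr_eq0 => /eqP.
by move=> ->.
Qed.

(** The times [k / n.+1] are countable, so one null set serves for all of them; right continuity
    carries the equality to every time. *)
Lemma compensator_unique : {ae P, forall w, forall t, 0 <= t -> B t w = A t w}.
Proof.
have [_ incA A0 _] := compA; have [_ incB B0 _] := compB.
have h : \forall w \ae P, forall n k : nat, B (grid 1 n k) w = A (grid 1 n k) w.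
  apply/ae_foralln => n; apply/ae_foralln => k.
  case: k => [|k]; first by apply: nearW => w; rewrite grid0 A0 B0.
  have g0 : 0 < grid 1 n k.+1 :> R by apply: le_lt_trans (grid_lt _ n k) => //; exact: grid_ge0.
  by apply: filterS (compensator_terminal g0) => w /(_ I).
apply: filterS h => w h t; rewrite le_eqVlt => /predU1P[<-|t0].
  by rewrite A0 B0.
have cv (C : R -> T -> R) : increasing_process C ->
    C (grid 1 n (grid_index 1 n t).+1) w @[n --> \oo] --> C t w.
  move=> /(_ w)[_ rC]; apply: (@cvg_right_sequence R (C ^~ w)).
  - exact: rC (ltW t0).
  - by move=> n; have /andP[] := grid_index_itv ltr01 n t0.
  - exact: cvg_grid_up.
rewrite -(cvg_lim _ (cv A incA))// -(cvg_lim _ (cv B incB))//.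
by congr (limn _); apply/funext => n; exact: h.
Qed.

End two_compensators.

End compensator_uniqueness.

(** * Moments of the bracket *)

(** With [e = 1 - delta] this is the form of [u |-> E[1_E X_u^2] / u] after a time [s > 0], when [E]
    belongs to [F s]. *)
Lemma power_ratio_continuous (R : realType) (K p e u : R) : 0 < u ->
  {for u, continuous (fun v : R => (K * v `^ e + p * v) / v)}.
Proof.
move=> u0; apply: cvgM; last by apply: cvgV; [rewrite gt_eqF|exact: cvg_id].
apply: cvgD; last by apply: cvgMr; exact: cvg_id.
apply: cvgMr.
have : derivable (fun v : R => v `^ e) u 1 by apply: ex_derive; exact: is_derive1_powR.
by move=> /derivable1_diffP/differentiable_continuous.
Qed.

Lemma power_ratio_integrable (R : realType) (K p e s t : R) : 0 < s ->
  lebesgue_measure.-integrable `[s, t] (EFin \o (fun v : R => (K * v `^ e + p * v) / v)).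
Proof.
move=> s0; apply: continuous_compact_integrable; first exact: segment_compact.
apply: continuous_in_subspaceT => u; rewrite inE/= in_itv/= => /andP[su _].
by apply: power_ratio_continuous; exact: lt_le_trans su.
Qed.

(** An antiderivative is [K u^e + e p u]. The factor [e] stays in the integrand because it may be 0,
    namely when [delta = 1]. *)
Lemma integral_power_ratio (R : realType) (K p e s t : R) : 0 < s -> s < t ->
  (\int[lebesgue_measure]_(u in `[s, t]) (e * ((K * u `^ e + p * u) / u))%:E =
   (K * t `^ e + e * p * t - (K * s `^ e + e * p * s))%:E)%E.
Proof.
move=> s0 st.
pose H (u : R) : R := K * u `^ e + e * p * u.
have dH (u : R) : 0 < u -> is_derive u 1 H (e * ((K * u `^ e + p * u) / u)).
  move=> u0.
  have d1 : is_derive u 1 (fun v : R => v `^ e) (e * u `^ (e - 1)) by exact: is_derive1_powR.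
  have d2 : is_derive u (1 : R) (fun v : R => v) 1 by exact: is_derive_id.
  have d3 := is_deriveD (is_deriveZ K d1) (is_deriveZ (e * p) d2).
  apply: (is_derive_eq d3).
  rewrite powRB; last by rewrite (gt_eqF u0) implybT.
  rewrite powRr1 ?(ltW u0)// /GRing.scale/= mulr1.
  by field; rewrite gt_eqF.
have cu (u : R) : 0 < u -> {for u, continuous (fun v => e * ((K * v `^ e + p * v) / v))}.
  by move=> u0; apply: cvgMr; exact: power_ratio_continuous.
have cH (u : R) : 0 < u -> {for u, continuous H}.
  move=> u0; have : derivable H u 1 by apply: ex_derive; exact: dH.
  by move=> /derivable1_diffP/differentiable_continuous.
rewrite (@continuous_FTC2 _ _ H)//.
- apply: continuous_in_subspaceT => u; rewrite inE/= in_itv/= => /andP[su _].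
  by apply: cu; exact: lt_le_trans su.
- split.
  + move=> u; rewrite in_itv/= => /andP[su _]; apply: ex_derive; apply: dH.
    exact: lt_trans su.
  + by apply: cvg_at_right_filter; exact: cH.
  + by apply: cvg_at_left_filter; apply: cH; exact: lt_trans st.
- move=> u; rewrite in_itv/= => /andP[su _]; rewrite derive1E.
  by have [_ ->] := dH u (lt_trans s0 su).
Qed.

(** Cauchy-Schwarz against the constant 1: integrate [2 m f <= m^2 + f^2] with [m] the average of
    [f]. *)
Lemma Rintegral_sqr_le (R : realType) (f : R -> R) (s t : R) : s < t ->
  lebesgue_measure.-integrable `[s, t] (EFin \o f) ->
  (((\int[lebesgue_measure]_(u in `[s, t]) f u) ^+ 2)%R%:E <=
   (t - s)%:E * \int[lebesgue_measure]_(u in `[s, t]) (f u ^+ 2)%:E)%E.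
Proof.
move=> st iF; set I := (X in (X ^+ 2)%:E); set J := (X in (_ * X)%E).
have h0 : 0 < t - s by rewrite subr_gt0.
have mf : measurable_fun `[s, t]%classic f by exact: rintegrable_measurable iF.
have mf2 : measurable_fun `[s, t]%classic (fun u => f u ^+ 2) by exact: measurable_funX.
have J0 : (0 <= J)%E by apply: integral_ge0 => u _; rewrite lee_fin sqr_ge0.
have [Jfin|] := ltP J +oo%E; last by rewrite leye_eq => /eqP ->; rewrite gt0_muley ?leey ?lte_fin.
have i2 : lebesgue_measure.-integrable `[s, t] (EFin \o (fun u => f u ^+ 2)).
  by apply: ge0_rintegrable => // u _; exact: sqr_ge0.
have lst : lebesgue_measure `[s, t]%classic = (t - s)%:E.
  by rewrite /= lebesgue_measure_itv/= lte_fin st EFinB.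
have ic (k : R) : lebesgue_measure.-integrable `[s, t] (EFin \o (cst k : R -> R)).
  apply: measurable_bounded_integrable => //; first by rewrite /= lst ltry.
  by exists `|k|; split; [exact: num_real|move=> M kM u _; exact: ltW].
have JE : J = (\int[lebesgue_measure]_(u in `[s, t]) (f u ^+ 2))%:E by exact: integral_Rintegral.
rewrite JE -EFinM lee_fin; set j := (X in _ <= _ * X).
pose m := I / (t - s).
have : \int[lebesgue_measure]_(u in `[s, t]) (2 * m * f u) <=
       \int[lebesgue_measure]_(u in `[s, t]) (m ^+ 2 + f u ^+ 2).
  apply: le_Rintegral => //; [exact: rintegrableZ|exact: (rintegrableD _ (ic (m ^+ 2)) i2)|].
  by move=> u _; have := sqr_ge0 (m - f u); nra.
have e1 : \int[lebesgue_measure]_(u in `[s, t]) cst (m ^+ 2) u = m ^+ 2 * (t - s).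
  by rewrite Rintegral_cst//; congr (_ * _); exact: (congr1 fine lst).
rewrite RintegralZl// (RintegralD _ (ic (m ^+ 2)) i2)// e1.
rewrite -/I -/j => h.
have mI : m * (t - s) = I by rewrite /m divfK// gt_eqF.
have h2 : m * I <= j by rewrite -mI in h *; nra.
rewrite expr2 -{1}mI -mulrA (mulrC (t - s)) mulrA mulrC ler_pM2l//.
Qed.

Section bracket_moments.
Context {R : realType} {d : measure_display} {T : measurableType d}.
Variables (G : R -> probability R R) (psi : R -> R) (P : probability T R).
Variables (F : R -> set_system T) (X : R -> T -> R).
Hypothesis G_itv01 : forall sigma, 1 <= sigma -> G sigma `[0, 1]%classic = 1%E.
Hypothesis G_laplace : has_laplace_exponent G psi.
Hypothesis psi_half : psi (1 / 2) = 1.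
Hypothesis F_filtration : filtration F.
Hypothesis X_0 : forall w, X 0 w = 0.
Hypothesis X_cadlag : cadlag X.
Hypothesis X_adapted : adapted F X.
Hypothesis X_markov : markov_process P F X (transition G).
Local Notation delta := (psi 1 / 2).
Local Notation mu := (@lebesgue_measure R).
Local Notation intg f := (P.-integrable setT (EFin \o f)).
Local Notation A t w := (bracket delta (X ^~ w) t).
Local Notation ratio w := (fun u => X u w ^+ 2 / u).

Let Fm := filtration_sub F_filtration.

Let FT t : 0 <= t -> F t setT.
Proof. by move=> t0; apply: sub_sigma_setT; case: F_filtration => h _ _; exact: h. Qed.

Let mX t : 0 <= t -> measurable_fun setT (X t).
Proof. exact: (adapted_measurable F_filtration X_adapted). Qed.

Let X_right w (s : R) : 0 <= s -> X u w @[u --> s^'+] --> X s w.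
Proof. by move=> s0; have [h _] := X_cadlag w; exact: h. Qed.

Let X_left w (s : R) : 0 < s -> cvg (X u w @[u --> s^'-]).
Proof. by move=> s0; have [_ h] := X_cadlag w; exact: h. Qed.

Let mXpath w (c : R) : 0 <= c -> measurable_fun `[0, c]%classic (X ^~ w).
Proof. by move=> c0; apply: measurable_path => // s /andP[s0 _]; exact: mX. Qed.

Let d01 : 0 <= delta <= 1 := delta_itv01 G_itv01 G_laplace psi_half.

Lemma process_integrable4 t : 0 <= t -> intg (fun w => X t w ^+ 4).
Proof.
move=> t0; apply: ge0_rintegrable => //.
- by apply: measurable_funX; exact: mX.
- by move=> w _; rewrite exprn_even_ge0.
- apply: le_lt_trans (ltry (64 * t ^+ 2)).
  exact: (fourth_moment F_filtration X_0 X_adapted X_markov).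
Qed.

Lemma process_integrable2 t : 0 <= t -> intg (fun w => X t w ^+ 2).
Proof.
move=> t0.
have i1 : intg (fun w => 1 + X t w ^+ 4).
  by apply: rintegrableD => //; [exact: finite_measure_integrable_cst|exact: process_integrable4].
apply: rintegrable_le i1 => //; first by apply: measurable_funX; exact: mX.
move=> w _; rewrite /= ger0_norm ?sqr_ge0// ger0_norm; last by rewrite addr_ge0// exprn_even_ge0.
by rewrite (exprM _ 2 2); have := sqr_ge0 (X t w ^+ 2 - 1); have := sqr_ge0 (X t w); nra.
Qed.

(** The exponent 1 serves for the martingale property and 2 for the second moment of increments. *)
Lemma weighted_square_tonelli n s t E : 0 <= s -> s <= t -> measurable E ->
  [/\ (\int[P]_(w in E) \int[mu]_(u in `[s, t]) ((X u w ^+ 2 / u) ^+ n)%:E =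
       \int[mu]_(u in `[s, t]) \int[P]_(w in E) ((X u w ^+ 2 / u) ^+ n)%:E)%E,
      measurable_fun (`[s, t]%classic : set R)
        (fun u => \int[P]_(w in E) ((X u w ^+ 2 / u) ^+ n)%:E)%E &
      measurable_fun E
        (fun w => \int[mu]_(u in `[s, t]) ((X u w ^+ 2 / u) ^+ n)%:E)%E].
Proof.
move=> s0 st mE; have t0 := le_trans s0 st.
pose D : set (R * T) := `[s, t]%classic `*` E.
have mD : measurable D by exact: measurableX.
pose g := (fun z : R * T => ((X z.1 z.2 ^+ 2 / z.1) ^+ n)%:E) \_ D.
have mg : measurable_fun setT g.
  apply/(measurable_restrictT _ _).1 => //; apply/measurable_EFinP.
  apply: measurable_funX; apply: measurable_funM.
    apply: measurable_funX.
    have mXt r : 0 <= r <= t -> measurable_fun setT (X r).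
      by move=> /andP[r0 _]; exact: mX.
    have := measurable_right_continuous t0 mXt X_right; apply: measurable_funS.
      exact: measurableX.
    move=> [u w] [/= + _]; rewrite in_itv/= => /andP[su ut].
    by split => //=; rewrite in_itv/= (le_trans s0).
  by apply: measurable_funV; apply: measurable_funTS; exact: measurable_fst.
have g0 z : (0 <= g z)%E.
  rewrite /g patchE; case: ifPn => // /set_mem[/=].
  rewrite in_itv/= => /andP[su _] _; rewrite lee_fin exprn_ge0//.
  by rewrite mulr_ge0 ?sqr_ge0// invr_ge0 (le_trans s0).
have inE w : w \in E -> (\int[mu]_u g (u, w) =
    \int[mu]_(u in `[s, t]) ((X u w ^+ 2 / u) ^+ n)%:E)%E.
  move=> wE; rewrite [RHS]integral_mkcond; apply: eq_integral => u _; rewrite /g !patchE.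
  rewrite (_ : ((u, w) \in D) = (u \in `[s, t]%classic))//.
  apply/idP/idP => /set_mem h; apply/mem_set; first by case: h.
  by split => //; exact: set_mem wE.
have inD u : u \in `[s, t]%classic -> (\int[P]_w g (u, w) =
    \int[P]_(w in E) ((X u w ^+ 2 / u) ^+ n)%:E)%E.
  move=> us; rewrite [RHS]integral_mkcond; apply: eq_integral => w _; rewrite /g !patchE.
  rewrite (_ : ((u, w) \in D) = (w \in E))//.
  apply/idP/idP => /set_mem h; apply/mem_set; first by case: h.
  by split => //; exact: set_mem us.
split.
- transitivity (\int[P]_w \int[mu]_u g (u, w))%E.
    rewrite [LHS]integral_mkcond; apply: eq_integral => w _; rewrite patchE.
    case: ifPn => wE; first by rewrite inE.
    rewrite integral0_eq// => u _; rewrite /g patchE ifF//.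
    by apply: contraNF wE => /set_mem[_ ?]; apply/mem_set.
  rewrite -(@fubini_tonelli _ _ _ _ R mu P g)//.
  rewrite [RHS]integral_mkcond; apply: eq_integral => u _; rewrite patchE.
  case: ifPn => us; first by rewrite inD.
  rewrite integral0_eq// => w _; rewrite /g patchE ifF//.
  by apply: contraNF us => /set_mem[? _]; apply/mem_set.
- apply: (eq_measurable_fun (fun u => \int[P]_w g (u, w))%E inD).
  by apply: measurable_funTS; exact: (@measurable_fun_fubini_tonelli_F _ _ _ _ R P g mg g0).
- apply: (eq_measurable_fun (fun w => \int[mu]_u g (u, w))%E inE).
  by apply: measurable_funTS; exact: (@measurable_fun_fubini_tonelli_G _ _ _ _ R mu g mg g0).
Qed.

(** The conditional second moment rearranged as a function of [u], so that it can be integrated in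
    time. *)
Lemma process_square_integral s u E : 0 < s -> s <= u -> F s E ->
  let m := \int[P]_(w in E) (X s w ^+ 2) in let p := fine (P E) in
  \int[P]_(w in E) (X u w ^+ 2) =
  (s `^ (delta - 1) * m - s `^ delta * p) * u `^ (1 - delta) + p * u.
Proof.
move=> s0 su FE m p; have mE := Fm (ltW s0) FE; have u0 : 0 < u := lt_le_trans s0 su.
have iE (f : T -> R) : intg f -> P.-integrable E (EFin \o f).
  by apply: integrableS.
have e1 : s `^ (delta - 1) * u `^ (1 - delta) = (u / s) `^ (1 - delta).
  rewrite powRM ?invr_ge0 ?ltW// mulrC; congr (_ * _).
  by rewrite -[s^-1]powR_inv1 ?ltW// -powRrM; congr (_ `^ _); ring.
have e2 : s `^ delta * u `^ (1 - delta) = u * (u / s) `^ (- delta).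
  rewrite powRM ?invr_ge0 ?ltW// powRD; last by rewrite (gt_eqF u0) implybT.
  rewrite powRr1 ?ltW// mulrC -mulrA; congr (_ * (_ * _)).
  by rewrite -[s^-1]powR_inv1 ?ltW// -powRrM; congr (_ `^ _); ring.
rewrite mulrBl (mulrAC (s `^ (delta - 1))) e1 (mulrAC (s `^ delta)) e2.
move: su; rewrite le_eqVlt => /predU1P[<-|su].
  by rewrite divff ?gt_eqF// !powR1; rewrite mul1r mulr1 (mulrC s) subrK.
have := integral_square_condexp G_itv01 G_laplace F_filtration X_0 X_adapted X_markov (ltW s0) su FE.
rewrite /cond_square gt_eqF// => /(congr1 fine).
rewrite -[X in X = _ -> _]/(\int[P]_(w in E) (X u w ^+ 2)) => ->.
rewrite -[LHS]/(\int[P]_(w in E) ((u / s) `^ (1 - delta) * X s w ^+ 2 +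
  (u - u * (u / s) `^ (- delta)))).
have i2 := process_integrable2 (ltW s0).
rewrite RintegralD//; last 2 first.
- by apply: rintegrableZ => //; exact: iE.
- by apply: iE; exact: finite_measure_integrable_cst.
rewrite RintegralZl//; last exact: iE.
by rewrite Rintegral_cst// -/m -/p; ring.
Qed.

Lemma process_square_integral0 u E : 0 <= u -> F 0 E ->
  \int[P]_(w in E) (X u w ^+ 2) = u * fine (P E).
Proof.
rewrite le_eqVlt => /predU1P[<-|u0] FE.
  have h : {in E, (fun w => X 0 w ^+ 2) =1 cst 0}.
    by move=> w _; rewrite X_0 expr0n.
  rewrite mul0r (eq_Rintegral _ h).
  by rewrite Rintegral_cst ?mul0r//; exact: Fm FE.
rewrite /Rintegral (integral_square_start F_filtration X_0 X_adapted X_markov)//.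
by rewrite -[LHS]/(\int[P]_(w in E) u) Rintegral_cst//; exact: Fm FE.
Qed.

(** By Tonelli, [J] is the time integral of [gE u / u]. It is an explicit power integral when
    [s > 0]; when [s = 0] one has [gE u = u p] and the ratio is the constant [p]. *)
Lemma integral_weighted_square_event s t E : 0 <= s -> s < t -> F s E ->
  exists J : R, (\int[P]_(w in E) \int[mu]_(u in `[s, t]) (X u w ^+ 2 / u)%:E = J%:E)%E /\
    delta * (t - s) * fine (P E) + (1 - delta) * J =
    \int[P]_(w in E) (X t w ^+ 2) - \int[P]_(w in E) (X s w ^+ 2).
Proof.
move=> s0 st FE; have mE := Fm s0 FE.
set p := fine (P E); have p0 : 0 <= p by rewrite fine_ge0.
have iE (f : T -> R) : intg f -> P.-integrable E (EFin \o f).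
  by apply: integrableS.
pose gE u := \int[P]_(w in E) (X u w ^+ 2).
have gE0 u : 0 <= gE u by apply: Rintegral_ge0 => w _; exact: sqr_ge0.
have inner u : s <= u <= t ->
    (\int[P]_(w in E) ((X u w ^+ 2 / u) ^+ 1)%:E = (gE u / u)%:E)%E.
  move=> /andP[su ut]; have u0 := le_trans s0 su.
  under eq_integral do rewrite expr1 mulrC EFinM.
  have i2 := iE _ (process_integrable2 u0).
  rewrite ge0_integralZl_EFin//.
  - by rewrite integral_Rintegral// -EFinM mulrC.
  - by move=> w _; rewrite lee_fin sqr_ge0.
  - exact: (measurable_int P i2).
  - by rewrite invr_ge0.
have -> : (\int[P]_(w in E) \int[mu]_(u in `[s, t]) (X u w ^+ 2 / u)%:E =
    \int[mu]_(u in `[s, t]) (gE u / u)%:E)%E.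
  have [+ _ _] := weighted_square_tonelli 1 s0 (ltW st) mE.
  rewrite [X in X = _ -> _](_ : _ = \int[P]_(w in E) \int[mu]_(u in `[s, t]) (X u w ^+ 2 / u)%:E)%E.
    move=> ->; apply: eq_integral => u; rewrite inE/= in_itv/=; exact: inner.
  by apply: eq_integral => w _; apply: eq_integral => u _; rewrite expr1.
move: s0; rewrite le_eqVlt => /predU1P[s0|s0].
  move: FE st; rewrite -s0 => FE t0.
  have gE' u : 0 <= u -> gE u = u * p by move=> u0; exact: process_square_integral0.
  exists (t * p); split; last first.
    by rewrite -/(gE t) -/(gE 0) !gE' ?(ltW t0)//; ring.
  (* At [u = 0] the quotient is 0 by convention and not [p]; removing the endpoint makes the
     integrand constant. *)
  rewrite -[LHS]integral_itv_obnd_cbnd; last first.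
    apply/measurable_EFinP; apply: (@eq_measurable_fun _ _ _ _ _ (cst p)) => //.
    move=> u; rewrite inE/= in_itv/= => /andP[u0 _].
    by rewrite gE' ?(ltW u0)//= mulrAC divff ?mul1r// gt_eqF.
  rewrite (eq_integral (cst p%:E)); last first.
    move=> u; rewrite inE/= in_itv/= => /andP[u0 _].
    by rewrite gE' ?(ltW u0)//= mulrAC divff ?mul1r// gt_eqF.
  by rewrite integral_cst//= lebesgue_measure_itv/= lte_fin t0 oppr0 adde0 -EFinM mulrC.
pose K := s `^ (delta - 1) * gE s - s `^ delta * p.
have gE' u : s <= u -> gE u = K * u `^ (1 - delta) + p * u.
  by move=> su; exact: process_square_integral.
have /andP[_ d1] := d01.
have := integral_power_ratio K p (1 - delta) s0 st.
set Jt := (X in _ = X%:E -> _) => e.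
have iR := @power_ratio_integrable R K p (1 - delta) s t s0.
exists (\int[mu]_(u in `[s, t]) ((K * u `^ (1 - delta) + p * u) / u)); split.
  rewrite -integral_Rintegral//; apply: eq_integral => u.
  by rewrite inE/= in_itv/= => /andP[su _]; rewrite gE'.
have : (1 - delta) * \int[mu]_(u in `[s, t]) ((K * u `^ (1 - delta) + p * u) / u) = Jt.
  by rewrite -RintegralZl//; exact: (congr1 fine e).
by move=> ->; rewrite -/(gE t) -/(gE s) !gE' ?(ltW st)// /Jt; ring.
Qed.

(** The mean of the integral over [[0, 1]] is finite, hence so is almost every value; other
    intervals follow by the dichotomy. *)
Lemma bracket_finite : {ae P, forall w, mu.-integrable `[0, 1] (EFin \o ratio w)}.
Proof.
have [J [HJ _]] := integral_weighted_square_event (lexx 0) ltr01 (FT (lexx 0)).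
have mXt r : 0 <= r <= 1 -> measurable_fun setT (X r) by move=> /andP[r0 _]; exact: mX.
have mI := measurable_integral_weighted_square ler01 mXt X_right.
have iI : P.-integrable setT (fun w => \int[mu]_(u in `[0%R, 1%R]) (X u w ^+ 2 / u)%:E)%E.
  apply/integrableP; split => //.
  rewrite (eq_integral (fun w => \int[mu]_(u in `[0%R, 1%R]) (X u w ^+ 2 / u)%:E)%E).
    by rewrite HJ ltry.
  move=> w _; rewrite gee0_abs//; apply: integral_ge0 => u /=.
  by rewrite in_itv/= => /andP[u0 _]; rewrite lee_fin mulr_ge0 ?sqr_ge0// invr_ge0.
have := integrable_ae measurableT iI; apply: filterS => w /(_ I) fin.
apply: ge0_rintegrable => //.
- apply: measurable_funM; last exact: measurable_funV.
  by apply: measurable_funX; exact: mXpath.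
- by move=> u /=; rewrite in_itv/= => /andP[u0 _]; rewrite mulr_ge0 ?sqr_ge0// invr_ge0.
- by rewrite ltey_eq fin.
Qed.

Lemma ratio_integrable w : mu.-integrable `[0, 1] (EFin \o ratio w) ->
  forall c, mu.-integrable `[0, c] (EFin \o ratio w).
Proof.
move=> h; apply: (@bracket_integrable_all _ (X ^~ w) _ _ _ 1) => //.
- by move=> s s0; exact: X_right.
- by move=> s s0; exact: X_left.
- by move=> c c0; exact: mXpath.
Qed.

Lemma bracket_incrementE w s t : mu.-integrable `[0, 1] (EFin \o ratio w) ->
  0 <= s -> s <= t ->
  A t w - A s w = delta * (t - s) + (1 - delta) * \int[mu]_(u in `[s, t]) (X u w ^+ 2 / u).
Proof.
move=> h s0 st; have i := ratio_integrable h.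
have : \int[mu]_(u in `[0, t]) (X u w ^+ 2 / u) - \int[mu]_(u in `[0, s]) (X u w ^+ 2 / u) =
    \int[mu]_(u in `[s, t]) (X u w ^+ 2 / u).
  rewrite (@Rintegral_itvB _ (ratio w) (BLeft 0) (BRight t) s)//.
  apply: Rintegral_itv_obnd_cbnd; apply: integrableS (i t) => //.
  by apply: subset_itvr; rewrite bnd_simp.
by rewrite /bracket => <-; ring.
Qed.

Lemma measurable_process_bracket t : 0 <= t -> measurable_fun setT (fun w => A t w).
Proof.
move=> t0; apply: measurable_bracket => // r /andP[r0 _]; exact: mX.
Qed.

Let ratio_itv_ge0 s t w u : 0 <= s -> `[s, t]%classic u -> 0 <= X u w ^+ 2 / u.
Proof.
move=> s0; rewrite /= in_itv/= => /andP[su _].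
by rewrite mulr_ge0 ?sqr_ge0// invr_ge0 (le_trans s0).
Qed.

Lemma bracket_increment_ge0 w s t : 0 <= s -> s <= t -> 0 <= A t w - A s w.
Proof.
move=> s0 st; rewrite subr_ge0; apply: bracket_nd => //.
- by move=> r r0; exact: X_right.
- by move=> r r0; exact: X_left.
- by move=> c c0; exact: mXpath.
Qed.

(* Jensen for the convex combination, then Cauchy-Schwarz in time. *)
Lemma bracket_increment_sqr s t : 0 <= s -> s < t ->
  (\int[P]_w ((A t w - A s w) ^+ 2)%:E <= (64 * (t - s) ^+ 2)%:E)%E.
Proof.
move=> s0 st; have h0 : 0 < t - s by rewrite subr_gt0.
have /andP[d0 d1] := d01; have t0 : 0 <= t := ltW (le_lt_trans s0 st).
have [mI mJ mK] := @weighted_square_tonelli 2 s t setT s0 (ltW st) measurableT.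
have inner u : s <= u <= t -> (\int[P]_w ((X u w ^+ 2 / u) ^+ 2)%:E <= 64%:E)%E.
  move=> /andP[su ut]; have u0 := le_trans s0 su.
  under eq_integral do rewrite exprMn mulrC -exprM EFinM.
  have i4 := process_integrable4 u0.
  rewrite ge0_integralZl_EFin//; last 3 first.
  - by move=> w _; rewrite lee_fin exprn_even_ge0.
  - exact: (measurable_int P i4).
  - exact: sqr_ge0.
  have := fourth_moment F_filtration X_0 X_adapted X_markov u0.
  move: u0; rewrite le_eqVlt => /predU1P[<-|u0] h4.
    by rewrite invr0 expr0n/= mul0e lee_fin.
  apply: (@le_trans _ _ ((u^-1 ^+ 2)%:E * (64 * u ^+ 2)%:E)%E).
    by apply: lee_wpmul2l => //; rewrite lee_fin sqr_ge0.
  by rewrite -EFinM lee_fin mulrCA -exprMn mulVf ?gt_eqF// expr1n mulr1.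
have lst : mu `[s, t]%classic = (t - s)%:E.
  by rewrite /= lebesgue_measure_itv/= lte_fin st EFinB.
have I64 : (\int[P]_w \int[mu]_(u in `[s, t]) ((X u w ^+ 2 / u) ^+ 2)%:E <= (64 * (t - s))%:E)%E.
  rewrite mI EFinM -lst -integral_cst//; apply: ge0_le_integral => //.
  by move=> u us; apply: integral_ge0 => w _; rewrite lee_fin sqr_ge0.
pose J w := (\int[mu]_(u in `[s, t]) ((X u w ^+ 2 / u) ^+ 2)%:E)%E.
have J0 w : (0 <= J w)%E by apply: integral_ge0 => u _; rewrite lee_fin sqr_ge0.
(* The mean of this bound is at most [(delta + 64 (1 - delta)) (t - s)^2], the 64 bounding
   [E[(X_u^2 / u)^2]] for each [u]. *)
pose bound w := ((delta * (t - s) ^+ 2)%:E + ((1 - delta) * (t - s))%:E * J w)%E.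
have k0 : 0 <= (1 - delta) * (t - s) by rewrite mulr_ge0 ?subr_ge0// ltW.
have kd : 0 <= delta * (t - s) ^+ 2 by rewrite mulr_ge0// sqr_ge0.
have mbound : measurable_fun setT bound.
  by apply: emeasurable_funD => //; exact: measurable_funeM.
apply: (@le_trans _ _ (\int[P]_w bound w)%E); last first.
  rewrite ge0_integralD//; last 2 first.
  - by move=> w _; rewrite mule_ge0.
  - exact: measurable_funeM.
  rewrite integral_cst//= [X in (_ * X + _)%E](@probability_setT _ _ _ P) mule1.
  rewrite ge0_integralZl_EFin//.
  apply: (@le_trans _ _ ((delta * (t - s) ^+ 2)%:E +
      ((1 - delta) * (t - s))%:E * (64 * (t - s))%:E)%E).
    by apply: leeD2l; apply: lee_wpmul2l.
  rewrite -EFinM -EFinD lee_fin; have := sqr_ge0 (t - s); nra.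
apply: ae_ge0_le_integral => //.
- by move=> w _; rewrite lee_fin sqr_ge0.
- apply/measurable_EFinP; apply: measurable_funX; apply: measurable_funB.
    exact: measurable_process_bracket.
  exact: measurable_process_bracket.
- by move=> w _; rewrite adde_ge0// mule_ge0.
apply: filterS bracket_finite => w iw _.
rewrite bracket_incrementE// ?(ltW st)//.
have ist : mu.-integrable `[s, t] (EFin \o ratio w).
  apply: integrableS (ratio_integrable iw t) => // u; rewrite /= !in_itv/= => /andP[su ->].
  by rewrite (le_trans s0).
have := Rintegral_sqr_le st ist; set I := (X in ((X ^+ 2)%:E <= _)%E) => cs.
apply: (@le_trans _ _ ((delta * (t - s) ^+ 2)%:E + (1 - delta)%:E * (I ^+ 2)%:E)%E).
  rewrite -EFinM -EFinD lee_fin.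
  (* The exact gap in the convexity inequality for the square at the points [t - s] and [I]. *)
  have : 0 <= delta * (1 - delta) * ((t - s) - I) ^+ 2.
    apply: mulr_ge0; last exact: sqr_ge0.
    by apply: mulr_ge0 => //; rewrite subr_ge0.
  rewrite -[\int[mu]_(u in `[s, t]) (X u w ^+ 2 / u)]/I -subr_ge0.
  by congr (_ <= _); ring.
rewrite /bound (EFinM (1 - delta)) -muleA; apply: leeD2l; apply: lee_wpmul2l => //.
by rewrite lee_fin subr_ge0.
Qed.

Lemma bracket_increment_event s t E : 0 <= s -> s <= t -> F s E ->
  (\int[P]_(w in E) (A t w - A s w)%:E =
   (\int[P]_(w in E) (X t w ^+ 2) - \int[P]_(w in E) (X s w ^+ 2))%:E)%E.
Proof.
move=> s0; rewrite le_eqVlt => /predU1P[<-|st] FE.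
  rewrite subrr (eq_integral (cst 0%E)) ?integral0// => w _.
  by rewrite subrr.
have mE := Fm s0 FE; have /andP[d0 d1] := d01.
have t0 : 0 <= t := ltW (le_lt_trans s0 st).
have [J [HJ <-]] := integral_weighted_square_event s0 st FE.
pose L w := (\int[mu]_(u in `[s, t]) (X u w ^+ 2 / u)%:E)%E.
have L0 w : (0 <= L w)%E.
  by apply: integral_ge0 => u us; rewrite lee_fin (ratio_itv_ge0 w s0 us).
have mL : measurable_fun E L.
  have [_ _] := weighted_square_tonelli 1 s0 (ltW st) mE.
  apply: eq_measurable_fun => w _; apply: eq_integral => u _.
  by rewrite expr1.
have st0 : 0 <= t - s by rewrite subr_ge0 ltW.
transitivity (\int[P]_(w in E) ((delta * (t - s))%:E + (1 - delta)%:E * L w))%E.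
  apply: ge0_ae_eq_integral => //.
  - apply: measurable_funTS; apply/measurable_EFinP; apply: measurable_funB.
      exact: measurable_process_bracket.
    exact: measurable_process_bracket.
  - by apply: emeasurable_funD => //; exact: measurable_funeM.
  - by move=> w _; rewrite lee_fin bracket_increment_ge0// ltW.
  - move=> w _; apply: adde_ge0; first by rewrite lee_fin mulr_ge0.
    by apply: mule_ge0 => //; rewrite lee_fin subr_ge0.
  apply: filterS bracket_finite => w iw _.
  rewrite bracket_incrementE// ?(ltW st)// EFinD EFinM [X in (_ + _ * X)%E]integral_Rintegral//.
  apply: integrableS (ratio_integrable iw t) => // u; rewrite /= !in_itv/= => /andP[su ->].
  by rewrite (le_trans s0).
rewrite ge0_integralD//; last 3 first.
- by move=> w _; rewrite lee_fin mulr_ge0.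
- by move=> w _; apply: mule_ge0 => //; rewrite lee_fin subr_ge0.
- exact: measurable_funeM.
rewrite integral_cst// ge0_integralZl_EFin ?subr_ge0// HJ -EFinM.
rewrite [X in (_ * X + _)%E](_ : _ = (fine (P E))%:E) -?EFinM -?EFinD//.
by rewrite fineK// fin_num_measure.
Qed.

Lemma bracket_integrable t : 0 <= t -> intg (fun w => A t w).
Proof.
move=> t0; apply: ge0_rintegrable => //; first exact: measurable_process_bracket.
  by move=> w _; have := bracket_increment_ge0 w (lexx 0) t0; rewrite bracket0 subr0.
rewrite (_ : (\int[P]_w (A t w)%:E)%E = (\int[P]_w (A t w - A 0 w)%:E)%E).
  by rewrite (bracket_increment_event (lexx 0) t0 (FT (lexx 0))) ltry.
by apply: eq_integral => w _; rewrite bracket0 subr0.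
Qed.

Lemma bracket_increment s t E : 0 <= s -> s <= t -> F s E ->
  \int[P]_(w in E) (A t w - A s w) = \int[P]_(w in E) (X t w ^+ 2 - X s w ^+ 2).
Proof.
move=> s0 st FE; have t0 := le_trans s0 st; have mE := Fm s0 FE.
have iE (f : T -> R) : intg f -> P.-integrable E (EFin \o f).
  by apply: integrableS.
rewrite [RHS]RintegralB//; last 2 first.
- by apply: iE; exact: process_integrable2.
- by apply: iE; exact: process_integrable2.
exact: (congr1 fine (bracket_increment_event s0 st FE)).
Qed.

Lemma bracket_compensates_square :
  compensates_square P F X (fun t w => A t w).
Proof.
have aA : adapted F (fun t w => A t w) by exact: bracket_adapted.
split.
- apply: left_continuous_predictable => // w t t0; apply: bracket_left => //.
  + by move=> r r0; exact: X_right.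
  + by move=> r r0; exact: X_left.
  + by move=> c c0; exact: mXpath.
- move=> w; split => [s t s0 st|t t0].
    by rewrite -subr_ge0; exact: bracket_increment_ge0.
  apply: bracket_right => //.
  + by move=> r r0; exact: X_right.
  + by move=> r r0; exact: X_left.
  + by move=> c c0; exact: mXpath.
- by move=> w; exact: bracket0.
have aM : adapted F (fun t w => X t w ^+ 2 - A t w).
  move=> t t0; have sF : sigma_algebra setT (F t) by case: F_filtration => h _ _; exact: h.
  apply/(measurable_wrtP sF); apply: measurable_funB.
    by apply: measurable_funX; apply/(measurable_wrtP sF); exact: X_adapted.
  by apply/(measurable_wrtP sF); exact: aA.
split; first exact: aM.
move=> s t s0 st; have t0 := le_trans s0 st.
have iM r : 0 <= r -> intg (fun w => X r w ^+ 2 - A r w).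
  by move=> r0; apply: rintegrableB => //; [exact: process_integrable2|exact: bracket_integrable].
split; [exact: iM|exact: iM|exact: aM|].
move=> E FE; have mE := Fm s0 FE.
have iE (f : T -> R) : intg f -> P.-integrable E (EFin \o f).
  by apply: integrableS.
have iME r : 0 <= r -> P.-integrable E (EFin \o (fun w => X r w ^+ 2 - A r w)).
  by move=> r0; apply: iE; exact: iM.
rewrite (integral_Rintegral mE (iME _ t0)) (integral_Rintegral mE (iME _ s0)).
apply: (congr1 EFin); apply: subr0_eq.
apply: (etrans (esym (RintegralB mE (iME _ t0) (iME _ s0)))).
have -> : \int[P]_(w in E) (X t w ^+ 2 - A t w - (X s w ^+ 2 - A s w)) =
   \int[P]_(w in E) ((X t w ^+ 2 - X s w ^+ 2) - (A t w - A s w)).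
  by apply: eq_Rintegral => w _; ring.
rewrite RintegralB//; last 2 first.
- by apply: rintegrableB => //; apply: iE; exact: process_integrable2.
- by apply: rintegrableB => //; apply: iE; exact: bracket_integrable.
by rewrite bracket_increment// subrr.
Qed.

End bracket_moments.

(** * Approximation by conditional increments *)

Section square_integrable.
Context {R : realType} {d : measure_display} {T : measurableType d}.
Variable P : probability T R.
Local Notation intg f := (P.-integrable setT (EFin \o f)).

Lemma square_integrableM (f g : T -> R) :
  measurable_fun setT f -> measurable_fun setT g ->
  intg (fun w => f w ^+ 2) -> intg (fun w => g w ^+ 2) ->
  intg (fun w => f w * g w).
Proof.
move=> mf mg i j.
apply: (@rintegrable_le _ _ _ P setT measurableT _ (fun w => f w ^+ 2 + g w ^+ 2)).
- exact: measurable_funM.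
- move=> w _; rewrite [leRHS]ger0_norm ?addr_ge0 ?sqr_ge0//.
  rewrite normrM -[f w ^+ 2]real_normK ?num_real// -[g w ^+ 2]real_normK ?num_real//.
  by have := sqr_ge0 (`|f w| - `|g w|); have := sqr_ge0 `|f w|; have := sqr_ge0 `|g w|; nra.
- exact: rintegrableD.
Qed.

Lemma square_integrable_integrable (f : T -> R) : measurable_fun setT f ->
  intg (fun w => f w ^+ 2) -> intg f.
Proof.
move=> mf i.
have i1 : intg (fun w => (cst 1 : T -> R) w ^+ 2).
  exact: (finite_measure_integrable_cst P (1 ^+ 2 : R)).
have m1 : measurable_fun setT (cst 1 : T -> R) by exact: measurable_cst.
have := square_integrableM mf m1 i i1.
by apply: eq_integrable => // w _; rewrite /= mulr1.
Qed.

Lemma square_integrableD (f g : T -> R) :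
  measurable_fun setT f -> measurable_fun setT g ->
  intg (fun w => f w ^+ 2) -> intg (fun w => g w ^+ 2) ->
  intg (fun w => (f w + g w) ^+ 2).
Proof.
move=> mf mg i j.
have := rintegrableD measurableT (rintegrableD measurableT i j)
  (rintegrableZ measurableT 2 (square_integrableM mf mg i j)).
by apply: eq_integrable => // w _; congr EFin; ring.
Qed.

Lemma square_integrableN (f : T -> R) :
  intg (fun w => f w ^+ 2) -> intg (fun w => (- f w) ^+ 2).
Proof. by apply: eq_integrable => // w _; rewrite /= sqrrN. Qed.

(** Pythagoras for martingale differences. In the inductive step the partial sum is measurable for
    [H n], over which [D n] integrates to 0, so the cross term vanishes by [integral_pull_out0]. *)
Lemma orthogonal_increments (H : nat -> set_system T) (D : nat -> T -> R) n :
  (forall k, (k <= n)%N -> sigma_algebra setT (H k)) ->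
  (forall k, (k <= n)%N -> H k `<=` measurable) ->
  (forall k, (k < n)%N -> H k `<=` H k.+1) ->
  (forall k, (k < n)%N -> measurable_wrt (H k.+1) (D k)) ->
  (forall k, (k < n)%N -> intg (fun w => D k w ^+ 2)) ->
  (forall k, (k < n)%N -> forall E, H k E -> \int[P]_(w in E) D k w = 0) ->
  [/\ measurable_wrt (H n) (fun w => \sum_(k < n) D k w),
      intg (fun w => (\sum_(k < n) D k w) ^+ 2) &
      \int[P]_w ((\sum_(k < n) D k w) ^+ 2) = \sum_(k < n) \int[P]_w (D k w ^+ 2)].
Proof.
elim: n => [|n IHn] sH Hm HS mD iD D0.
  have e : (fun w : T => \sum_(k < 0) D k w) = cst 0.
    by apply/funext => w; rewrite big_ord0.
  have e2 : (fun w : T => (\sum_(k < 0) D k w) ^+ 2) = cst 0.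
    by apply/funext => w; rewrite big_ord0 expr0n.
  split.
  - by rewrite e; apply/(measurable_wrtP (sH 0%N (leqnn _))); exact: measurable_cst.
  - by rewrite e2; exact: finite_measure_integrable_cst.
  - by rewrite e2 Rintegral_cst// mul0r big_ord0.
have [mM iM eM] : [/\ measurable_wrt (H n) (fun w => \sum_(k < n) D k w),
      intg (fun w => (\sum_(k < n) D k w) ^+ 2) &
      \int[P]_w ((\sum_(k < n) D k w) ^+ 2) = \sum_(k < n) \int[P]_w (D k w ^+ 2)].
  apply: IHn => k kn; [exact/sH/leqW|exact/Hm/leqW|exact/HS/leqW|exact/mD/leqW|exact/iD/leqW|].
  exact/D0/leqW.
have sHn := sH n (leqnSn n); have sHn1 := sH n.+1 (leqnn _).
have mDn := mD n (ltnSn n); have iDn := iD n (ltnSn n).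
have mMT := measurable_fun_wrt (Hm n (leqnSn n)) mM.
have mDT := measurable_fun_wrt (Hm n.+1 (leqnn _)) mDn.
have iMD := square_integrableM mMT mDT iM iDn.
have sqE w : (\sum_(k < n.+1) D k w) ^+ 2 =
    (\sum_(k < n) D k w) ^+ 2 + D n w ^+ 2 + 2 * ((\sum_(k < n) D k w) * D n w).
  by rewrite big_ord_recr/=; ring.
have i12 := rintegrableD measurableT iM iDn.
have i3 := rintegrableZ measurableT 2 iMD.
split.
- apply/(measurable_wrtP sHn1); under eq_fun do rewrite big_ord_recr/=.
  apply: measurable_funD; last exact/(measurable_wrtP sHn1).
  apply/(measurable_wrtP sHn1) => B mB; apply: HS => //; exact: mM.
- have := rintegrableD measurableT i12 i3.
  by apply: eq_integrable => // w _; rewrite /= sqE.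
- under eq_Rintegral do rewrite sqE.
  rewrite (RintegralD measurableT i12 i3) (RintegralD measurableT iM iDn).
  rewrite (RintegralZl _ measurableT iMD) big_ord_recr/= -eM.
  rewrite (integral_pull_out0 sHn (Hm n (leqnSn n)) (square_integrable_integrable mDT iDn)
    (D0 n (ltnSn n)) mM iMD).
  by rewrite mulr0 addr0.
Qed.

Lemma second_moment_inequality (f : T -> R) (eps : R) : 0 < eps ->
  measurable_fun setT f ->
  ((eps ^+ 2)%:E * P [set w | (eps <= `|f w|)%R] <= \int[P]_w (f w ^+ 2)%:E)%E.
Proof.
move=> e0 mf; set E := [set w | _].
have mE : measurable E.
  have := @measurable_fun_le _ _ R setT _ _ measurableT (measurable_cst eps)
    (measurableT_comp (@normr_measurable R setT) mf).
  by rewrite setTI.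
have mf2 : measurable_fun setT (fun w => (f w ^+ 2)%:E).
  by apply/measurable_EFinP; exact: measurable_funX.
rewrite -integral_cst//; apply: (@le_trans _ _ (\int[P]_(w in E) (f w ^+ 2)%:E)%E).
  apply: ge0_le_integral => //.
  - by move=> w _; rewrite lee_fin sqr_ge0.
  - exact: measurable_funTS.
  - move=> w Ew; rewrite lee_fin -[leRHS]real_normK ?num_real//.
    by rewrite ler_pXn2r ?nnegrE ?normr_ge0// ltW.
by apply: ge0_subset_integral => // w _; rewrite lee_fin sqr_ge0.
Qed.

End square_integrable.

Lemma condexpP (R : realType) (d : measure_display) (T : measurableType d)
    (P : probability T R) (H : set_system T) (Z Y : T -> R) :
  is_condexp P H Z Y -> is_condexp P H Z (condexp P Z H).
Proof. by move=> h; apply: (@xgetPex _ (fun=> 0) [set U | is_condexp P H Z U]); exists Y. Qed.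

(** * Conditional increments and their defects *)

Section conditional_increments.
Context {R : realType} {d : measure_display} {T : measurableType d}.
Variables (G : R -> probability R R) (psi : R -> R) (P : probability T R).
Variables (F : R -> set_system T) (X : R -> T -> R).
Hypothesis G_itv01 : forall sigma, 1 <= sigma -> G sigma `[0, 1]%classic = 1%E.
Hypothesis G_laplace : has_laplace_exponent G psi.
Hypothesis psi_half : psi (1 / 2) = 1.
Hypothesis F_filtration : filtration F.
Hypothesis X_0 : forall w, X 0 w = 0.
Hypothesis X_cadlag : cadlag X.
Hypothesis X_martingale : martingale P F X.
Hypothesis X_markov : markov_process P F X (transition G).
Local Notation delta := (psi 1 / 2).
Local Notation intg f := (P.-integrable setT (EFin \o f)).
Local Notation A t w := (bracket delta (X ^~ w) t).
Local Notation cond_increment s t w :=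
  (cond_square delta s t (X s w ^+ 2) - X s w ^+ 2).

Let X_adapted : adapted F X := X_martingale.1.

Let Fm := filtration_sub F_filtration.

Let sF t : 0 <= t -> sigma_algebra setT (F t).
Proof. by case: F_filtration => h _ _; exact: h. Qed.

Let mX t : 0 <= t -> measurable_fun setT (X t).
Proof. exact: (adapted_measurable F_filtration X_adapted). Qed.

Let i2 t : 0 <= t -> intg (fun w => X t w ^+ 2).
Proof. exact: (process_integrable2 F_filtration X_0 X_adapted X_markov). Qed.

Let sigma_RV_algebra t : sigma_algebra setT (sigma_RV (X t)).
Proof. by apply: sigma_algebra_preimage; exact: sigma_algebra_measurable. Qed.

(** [H] is general because the claim serves for [F s], for the sigma-algebra of [X s] and for later
    sigma-algebras. *)
Lemma measurable_cond_increment (H : set_system T) s t :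
  sigma_algebra setT H -> measurable_wrt H (X s) ->
  measurable_wrt H (fun w => cond_increment s t w).
Proof.
move=> sH mH; apply/(measurable_wrtP sH).
have m2 : measurable_fun setT (fun w : g_sigma_algebraType H => X s w ^+ 2).
  by apply: measurable_funX; exact/(measurable_wrtP sH).
rewrite /cond_square; case: (s == 0); apply: measurable_funB => //.
by apply: measurable_funD => //; exact: measurable_funM.
Qed.

Lemma square_integrable_cond_increment s t : 0 <= s ->
  intg (fun w => cond_increment s t w ^+ 2).
Proof.
move=> s0.
have [a [b e]] : exists a b, forall w, cond_increment s t w = a * X s w ^+ 2 + b.
  rewrite /cond_square; case: (s == 0); first by exists (-1), t => w; ring.
  by exists ((t / s) `^ (1 - delta) - 1), (t - t * (t / s) `^ (- delta)) => w; ring.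
have i4 := process_integrable4 F_filtration X_0 X_adapted X_markov s0.
have m2 : measurable_fun setT (fun w => X s w ^+ 2).
  by apply: measurable_funX; exact: mX.
have ia : intg (fun w => (a * X s w ^+ 2) ^+ 2).
  have := rintegrableZ measurableT (a ^+ 2) i4.
  by apply: eq_integrable => // w _; congr EFin; ring.
have ib : intg (fun w => (cst b : T -> R) w ^+ 2).
  exact: (finite_measure_integrable_cst P (b ^+ 2 : R)).
have ma : measurable_fun setT (fun w => a * X s w ^+ 2) by exact: measurable_funM.
have mb : measurable_fun setT (cst b : T -> R) by exact: measurable_cst.
have := square_integrableD ma mb ia ib.
by apply: eq_integrable => // w _; rewrite /= e.
Qed.

Lemma measurable_fun_cond_increment s t : 0 <= s ->
  measurable_fun setT (fun w => cond_increment s t w).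
Proof.
move=> s0; apply: (measurable_fun_wrt (Fm s0)).
by apply: measurable_cond_increment; [exact: sF|exact: X_adapted].
Qed.

Lemma integral_cond_increment s t E : 0 <= s -> s < t -> F s E ->
  \int[P]_(w in E) cond_increment s t w =
  \int[P]_(w in E) (X t w ^+ 2 - X s w ^+ 2).
Proof.
move=> s0 st FE; have mE := Fm s0 FE; have t0 : 0 <= t := ltW (le_lt_trans s0 st).
have iE (f : T -> R) : intg f -> P.-integrable E (EFin \o f).
  by apply: integrableS.
have ic : intg (fun w => cond_square delta s t (X s w ^+ 2)).
  have mc := measurable_fun_cond_increment t s0.
  have := rintegrableD measurableT (square_integrable_integrable mc
    (square_integrable_cond_increment t s0)) (i2 s0).
  by apply: eq_integrable => // w _; rewrite /= subrK.
rewrite (RintegralB mE (iE _ ic) (iE _ (i2 s0))) (RintegralB mE (iE _ (i2 t0)) (iE _ (i2 s0))).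
congr (_ - _); symmetry; apply: (congr1 fine).
exact: (integral_square_condexp G_itv01 G_laplace F_filtration X_0 X_adapted X_markov s0 st FE).
Qed.

(** [(X_t - X_s)^2] differs from [X_t^2 - X_s^2] by [2 X_s (X_t - X_s)], whose integral over [E]
    vanishes by the martingale property tested on [1_E X_s]. *)
Lemma cond_increment_condexp s t : 0 <= s -> s < t ->
  is_condexp P (sigma_RV (X s)) (fun w => (X t w - X s w) ^+ 2)
    (fun w => cond_increment s t w).
Proof.
move=> s0 st; have t0 : 0 <= t := ltW (le_lt_trans s0 st).
have mXN : measurable_fun setT (fun w => - X s w) by exact: (measurable_funN (mX s0)).
have mD : measurable_fun setT (fun w => X t w - X s w).
  exact: (measurable_funB (mX t0) (mX s0)).
have iN := square_integrableN (i2 s0).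
have iZ := square_integrableD (mX t0) mXN (i2 t0) iN.
have ic := square_integrable_integrable (measurable_fun_cond_increment t s0)
  (square_integrable_cond_increment t s0).
split => //; first by apply: measurable_cond_increment => //; exact: sigma_RV_algebra.
move=> E HE; have FE : F s E by exact: X_adapted HE.
have mE := Fm s0 FE.
have iE (f : T -> R) : intg f -> P.-integrable E (EFin \o f).
  by apply: integrableS.
have iXD := square_integrableM (mX s0) mD (i2 s0) iZ.
have cross : \int[P]_(w in E) (X s w * (X t w - X s w)) = 0.
  have [_ /(_ s t s0 (ltW st)) cX] := X_martingale.
  have [iXt iXs _ _] := cX.
  rewrite Rintegral_mkcond.
  have e : (fun w => X s w * (X t w - X s w)) \_ E =
      (fun w => (\1_E w * X s w) * (X t w - X s w)) :> (T -> R).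
    by apply/funext => w; rewrite patchE indicE; case: ifPn => _; rewrite ?mul1r ?mul0r.
  have mH : measurable_wrt (F s) (fun w => \1_E w * X s w).
    apply/(measurable_wrtP (sF s0)); apply: measurable_funM.
      by apply: measurable_indic; exact: sub_sigma_algebra.
    by apply/(measurable_wrtP (sF s0)); exact: X_adapted.
  rewrite e; apply: (integral_pull_out0 (sF s0) (Fm s0) _ _ mH).
  - exact: (rintegrableB measurableT iXt iXs).
  - exact: (is_condexp_diff (Fm s0) cX).
  - apply: rintegrable_le iXD => //.
      by apply: measurable_funM => //; apply: measurable_funM; [exact: measurable_indic|exact: mX].
    move=> w _; rewrite -mulrA normrM indicE; case: (w \in E).
      by rewrite normr1 mul1r.
    by rewrite normr0 mul0r.
rewrite (integral_Rintegral mE (iE _ iZ)) (integral_Rintegral mE (iE _ ic)).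
rewrite integral_cond_increment//; apply: (congr1 EFin).
have i3 := rintegrableB measurableT (i2 t0) (i2 s0).
have i4 := rintegrableZ measurableT 2 iXD.
transitivity (\int[P]_(w in E) ((X t w ^+ 2 - X s w ^+ 2) - 2 * (X s w * (X t w - X s w)))).
  by apply: eq_Rintegral => w _; ring.
rewrite (RintegralB mE (iE _ i3) (iE _ i4)) (RintegralZl _ mE (iE _ iXD)).
by rewrite cross mulr0 subr0.
Qed.

Lemma condexp_increment s t : 0 <= s -> s < t ->
  ae_eq P setT (condexp P (fun w => (X t w - X s w) ^+ 2) (sigma_RV (X s)))
    (fun w => cond_increment s t w).
Proof.
move=> s0 st; have h := cond_increment_condexp s0 st.
have sub : sigma_RV (X s) `<=` measurable.
  by move=> E /(X_adapted s0); exact: Fm.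
apply: (is_condexp_unique (sigma_RV_algebra s) sub _ h).
exact: condexpP h.
Qed.

Lemma measurable_condexp_increment s t : 0 <= s -> s < t ->
  measurable_fun setT (condexp P (fun w => (X t w - X s w) ^+ 2) (sigma_RV (X s))).
Proof.
move=> s0 st; have h := cond_increment_condexp s0 st.
have sub : sigma_RV (X s) `<=` measurable.
  by move=> E /(X_adapted s0); exact: Fm.
have [_ _ + _] := condexpP h.
exact: measurable_fun_wrt.
Qed.

Lemma defect_event s t E : 0 <= s -> s < t -> F s E ->
  \int[P]_(w in E) (A t w - A s w - cond_increment s t w) = 0.
Proof.
move=> s0 st FE; have mE := Fm s0 FE; have t0 : 0 <= t := ltW (le_lt_trans s0 st).
have iE (f : T -> R) : intg f -> P.-integrable E (EFin \o f).
  by apply: integrableS.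
have iA r : 0 <= r -> intg (fun w => A r w).
  exact: (bracket_integrable G_itv01 G_laplace psi_half F_filtration X_0 X_cadlag X_adapted X_markov).
have iAA := rintegrableB measurableT (iA t t0) (iA s s0).
have ic := square_integrable_integrable (measurable_fun_cond_increment t s0)
  (square_integrable_cond_increment t s0).
rewrite (RintegralB mE (iE _ iAA) (iE _ ic)) integral_cond_increment//.
rewrite (bracket_increment G_itv01 G_laplace psi_half F_filtration X_0 X_cadlag X_adapted X_markov s0 (ltW st) FE).
by rewrite subrr.
Qed.

Lemma measurable_defect (H : set_system T) s t : sigma_algebra setT H ->
  0 <= s -> s <= t -> F t `<=` H ->
  measurable_wrt H (fun w => A t w - A s w - cond_increment s t w).
Proof.
move=> sH s0 st FH; have t0 := le_trans s0 st.
have FsH : F s `<=` H.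
  by move=> B FB; apply: FH; case: F_filtration => _ _ h; exact: (h s t).
have aA : adapted F (fun t w => A t w).
  apply: bracket_adapted => // w r r0.
  by have [h _] := X_cadlag w; exact: h.
have mA r : 0 <= r -> F r `<=` H -> measurable_wrt H (fun w => A r w).
  by move=> r0 FrH B /(aA r r0); exact: FrH.
apply/(measurable_wrtP sH); apply: measurable_funB.
  by apply: measurable_funB; apply/(measurable_wrtP sH); exact: mA.
apply/(measurable_wrtP sH); apply: measurable_cond_increment => //.
by move=> B /(X_adapted s0); exact: FsH.
Qed.

(** The conditional increment is measurable for [F s] and the defect integrates to 0 over [F s].
    They are orthogonal, and their squared norms add up to that of the increment of [A]. *)
Lemma defect_sqr s t : 0 <= s -> s < t ->
  intg (fun w => (A t w - A s w - cond_increment s t w) ^+ 2) /\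
  \int[P]_w ((A t w - A s w - cond_increment s t w) ^+ 2) <= 64 * (t - s) ^+ 2.
Proof.
move=> s0 st; have t0 : 0 <= t := ltW (le_lt_trans s0 st).
have h64 := bracket_increment_sqr G_itv01 G_laplace psi_half F_filtration X_0 X_cadlag X_adapted X_markov s0 st.
have mB r : 0 <= r -> measurable_fun setT (fun w => A r w).
  exact: (measurable_process_bracket _ F_filtration X_cadlag X_adapted).
have mAA : measurable_fun setT (fun w => A t w - A s w).
  exact: (measurable_funB (mB t t0) (mB s s0)).
have iAA : intg (fun w => (A t w - A s w) ^+ 2).
  apply: ge0_rintegrable => //; first exact: measurable_funX.
    by move=> w _; exact: sqr_ge0.
  exact: le_lt_trans h64 (ltry _).
have mc := measurable_fun_cond_increment t s0.
have ic2 := square_integrable_cond_increment t s0.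
have mN : measurable_fun setT (fun w => - cond_increment s t w) by exact: (measurable_funN mc).
have iD2 := square_integrableD mAA mN iAA (square_integrableN ic2).
have mD : measurable_fun setT (fun w => A t w - A s w - cond_increment s t w).
  exact: (measurable_funB mAA mc).
have icD := square_integrableM mc mD ic2 iD2.
have cD0 : \int[P]_w (cond_increment s t w * (A t w - A s w - cond_increment s t w)) = 0.
  apply: (integral_pull_out0 (sF s0) (Fm s0) _ _ _ icD).
  - exact: (square_integrable_integrable mD iD2).
  - by move=> E; exact: defect_event.
  - by apply: measurable_cond_increment; [exact: sF|exact: X_adapted].
split => //.
have i2c := rintegrableZ measurableT 2 icD.
have e : \int[P]_w ((A t w - A s w) ^+ 2) =
    \int[P]_w ((A t w - A s w - cond_increment s t w) ^+ 2) +
    (\int[P]_w (cond_increment s t w ^+ 2) + 2 * 0).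
  rewrite -{1}cD0 -(RintegralZl _ measurableT icD) -(RintegralD measurableT ic2 i2c).
  rewrite -(RintegralD measurableT iD2 (rintegrableD measurableT ic2 i2c)).
  by apply: eq_Rintegral => w _; ring.
have le64 : \int[P]_w ((A t w - A s w) ^+ 2) <= 64 * (t - s) ^+ 2.
  by rewrite -lee_fin -(integral_Rintegral measurableT iAA).
apply: le_trans le64; rewrite e mulr0 addr0 lerDl.
by apply: Rintegral_ge0 => w _; exact: sqr_ge0.
Qed.

Lemma bracket_approximation t : 0 < t ->
  cvg_in_prob_mesh P t
    (fun n p w => \sum_(k < n)
       condexp P (fun w' => (X (p k.+1) w' - X (p k) w') ^+ 2)
         (sigma_RV (X (p k))) w)
    (fun w => A t w).
Proof.
move=> t0 eps eta eps0 eta0.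
(* Chebyshev's inequality bounds the probability by [64 t mesh / eps^2]. *)
exists (eps ^+ 2 * eta / (64 * t)).
  by rewrite divr_gt0 ?mulr_gt0// exprn_gt0.
move=> n p [p0 pn pS] hm.
have pk0 k : (k <= n)%N -> 0 <= p k.
  elim: k => [|k IHk] kn; first by rewrite p0.
  by apply: le_trans (ltW (pS _ kn)); apply: IHk; exact: ltnW.
have le_mesh (k : 'I_n) : p k.+1 - p k <= mesh n p.
  by apply: (@le_bigmax _ _ _ 0 (fun k : 'I_n => p k.+1 - p k)).
pose D k w := A (p k.+1) w - A (p k) w -
  (cond_square delta (p k) (p k.+1) (X (p k) w ^+ 2) - X (p k) w ^+ 2).
have [] := @orthogonal_increments _ _ _ P (fun k => F (p k)) D n.
- by move=> k kn; exact/sF/pk0.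
- by move=> k kn; exact/Fm/pk0.
- move=> k kn; case: F_filtration => _ _; apply; first exact/pk0/ltnW.
  exact/ltW/pS.
- move=> k kn; apply: measurable_defect => //; first exact/sF/pk0.
    exact/pk0/ltnW.
  exact/ltW/pS.
- move=> k kn; have [] // := @defect_sqr (p k) (p k.+1).
    exact/pk0/ltnW.
  exact: pS.
- by move=> k kn E; apply: defect_event; [exact/pk0/ltnW|exact: pS].
move=> mSD iSD eSD.
pose S w := \sum_(k < n)
  condexp P (fun w' => (X (p k.+1) w' - X (p k) w') ^+ 2) (sigma_RV (X (p k))) w.
rewrite -[X in (P X < _)%E]/[set w | eps <= `|S w - A t w|].
have mS : measurable_fun setT S.
  apply: measurable_sum => k; apply: measurable_condexp_increment.
    exact/pk0/ltnW.
  exact: pS.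
have mSA : measurable_fun setT (fun w => S w - A t w).
  apply: measurable_funB => //.
  exact: (measurable_process_bracket _ F_filtration X_cadlag X_adapted (ltW t0)).
have telescope w : \sum_(k < n) (A (p k.+1) w - A (p k) w) = A t w.
  rewrite -(big_mkord xpredT (fun k => A (p k.+1) w - A (p k) w)) telescope_sumr//.
  by rewrite pn p0 bracket0 subr0.
(* Each chosen version of a conditional expectation agrees with the explicit formula off a null set.
   The sign is lost since [D] is the bracket minus the approximation. *)
have SE : \forall w \ae P, (S w - A t w) ^+ 2 = (\sum_(k < n) D k w) ^+ 2.
  have h : \forall w \ae P, forall k, (k < n)%N ->
      condexp P (fun w' => (X (p k.+1) w' - X (p k) w') ^+ 2) (sigma_RV (X (p k))) w =
      cond_square delta (p k) (p k.+1) (X (p k) w ^+ 2) - X (p k) w ^+ 2.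
    apply/ae_foralln => k; have [kn|kn] := ltnP k n; last by apply: nearW.
    have pk := pk0 _ (ltnW kn).
    by apply: filterS (condexp_increment pk (pS _ kn)) => w h _; exact: h.
  apply: filterS h => w h.
  rewrite /D sumrB telescope -sqrrN opprB; congr ((_ - _) ^+ 2).
  by apply: eq_bigr => k _; exact: h.
have e2 : (\int[P]_w ((S w - A t w) ^+ 2)%:E =
    (\sum_(k < n) \int[P]_w (D k w ^+ 2))%:E)%E.
  rewrite -eSD -(integral_Rintegral measurableT iSD); apply: ge0_ae_eq_integral => //.
  - by apply/measurable_EFinP; exact: measurable_funX.
  - exact: measurable_int iSD.
  - by move=> w _; rewrite lee_fin sqr_ge0.
  - by move=> w _; rewrite lee_fin sqr_ge0.
  - by apply: filterS SE => w -> _.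
rewrite -(@lte_pmul2l _ (eps ^+ 2)%:E)//; last by rewrite lte_fin exprn_gt0.
have cheb := @second_moment_inequality _ _ _ P _ _ eps0 mSA.
apply: (le_lt_trans cheb).
rewrite e2 -EFinM lte_fin.
(* One factor of each squared step is bounded by the mesh; the remaining steps telescope to [t]. *)
apply: (@le_lt_trans _ _ (\sum_(k < n) 64 * mesh n p * (p k.+1 - p k))).
  apply: ler_sum => k _; have pk := pk0 _ (ltnW (ltn_ord k)).
  have [_ h] := defect_sqr pk (pS _ (ltn_ord k)); apply: le_trans h _.
  have := le_mesh k; have := pS _ (ltn_ord k); nra.
rewrite -mulr_sumr.
rewrite -(big_mkord xpredT (fun k => p k.+1 - p k)) telescope_sumr// pn p0 subr0.
move: hm; rewrite ltr_pdivlMr ?mulr_gt0//.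
by rewrite mulrA (mulrC _ 64).
Qed.

End conditional_increments.

(** The first conjunct certifies that, almost surely, the real-valued integral in [A] is a genuine
    integral and not the default value 0. *)
Theorem theorem6 (R : realType) (G : R -> probability R R) (psi : R -> R)
    (d : measure_display) (T : measurableType d) (P : probability T R)
    (F : R -> set_system T) (X : R -> T -> R)
    (G_semigroup : log_convolution_semigroup G)
    (G_laplace : has_laplace_exponent G psi)
    (psi_half : psi (1 / 2) = 1)
    (F_filtration : filtration F)
    (X_0 : forall w, X 0 w = 0)
    (X_cadlag : cadlag X)
    (X_martingale : martingale P F X)
    (X_markov : markov_process P F X (transition G)) :
  let delta := psi 1 / 2 in
  let A := fun (t : R) (w : T) =>
    delta * t +
    (1 - delta) * \int[lebesgue_measure]_(s in `[0, t]) (X s w ^+ 2 / s) in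
  [/\ {ae P, forall w, forall t, 0 <= t ->
        lebesgue_measure.-integrable `[0, t]%classic (fun s => (X s w ^+ 2 / s)%:E)},
      is_predictable_qv P F X A &
      forall t, 0 < t ->
        cvg_in_prob_mesh P t
          (fun n p w => \sum_(k < n)
             condexp P (fun w' => (X (p k.+1) w' - X (p k) w') ^+ 2)
               (sigma_RV (X (p k))) w)
          (A t)].
Proof.
have [G_itv01 _] := G_semigroup; have X_adapted := X_martingale.1.
move=> delta A.
have compA := bracket_compensates_square G_itv01 G_laplace psi_half F_filtration
  X_0 X_cadlag X_adapted X_markov.
split.
- apply: filterS (bracket_finite G_itv01 G_laplace psi_half F_filtration
    X_0 X_cadlag X_adapted X_markov) => w h t _.
  exact: (ratio_integrable F_filtration X_cadlag X_adapted h).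
- split; first exact: compA.
  move=> B compB; apply: (compensator_unique F_filtration _ compA compB).
  exact: (process_integrable2 F_filtration X_0 X_adapted X_markov).
- move=> t t0.
  exact: (bracket_approximation G_itv01 G_laplace psi_half F_filtration X_0
    X_cadlag X_martingale X_markov t0).
Qed.
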